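(* Let $\mathbb{P}D^2$ be the (mod-2) Pontryagin disk and let $\Gamma$ be a torsion-free group whose abelianization $\Gamma_{ab}$ is a non-trivial 2-group. Then $K(\Gamma_{ab},1)$ is an absolute extensor of $\mathbb{P}D^2$, but $K(\Gamma,1)$ is not an absolute extensor of $\mathbb{P}D^2$.
   Context: A space $M$ is an absolute extensor of a space $X$ (written $X \tau M$) if every continuous map from a closed subset of $X$ to $M$ extends to a continuous map $X \to M$. $K(G,1)$ denotes an Eilenberg–MacLane CW complex of type $(G,1)$, and $\Gamma_{ab}=\Gamma/[\Gamma,\Gamma]$. The mod-2 Pontryagin disk $\mathbb{P}D^2$ is the 2-dimensional compactum defined as the inverse limit of the following inverse sequence of compact triangulated polyhedra. The first stage is a 2-cell embedded in $\mathbb{R}^3$ with a triangulation of mesh less than $1$. Given the $k$-th stage, the $(k+1)$-th stage is obtained by removing the interior of each 2-simplex $\sigma$ and gluing in a disk along a degree 2 map from the boundary of the disk to $\partial\sigma$, and then giving the resulting space a triangulation of mesh less than $1/(k+1)$. The bonding map from the $(k+1)$-th stage to the $k$-th stage is the identity on the 1-skeleton of the $k$-th triangulation, and maps the disk attached in place of $\sigma$ onto $\sigma$: the 2-simplices in the interior of the attached disk are sent to the barycenter of $\sigma$, and the remaining collar of the disk is mapped radially onto $\sigma$. The triangulations $\lambda_i$ of the stages have meshes tending to $0$ in the sense that for every $k$ one has $\lim_{i\to\infty} \operatorname{mesh}\bigl(q^{k+i}_k(\lambda_{k+i})\bigr)=0$, where $q^{k+i}_k$ is the composed bonding map from stage $k+i$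 to stage $k$. *)

(* Defs.v *)
From HB Require Import structures.
From mathcomp Require Import all_boot all_order all_algebra generic_quotient.
From mathcomp Require Import all_classical all_reals all_analysis.
Set Implicit Arguments.
Unset Strict Implicit.
Unset Printing Implicit Defensive.
Import Order.TTheory GRing.Theory Num.Theory.
Import numFieldNormedType.Exports.
Local Open Scope classical_set_scope.
Local Open Scope ring_scope.

(* Groups may be infinite, so they are MathComp's groupType rather than
   finGroupType. *)

Definition subgroup (G : groupType) (H : set G) : Prop :=
  H 1%g /\ forall x y, H x -> H y -> H (x * y^-1)%g.

Definition commutator_subgroup (G : groupType) : set G :=
  \bigcap_(H in [set H | subgroup H /\ forall x y : G, H [~ x, y]%g]) H.

Definition torsion_free (G : groupType) : Prop :=
  forall (x : G) (n : nat), (0 < n)%N -> (x ^+ n)%g = 1%g -> x = 1%g.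

Definition two_group (G : groupType) : Prop :=
  forall x : G, exists n : nat, (x ^+ (2 ^ n))%g = 1%g.

Definition nontrivial_group (G : groupType) : Prop := exists x : G, x <> 1%g.

Section Abelianization.
Variable G : groupType.
Local Notation D := (@commutator_subgroup G).
Local Open Scope quotient_scope.

Lemma commutator_subgroupP : subgroup D.
Proof.
split; first by move=> H [[]].
by move=> x y Dx Dy H HP; apply: (HP.1).2; [exact: Dx | exact: Dy].
Qed.

Lemma commutator_subgroup1 : D 1%g.
Proof. by have [] := commutator_subgroupP. Qed.

Lemma commutator_subgroupV x : D x -> D x^-1%g.
Proof.
move=> Dx; rewrite -[(x^-1)%g]mul1g.
by have [D1 DB] := commutator_subgroupP; exact: DB.
Qed.

Lemma commutator_subgroupM x y : D x -> D y -> D (x * y)%g.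
Proof.
move=> Dx Dy; rewrite -[y]invgK.
have [_ DB] := commutator_subgroupP; apply: DB => //.
exact: commutator_subgroupV.
Qed.

Lemma commutator_subgroupR (x y : G) : D [~ x, y]%g.
Proof. by move=> H [_]; exact. Qed.

Lemma commutator_subgroupJ x y : D x -> D (x ^ y)%g.
Proof.
move=> Dx; have -> : (x ^ y = x * [~ x, y])%g by rewrite commgEl mulVKg.
exact: commutator_subgroupM (commutator_subgroupR _ _).
Qed.

Definition coset_rel (x y : G) : bool := `[< D (x^-1 * y)%g >].

Lemma coset_rel_refl : reflexive coset_rel.
Proof. by move=> x; apply/asboolP; rewrite mulVg; exact: commutator_subgroup1. Qed.

Lemma coset_rel_sym : symmetric coset_rel.
Proof.
have sub x y : coset_rel x y -> coset_rel y x.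
  move=> /asboolP/commutator_subgroupV; rewrite invgM invgK => h.
  exact/asboolP.
by move=> x y; apply/idP/idP; exact: sub.
Qed.

Lemma coset_rel_trans : transitive coset_rel.
Proof.
move=> y x z /asboolP h1 /asboolP h2; apply/asboolP.
by have := commutator_subgroupM h1 h2; rewrite mulgA mulgK.
Qed.

Canonical coset_equiv :=
  EquivRel coset_rel coset_rel_refl coset_rel_sym coset_rel_trans.

Definition abelianization := {eq_quot coset_equiv}.

HB.instance Definition _ := Choice.on abelianization.

Definition ab_pi (x : G) : abelianization := \pi_abelianization x.
Definition ab_one : abelianization := ab_pi 1%g.
Definition ab_mul (a b : abelianization) : abelianization :=
  ab_pi (repr a * repr b)%g.
Definition ab_inv (a : abelianization) : abelianization := ab_pi (repr a)^-1%g.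

Lemma ab_piP x y : ab_pi x = ab_pi y <-> D (x^-1 * y)%g.
Proof.
split=> [/eqP|h].
  by rewrite /ab_pi eqmodE => /asboolP.
by apply/eqP; rewrite /ab_pi eqmodE; exact/asboolP.
Qed.

Lemma ab_piM x y : ab_mul (ab_pi x) (ab_pi y) = ab_pi (x * y)%g.
Proof.
have h z : D ((repr (ab_pi z))^-1 * z)%g by apply/ab_piP; rewrite /ab_pi reprK.
apply/ab_piP; set x' := repr _; set y' := repr _.
have -> : ((x' * y')^-1 * (x * y) = (x'^-1 * x) ^ y' * (y'^-1 * y))%g.
  by rewrite conjgE invgM !mulgA mulgK.
apply: commutator_subgroupM; last exact: h.
by apply: commutator_subgroupJ; exact: h.
Qed.

Lemma ab_piV x : ab_inv (ab_pi x) = ab_pi x^-1%g.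
Proof.
have h : D ((repr (ab_pi x))^-1 * x)%g by apply/ab_piP; rewrite /ab_pi reprK.
apply/ab_piP; set x' := repr _ in h *; rewrite invgK.
have -> : (x' * x^-1 = ((x'^-1 * x)^-1) ^ x'^-1)%g.
  by rewrite conjgE invgM !invgK !mulgA mulgK.
by apply: commutator_subgroupJ; exact: commutator_subgroupV.
Qed.

Lemma ab_pi_surj (a : abelianization) : exists x, a = ab_pi x.
Proof. by exists (repr a); rewrite /ab_pi reprK. Qed.

Lemma ab_mulA : associative ab_mul.
Proof.
move=> a b c; have [x ->] := ab_pi_surj a; have [y ->] := ab_pi_surj b.
by have [z ->] := ab_pi_surj c; rewrite !ab_piM mulgA.
Qed.

Lemma ab_mul1 : left_id ab_one ab_mul.
Proof. by move=> a; have [x ->] := ab_pi_surj a; rewrite ab_piM mul1g. Qed.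

Lemma ab_mulr1 : right_id ab_one ab_mul.
Proof. by move=> a; have [x ->] := ab_pi_surj a; rewrite ab_piM mulg1. Qed.

Lemma ab_mulV : left_inverse ab_one ab_inv ab_mul.
Proof.
by move=> a; have [x ->] := ab_pi_surj a; rewrite ab_piV ab_piM mulVg.
Qed.

Lemma ab_mulrV : right_inverse ab_one ab_inv ab_mul.
Proof.
by move=> a; have [x ->] := ab_pi_surj a; rewrite ab_piV ab_piM mulgV.
Qed.

HB.instance Definition _ := isGroup.Build abelianization
  ab_mulA ab_mul1 ab_mulr1 ab_mulV ab_mulrV.

End Abelianization.

Definition absolute_extensor (X M : topologicalType) : Prop :=
  forall A : set X, closed A -> forall f : A -> M, continuous f ->
  exists2 g : X -> M, continuous g & forall a : A, g (\val a) = f a.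

Definition homeo_on (T U : topologicalType) (A : set T) (B : set U)
    (f : T -> U) : Prop :=
  exists g : U -> T,
  [/\ {within A, continuous f} /\ {within B, continuous g},
      forall x, A x -> B (f x) /\ g (f x) = x
    & forall y, B y -> A (g y) /\ f (g y) = y].

Section Euclidean.
Variable R : realType.

Definition sqnorm n (x : 'rV[R]_n) : R := \sum_i x ord0 i ^+ 2.
Definition disk n : set 'rV[R]_n := [set x | sqnorm x <= 1].
Definition open_disk n : set 'rV[R]_n := [set x | sqnorm x < 1].
Definition sphere n : set 'rV[R]_n := [set x | sqnorm x = 1].

Definition cube n : set 'rV[R]_n := [set x | forall i, 0 <= x ord0 i <= 1].
Definition cube_boundary n : set 'rV[R]_n :=
  [set x | cube x /\ exists i, x ord0 i = 0 \/ x ord0 i = 1].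

Definition circle_point (t : R) : 'rV[R]_2 :=
  \row_j (if j == ord0 then cos (2 * pi * t) else sin (2 * pi * t)).

(* [f] restricts to a map of degree 2 from the unit circle to the simple closed
   curve [C].  Since [phi] is an arbitrary homeomorphism onto [C], no orientation
   of [C] is singled out; [theta] is a lift of [phi^-1 \o f] along
   [circle_point]. *)
Definition degree_two (T : topologicalType) (C : set T) (f : 'rV[R]_2 -> T) :=
  exists (phi : 'rV[R]_2 -> T) (theta : R -> R),
  [/\ homeo_on (@sphere 2) C phi,
      {within `[0, 1], continuous theta},
      (forall t, 0 <= t <= 1 ->
         f (circle_point t) = phi (circle_point (theta t)))
    & theta 1 - theta 0 = 2].

End Euclidean.

Section Homotopy.
Variables (R : realType) (X : topologicalType).

Definition path_connected : Prop :=
  (exists x : X, True) /\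
  forall x y : X, exists f : R -> X,
    [/\ {within `[0, 1], continuous f}, f 0 = x & f 1 = y].

Definition loop (x0 : X) (f : R -> X) : Prop :=
  [/\ {within `[0, 1], continuous f}, f 0 = x0 & f 1 = x0].

Definition loop_homotopic (x0 : X) (f g : R -> X) : Prop :=
  exists H : R * R -> X,
    {within `[0, 1] `*` `[0, 1], continuous H} /\
    forall s, 0 <= s <= 1 ->
      [/\ H (s, 0) = f s, H (s, 1) = g s, H (0, s) = x0 & H (1, s) = x0].

Definition loop_cat (f g : R -> X) (s : R) : X :=
  if s <= 2^-1 then f (2 * s) else g (2 * s - 1).

(* pi_1(X, x0) is the group of homotopy classes of loops at x0; an isomorphism
   onto G is given here by its composite [phi] with the map sending a loop to
   its class. *)
Definition pi1_isomorphic (x0 : X) (G : groupType) : Prop :=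
  exists phi : (R -> X) -> G,
  [/\ forall a : G, exists2 f, loop x0 f & phi f = a,
      forall f g, loop x0 f -> loop x0 g ->
        (phi f = phi g <-> loop_homotopic x0 f g)
    & forall f g, loop x0 f -> loop x0 g ->
        phi (loop_cat f g) = (phi f * phi g)%g].

Definition pi_trivial (n : nat) (x0 : X) : Prop :=
  forall f : 'rV[R]_n -> X,
  {within @cube R n, continuous f} ->
  (forall u, cube_boundary u -> f u = x0) ->
  exists H : 'rV[R]_n * R -> X,
  [/\ {within @cube R n `*` `[0, 1], continuous H},
      forall u, cube u -> H (u, 0) = f u /\ H (u, 1) = x0
    & forall u t, cube_boundary u -> 0 <= t <= 1 -> H (u, t) = x0].

(* Whitehead's definition.  Since X is Hausdorff, [cw_unique] and [cw_boundary]
   make each characteristic map a homeomorphism from the open disk onto an open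
   cell. *)
Record cw_structure := CWStructure {
  cw_cell : nat -> Type;
  cw_map : forall n, cw_cell n -> 'rV[R]_n -> X;
  cw_hausdorff : hausdorff_space X;
  cw_continuous : forall n (e : cw_cell n),
    {within @disk R n, continuous (cw_map e)};
  cw_cover : forall x : X, exists n (e : cw_cell n) u,
    open_disk u /\ cw_map e u = x;
  cw_unique : forall n (e : cw_cell n) u m (e' : cw_cell m) v,
    open_disk u -> open_disk v -> cw_map e u = cw_map e' v ->
    existT (fun k => (cw_cell k * 'rV[R]_k)%type) n (e, u) =
    existT (fun k => (cw_cell k * 'rV[R]_k)%type) m (e', v);
  cw_boundary : forall n (e : cw_cell n),
    exists (N : nat) (c : 'I_N -> {m : nat & cw_cell m}),
      (forall j, (tag (c j) < n)%N) /\
      forall u, sphere u -> exists j v,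
        open_disk v /\ cw_map (tagged (c j)) v = cw_map e u;
  cw_weak : forall A : set X,
    (forall n (e : cw_cell n), closed (@disk R n `&` cw_map e @^-1` A)) ->
    closed A
}.

End Homotopy.

Definition eilenberg_maclane1 (R : realType) (G : groupType)
    (K : topologicalType) : Prop :=
  [/\ inhabited (cw_structure R K),
      path_connected R K,
      forall x0 : K, pi1_isomorphic R x0 G
    & forall (n : nat) (x0 : K), (2 <= n)%N -> pi_trivial R n x0].

Section Simplices.
Variables (R : realType) (n : nat).
Implicit Types (s : {set 'I_n}) (K : {set {set 'I_n}}).

Definition simplex s : set 'rV[R]_n :=
  [set x | [/\ forall i, 0 <= x ord0 i, \sum_i x ord0 i = 1
             & forall i, i \notin s -> x ord0 i = 0]].

Definition simplex_boundary s : set 'rV[R]_n :=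
  [set x | simplex s x /\ exists2 i, i \in s & x ord0 i = 0].

Definition barycenter s : 'rV[R]_n :=
  \row_i (if i \in s then (#|s|%:R)^-1 else 0).

Definition realization K : set 'rV[R]_n := \bigcup_(s in [set` K]) simplex s.

Definition skeleton1 K : {set {set 'I_n}} := [set s in K | (#|s| <= 2)%N].

(* Finite abstract simplicial complex of dimension at most 2; an i-simplex has
   i + 1 vertices. *)
Definition complex2 K : Prop :=
  forall s, s \in K ->
    (0 < #|s| <= 3)%N /\ forall t : {set 'I_n}, t \subset s -> (0 < #|t|)%N -> t \in K.

End Simplices.

Arguments simplex R {n} s _.
Arguments simplex_boundary R {n} s _.
Arguments barycenter R {n} s.
Arguments realization R {n} K _.

Record triangulation (R : realType) (P : topologicalType) := Triangulation {
  tri_size : nat;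
  tri_complex : {set {set 'I_tri_size}};
  tri_map : 'rV[R]_tri_size -> P;
  tri_complexP : complex2 tri_complex;
  tri_homeo : homeo_on (realization R tri_complex) setT tri_map
}.

Arguments tri_map {R P} t _.

Section Mesh.
Variables (R : realType).

Definition tri_cell (P : topologicalType) (L : triangulation R P)
  (s : {set 'I_(tri_size L)}) : set P := tri_map L @` simplex R s.

(* Mesh of the family of images under g of the simplices of L, i.e. the largest
   of their diameters. *)
Definition mesh (P : topologicalType) (L : triangulation R P)
    (Q : metricType R) (g : P -> Q) : R :=
  sup [set d | exists s x y, [/\ s \in tri_complex L,
    @tri_cell P L s x, @tri_cell P L s y & d = mdist (g x) (g y)]].

End Mesh.

Arguments tri_cell {R P} L s _.

Section Bond.
Variables (R : realType) (P P' : topologicalType).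
Variables (L : triangulation R P) (L' : triangulation R P').

Local Notation V := 'rV[R]_(tri_size L).

Definition skel1 : set V := realization R (skeleton1 (tri_complex L)).

Definition is_tri (s : {set 'I_(tri_size L)}) : Prop :=
  s \in tri_complex L /\ #|s| = 3%N.

(* P' is the quotient of the disjoint union of the 1-skeleton of L and of one
   disk for each 2-simplex s of L by u ~ att s u (u in the boundary circle); inc
   and att_disk s are the restrictions of the quotient map to the summands. *)
Definition is_attachment (att : {set 'I_(tri_size L)} -> 'rV[R]_2 -> V)
    (inc : V -> P') (att_disk : {set 'I_(tri_size L)} -> 'rV[R]_2 -> P')
    : Prop :=
  [/\ (forall z : P', (exists2 y, skel1 y & inc y = z) \/
         exists s u, [/\ is_tri s, disk u & att_disk s u = z]),
      (forall A : set P', closed A <->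
         closed (skel1 `&` inc @^-1` A) /\
         forall s, is_tri s -> closed (@disk R 2 `&` att_disk s @^-1` A)),
      (forall y y', skel1 y -> skel1 y' -> inc y = inc y' -> y = y'),
      (forall s u, is_tri s -> sphere u -> att_disk s u = inc (att s u))
    & (forall s u, is_tri s -> open_disk u ->
         (forall y, skel1 y -> att_disk s u <> inc y) /\
         (forall s' u', is_tri s' -> open_disk u' ->
            att_disk s u = att_disk s' u' -> s = s' /\ u = u'))].

Definition disk_core (D : 'rV[R]_2 -> P') : set P' :=
  [set z | exists s, [/\ s \in tri_complex L', #|s| = 3%N,
     tri_cell L' s `<=` D @` @open_disk R 2 & tri_cell L' s z]].

(* The step from P to P': the 2-simplices of L are replaced by disks attached
   along maps of degree 2, the result P' is triangulated by L' so that the old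
   1-skeleton is a union of simplices, and q is the bonding map.  For each
   2-simplex s, [collar s] parametrizes by (circle) x [0, 1[ the complement in
   the disk of the 2-simplices of L' lying in its interior; in these
   coordinates q is radial, from the boundary (t = 0) towards the barycenter
   of s (t -> 1). *)
Definition pontryagin_step (q : P' -> P) : Prop :=
  exists (att : {set 'I_(tri_size L)} -> 'rV[R]_2 -> V)
         (inc : V -> P') (att_disk : {set 'I_(tri_size L)} -> 'rV[R]_2 -> P')
         (collar : {set 'I_(tri_size L)} -> 'rV[R]_2 * R -> 'rV[R]_2),
  [/\ (forall s, is_tri s -> {within @sphere R 2, continuous (att s)} /\
         degree_two (simplex_boundary R s) (att s)),
      is_attachment att inc att_disk,
      (forall y, skel1 y -> exists s, [/\ s \in tri_complex L',
         tri_cell L' s `<=` inc @` skel1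
         & tri_cell L' s (inc y)]),
      continuous q /\ (forall y, skel1 y -> q (inc y) = tri_map L y)
    & forall s, is_tri s ->
      [/\ (forall z, disk_core (att_disk s) z ->
             q z = tri_map L (barycenter R s)),
          homeo_on (@sphere R 2 `*` (`[0, 1[ : set R))
            (@disk R 2 `\` att_disk s @^-1` disk_core (att_disk s)) (collar s),
          (forall u, sphere u -> collar s (u, 0) = u)
        & (forall u t, sphere u -> 0 <= t < 1 ->
             q (att_disk s (collar s (u, t))) =
             tri_map L ((1 - t) *: att s u + t *: barycenter R s))]].

End Bond.

Fixpoint bond_iter (T : nat -> Type) (q : forall k, T k.+1 -> T k) (k i : nat) :
    T (i + k)%N -> T k :=
  match i with
  | 0 => fun x => x
  | i'.+1 => fun x => bond_iter q (q (i' + k)%N x)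
  end.

(* Stages are numbered from 0, so the mesh bound at stage k is 1/(k+1). *)
Record pontryagin_sequence (R : realType) := PontryaginSequence {
  pd_stage : nat -> metricType R;
  pd_tri : forall k, triangulation R (pd_stage k);
  pd_bond : forall k, pd_stage k.+1 -> pd_stage k;
  pd_disk : exists f : 'rV[R]_2 -> pd_stage 0,
    homeo_on (@disk R 2) setT f;
  pd_embedded : exists e : pd_stage 0 -> 'rV[R]_3,
    forall x y, mdist x y = Num.sqrt (sqnorm (e x - e y));
  pd_mesh : forall k, mesh (pd_tri k) (@idfun (pd_stage k)) < k.+1%:R^-1;
  pd_step : forall k, pontryagin_step (pd_tri k) (pd_tri k.+1) (@pd_bond k);
  pd_mesh_lim : forall k,
    mesh (pd_tri (i + k)%N) (@bond_iter pd_stage pd_bond k i) @[i --> \oo]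
      --> (0 : R)
}.

Definition inverse_limit (T : nat -> topologicalType)
    (q : forall k, T k.+1 -> T k) : topologicalType :=
  set_type [set x : prod_topology T | forall k, q k (x k.+1) = x k].

Definition pontryagin_disk (R : realType) (S : pontryagin_sequence R)
    : topologicalType :=
  inverse_limit (T := fun k => pd_stage S k) (@pd_bond R S).

(* Main.v *)
(* Finite CW complexes are neighbourhood retracts, so a map into [K] from a closed
   subset [A] of the Pontryagin disk extends to a neighbourhood of [A].  Hence, for
   [k] large, it extends to the cylinder (the preimage) of every simplex of stage
   [k] whose cylinder meets [A], and over the remaining edges by paths in [K].
   There remains the cylinder of a triangle [s], with a map given on the boundary
   of [s]; its class [c] satisfies [c ^ (2 ^ m) = 1] when pi_1 is a 2-group.  If
   [m = 0] the map extends over [s].  Otherwise [s] is replaced, at stage [k + 1],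
   by a disk attached along a map of degree 2; pushing this disk, punctured by a
   small triangle [s'], onto its boundary gives an extension outside the cylinder
   of [s'] for which the class on the boundary of [s'] is a power of [c ^ 2], and
   one concludes by induction on [m].

   Conversely, given a map [g] from the Pontryagin disk to [K], for [k] large the
   restriction of [g] to the 1-skeleton of stage [k] extends over stage [k].  If
   this holds for [k + 1], the extension over the disk attached in place of a
   triangle [s] shows that the class of [g] on the boundary of [s] has trivial
   square; when pi_1 is torsion-free it is therefore trivial, and the property
   holds for [k].  Thus [g] is null-homotopic on the boundary of each triangle of
   stage 0, where any element of pi_1 could be prescribed. *)

Require Import Defs.
From HB Require Import structures.
From mathcomp Require Import all_boot all_order all_algebra.
From mathcomp Require Import all_classical all_reals all_analysis.
From mathcomp Require Import ring lra.
Set Implicit Arguments.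
Unset Strict Implicit.
Unset Printing Implicit Defensive.
Import Order.TTheory GRing.Theory Num.Theory.
Import numFieldNormedType.Exports.
Local Open Scope classical_set_scope.
Local Open Scope ring_scope.

(** * Continuity within a subset *)

(** Two obstacles shape the proof. Elements of pi_1 live at base points, while circle maps and
    boundaries of triangles come without one, and even the orientation of a boundary is left open.
    Conditions on powers of a class are therefore stated as [bounds_disk]: the N-fold circle map
    extends over the disk, a property in which no base point occurs. Secondly, some combinatorial
    facts are consequences rather than data. That the old 1-skeleton stays in the new one, and that
    stage 0 has a triangle at all, follow because a square does not embed in a graph; that an
    attached disk contains a triangle in its interior follows from compactness of the disk.
    Neighbourhood retractions are built one cell at a time: attaching a cell enlarges the ambient
    normed space by the factors R and R^n, and Tietze's theorem passes to such products. *)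

Lemma within_closedP (X Y : topologicalType) (A : set X) (f : X -> Y) : closed A ->
  {within A, continuous f} <->
  forall C, closed C -> closed (A `&` f @^-1` C).
Proof.
move=> cA; split=> [/continuous_closedP cf C /cf cC|cf].
  by rewrite closed_setSI.
by apply/continuous_closedP => C cC; rewrite -closed_setSI//; exact: cf.
Qed.

Lemma withinP (X Y : topologicalType) (A : set X) (f : X -> Y) :
  {within A, continuous f} <->
  forall x, A x -> forall U, open U -> U (f x) ->
    exists V, [/\ open V, V x & forall y, V y -> A y -> U (f y)].
Proof.
split=> [/subspace_continuousP cf x Ax U oU Ux|cf].
  have := cf x Ax U (open_nbhs_nbhs (conj oU Ux)).
  rewrite /= nbhs_simpl /= /within /= nbhsE => -[V [oV Vx] VU].
  by exists V; split => // y /VU.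
apply/subspace_continuousP => x Ax U; rewrite nbhsE => -[W [oW Wx] WU].
have [V [oV Vx VW]] := cf x Ax W oW Wx.
rewrite /= nbhs_simpl /= /within /= nbhsE.
by exists V => // y Vy Ay; apply/WU/VW.
Qed.

Lemma within_ext (X Y : topologicalType) (A : set X) (f g : X -> Y) : (forall x, A x -> f x = g x) ->
  {within A, continuous f} -> {within A, continuous g}.
Proof.
move=> fg; apply: subspace_eq_continuous => x; rewrite inE => Ax.
exact: fg.
Qed.

Lemma within_comp (X Y Z : topologicalType) (A : set X) (B : set Y) (f : X -> Y) (g : Y -> Z) :
  (forall x, A x -> B (f x)) -> {within A, continuous f} ->
  {within B, continuous g} -> {within A, continuous (g \o f)}.
Proof.
move=> AB /withinP cf /withinP cg; apply/withinP => x Ax U oU Ux.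
have [V [oV Vx VU]] := cg _ (AB _ Ax) U oU Ux.
have [W [oW Wx WV]] := cf _ Ax V oV Vx.
by exists W; split => // y Wy Ay; apply: VU; [exact: WV|exact: AB].
Qed.

Lemma within_pair (X Y Z : topologicalType) (A : set X) (f : X -> Y) (g : X -> Z) :
  {within A, continuous f} -> {within A, continuous g} ->
  {within A, continuous (fun x => (f x, g x))}.
Proof. by move=> cf cg x; apply: cvg_pair; [exact: cf|exact: cg]. Qed.

(** A continuous map from a compact set to a Hausdorff space is closed onto its image, hence a
    quotient map. This is the device by which maps are defined below on images of non-injective
    parametrizations. *)
Lemma within_quotient (X Y Z : topologicalType) (A : set X) (f : X -> Y) (g : Y -> Z) :
  compact A -> hausdorff_space Y -> {within A, continuous f} ->
  {within A, continuous (g \o f)} -> {within f @` A, continuous g}.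
Proof.
move=> kA hY cf cgf; have kfA := continuous_compact cf kA.
apply/within_closedP; first exact: compact_closed.
move=> C cC; move/continuous_closedP/(_ C cC)/closed_subspaceP : (cgf).
move=> -[V cV VA]; apply: compact_closed => //.
have -> : f @` A `&` g @^-1` C = f @` (V `&` A).
  rewrite VA; apply/seteqP; split=> [_ [[x Ax <-] Cgf]|_ [x [Cgf Ax] <-]].
    by exists x.
  by split=> //; exists x.
apply: continuous_compact; last by rewrite setIC; exact: compact_closedI.
by apply: continuous_subspaceW cf => x [].
Qed.

Lemma within_cover (X Y : topologicalType) (I : finType) (P : set I)
    (A : I -> set X) (B : set X) (f : X -> Y) :
  (forall i, P i -> closed (A i)) ->
  (forall i, P i -> {within A i, continuous f}) ->
  (forall x, B x -> exists2 i, P i & A i x) -> {within B, continuous f}.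
Proof.
move=> cA cf BA; pose U := \bigcup_(i in P) A i.
have finP : finite_set P by exact: finite_finset.
have cU : closed U by apply: closed_bigcup.
apply: (@continuous_subspaceW _ _ _ U) => [x /BA[i Pi Aix]|]; first by exists i.
apply/within_closedP => // C cC; rewrite setI_bigcupl.
apply: closed_bigcup => // i Pi.
by have /within_closedP := cf i Pi; apply; [exact: cA|].
Qed.

Lemma within_setT (X Y : topologicalType) (f : X -> Y) :
  {within setT, continuous f} <-> continuous f.
Proof. by rewrite continuous_subspace_setT. Qed.

Lemma within_at (X Y : topologicalType) (A O : set X) (f : X -> Y) :
  open O -> A `<=` O -> (forall x, O x -> {for x, continuous f}) ->
  {within A, continuous f}.
Proof.
by move=> oO AO cf; apply: continuous_in_subspaceT => x; rewrite inE => /AO/cf.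
Qed.

Lemma within_compT (X Y Z : topologicalType) (A : set X) (f : X -> Y)
    (g : Y -> Z) : {within A, continuous f} -> continuous g ->
  {within A, continuous (fun x => g (f x))}.
Proof.
by move=> cf cg; apply: (within_comp (B := setT)) => //; exact/within_setT.
Qed.

Lemma fst_continuous (X Y : topologicalType) : continuous (@fst X Y).
Proof. by move=> x; exact: cvg_fst. Qed.

Lemma snd_continuous (X Y : topologicalType) : continuous (@snd X Y).
Proof. by move=> x; exact: cvg_snd. Qed.

Lemma fst_snd_continuous (X Y Z : topologicalType) :
  continuous (fun p : X * (Y * Z) => p.2.1).
Proof.
by move=> p; apply: continuous_comp; [exact: cvg_snd|exact: cvg_fst].
Qed.

Lemma snd_snd_continuous (X Y Z : topologicalType) :
  continuous (fun p : X * (Y * Z) => p.2.2).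
Proof. by move=> p; apply: continuous_comp; exact: cvg_snd. Qed.

Lemma closed_preimage (X Y : topologicalType) (f : X -> Y) (D : set Y) :
  continuous f -> closed D -> closed (f @^-1` D).
Proof. by move=> cf; apply: preimage_closed => x _; exact: cf. Qed.

Lemma closed_equalizer (X Y : topologicalType) (f g : X -> Y) :
  hausdorff_space Y -> continuous f -> continuous g ->
  closed [set x | f x = g x].
Proof.
move=> hY cf cg; rewrite -[X in closed X]setCK; apply: open_closedC.
rewrite openE => x /= fg; move: hY; rewrite open_hausdorff => hY.
have [|[U W] [/set_mem Ux /set_mem Wx] [oU oW UW]] := hY (f x) (g x).
  exact/eqP.
have fU : nbhs x (f @^-1` U) := cf x _ (open_nbhs_nbhs (conj oU Ux)).
have gW : nbhs x (g @^-1` W) := cg x _ (open_nbhs_nbhs (conj oW Wx)).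
move: fU gW; apply: filterS2 => z /= Uz Wz zz.
have UWz : (U `&` W) (g z) by split=> //; rewrite -zz.
by move/eqP/seteqP : UW => [UW _]; exact: (UW _ UWz).
Qed.

(** * Euclidean disks and spheres *)

Section EuclideanNorm.
Variable R : realType.

Lemma rV_continuous (T : topologicalType) n (f : T -> 'rV[R]_n) :
  (forall i, continuous (fun x => f x ord0 i)) -> continuous f.
Proof.
move=> cf x A [P fxP PA] /=; rewrite nbhs_simpl /=.
have : \forall y \near x, forall i, P ord0 i (f y ord0 i).
  by apply: filter_forall => i; exact: (cf i x _ (fxP ord0 i)).
by apply: filterS => y Py; apply: PA => i j; rewrite (ord1 i).
Qed.

Lemma sum_continuous (T : topologicalType) (I : Type) (r : seq I)
    (f : I -> T -> R) :
  (forall i, continuous (f i)) -> continuous (fun x => \sum_(i <- r) f i x).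
Proof.
move=> cf; elim: r => [|i r IH] x.
  rewrite (_ : (fun _ => _) = cst 0); first exact: cvg_cst.
  by apply/funext => y; rewrite big_nil.
rewrite (_ : (fun _ => _) = (fun y => f i y + \sum_(j <- r) f j y)).
  by apply: cvgD; [exact: cf|exact: IH].
by apply/funext => y; rewrite big_cons.
Qed.

Variable n : nat.

Lemma rV_hausdorff : hausdorff_space 'rV[R]_n.
Proof. exact: (@norm_hausdorff R 'rV[R]_n). Qed.

Implicit Types u v : 'rV[R]_n.

Definition nrm u : R := Num.sqrt (sqnorm u).

Lemma sqnorm_ge0 u : 0 <= sqnorm u.
Proof. by apply: sumr_ge0 => i _; exact: sqr_ge0. Qed.

Lemma sqnormZ (c : R) u : sqnorm (c *: u) = c ^+ 2 * sqnorm u.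
Proof. by rewrite /sqnorm mulr_sumr; apply: eq_bigr => i _; rewrite mxE exprMn. Qed.

Lemma nrm_ge0 u : 0 <= nrm u. Proof. exact: sqrtr_ge0. Qed.

Lemma sqr_nrm u : nrm u ^+ 2 = sqnorm u.
Proof. by rewrite sqr_sqrtr// sqnorm_ge0. Qed.

Lemma nrmZ (c : R) u : nrm (c *: u) = `|c| * nrm u.
Proof. by rewrite /nrm sqnormZ sqrtrM ?sqr_ge0// sqrtr_sqr. Qed.

Lemma nrm_eq0 u : nrm u = 0 -> u = 0.
Proof.
move=> /(congr1 (fun x => x ^+ 2)); rewrite sqr_nrm expr0n /= => /eqP.
rewrite psumr_eq0 => [/allP u0|i _]; last exact: sqr_ge0.
apply/rowP => i; rewrite mxE.
by have := u0 i; rewrite mem_index_enum sqrf_eq0 => /(_ isT)/eqP.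
Qed.

Lemma nrm0 : nrm 0 = 0.
Proof. by rewrite -(scale0r 0) nrmZ normr0 mul0r. Qed.

Lemma disk_nrm u : disk u <-> nrm u <= 1.
Proof.
rewrite /disk /= -sqr_nrm -[X in _ <= X](expr1n _ 2).
by rewrite ler_pXn2r// nnegrE ?nrm_ge0.
Qed.

Lemma open_disk_nrm u : open_disk u <-> nrm u < 1.
Proof.
rewrite /open_disk /= -sqr_nrm -[X in _ < X](expr1n _ 2).
by rewrite ltr_pXn2r// nnegrE ?nrm_ge0.
Qed.

Lemma sphere_nrm u : sphere u <-> nrm u = 1.
Proof.
rewrite /sphere /= -sqr_nrm; split=> [/eqP|->]; last by rewrite expr1n.
by rewrite sqrf_eq1 => /orP[/eqP//|/eqP h]; have := nrm_ge0 u; rewrite h; lra.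
Qed.

Lemma disk_split u : disk u -> open_disk u \/ sphere u.
Proof. by rewrite /disk /= le_eqVlt => /orP[/eqP ?|?]; [right|left]. Qed.

Lemma open_disk_disk u : open_disk u -> disk u.
Proof. exact: ltW. Qed.

Lemma sphere_disk u : sphere u -> disk u.
Proof. by rewrite /sphere /disk /= => ->. Qed.

Lemma sphere_open_disk u : sphere u -> open_disk u -> False.
Proof. by rewrite /sphere /open_disk /= => ->; rewrite ltxx. Qed.

Lemma sphere_normalize u : 0 < nrm u -> sphere ((nrm u)^-1 *: u).
Proof.
move=> u0; apply/sphere_nrm.
by rewrite nrmZ ger0_norm ?invr_ge0 ?nrm_ge0// mulVf// gt_eqF.
Qed.

Lemma sqnorm_continuous : continuous (@sqnorm R n).
Proof.
rewrite /sqnorm; apply: sum_continuous => i x.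
rewrite (_ : (fun _ => _) = fun y : 'rV[R]_n => y ord0 i * y ord0 i).
  have c := @coord_continuous R 1 n ord0 i x; exact: (cvgM c c).
by apply/funext => y; rewrite expr2.
Qed.

Lemma nrm_continuous : continuous nrm.
Proof.
move=> x; apply: continuous_comp; [exact: sqnorm_continuous|].
exact: sqrt_continuous.
Qed.

Lemma disk_closed : closed (@disk R n).
Proof.
have -> : @disk R n = @sqnorm R n @^-1` [set x | x <= 1] by [].
apply: preimage_closed (@closed_le R 1) => x _; exact: sqnorm_continuous.
Qed.

Lemma sphere_closed : closed (@sphere R n).
Proof.
have -> : @sphere R n = @sqnorm R n @^-1` [set 1] by [].
apply: preimage_closed (@closed_eq R 1) => x _; exact: sqnorm_continuous.
Qed.

Lemma coord_le_nrm u i : `|u ord0 i| <= nrm u.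
Proof.
rewrite -(ler_pXn2r (ltn0Sn 1)) ?nnegrE ?nrm_ge0// sqr_nrm real_normK ?num_real//.
by rewrite /sqnorm (bigD1 i)//= lerDl; apply: sumr_ge0 => j _; exact: sqr_ge0.
Qed.

Lemma rV_norm_le u (M : R) : 0 <= M -> (forall i, `|u ord0 i| <= M) -> `|u| <= M.
Proof.
move=> M0 uM; rewrite [`|u|]mx_normrE; apply: bigmax_le => // -[i j] _ /=.
by rewrite (ord1 i).
Qed.

Lemma rV_bounded_compact (A : set 'rV[R]_n) (M : R) : closed A ->
  (forall u i, A u -> `|u ord0 i| <= M) -> compact A.
Proof.
move=> cA AM; apply: bounded_closed_compact => //.
exists (Num.max M 0); split; first exact: num_real.
move=> N MN u Au; apply: rV_norm_le; first by rewrite (le_trans _ (ltW MN))// le_max lexx orbT.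
by move=> i; apply: le_trans (AM _ _ Au) _; apply: ltW (le_lt_trans _ MN); rewrite le_max lexx.
Qed.

Lemma disk_compact : compact (@disk R n).
Proof.
apply: (@rV_bounded_compact _ 1) disk_closed _ => u i /disk_nrm u1.
exact: le_trans (coord_le_nrm _ _) u1.
Qed.

Lemma sphere_compact : compact (@sphere R n).
Proof. exact: subclosed_compact sphere_closed disk_compact (@sphere_disk). Qed.

Lemma disk_convex u v (t : R) : 0 <= t <= 1 -> disk u -> disk v ->
  disk ((1 - t) *: u + t *: v).
Proof.
case/andP=> t0 t1; rewrite /disk /= => u1 v1.
have : sqnorm ((1 - t) *: u + t *: v) <= (1 - t) * sqnorm u + t * sqnorm v.
  rewrite /sqnorm !mulr_sumr -big_split /=; apply: ler_sum => i _.
  rewrite !mxE -subr_ge0; set a := u _ _; set b := v _ _.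
  have -> : (1 - t) * a ^+ 2 + t * b ^+ 2 - ((1 - t) * a + t * b) ^+ 2 =
    t * (1 - t) * (a - b) ^+ 2 by ring.
  by apply: mulr_ge0 (sqr_ge0 _); apply: mulr_ge0; rewrite ?subr_ge0.
move/le_trans; apply.
have a1 : (1 - t) * sqnorm u <= (1 - t) * 1 by rewrite ler_wpM2l// subr_ge0.
have a2 : t * sqnorm v <= t * 1 by rewrite ler_wpM2l.
by rewrite (le_trans (lerD a1 a2))// !mulr1 subrK.
Qed.

End EuclideanNorm.

Section WithinAlgebra.
Variables (R : realType) (V : normedModType R) (T : topologicalType) (A : set T).

Lemma withinD (f g : T -> V) : {within A, continuous f} ->
  {within A, continuous g} -> {within A, continuous (fun x => f x + g x)}.
Proof. by move=> cf cg x; exact: (cvgD (cf x) (cg x)). Qed.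

Lemma withinB (f g : T -> V) : {within A, continuous f} ->
  {within A, continuous g} -> {within A, continuous (fun x => f x - g x)}.
Proof. by move=> cf cg x; exact: (cvgB (cf x) (cg x)). Qed.

Lemma withinZ (s : T -> R) (f : T -> V) : {within A, continuous s} ->
  {within A, continuous f} -> {within A, continuous (fun x => s x *: f x)}.
Proof. by move=> cs cf x; exact: (cvgZ (cs x) (cf x)). Qed.

Lemma within_cst (U : topologicalType) (c : U) :
  {within A, continuous (fun=> c)}.
Proof. by apply: continuous_subspaceT; exact: cst_continuous. Qed.

End WithinAlgebra.

(** * Tietze extension and neighbourhood retracts *)

Section Tietze.
Variable R : realType.

Lemma cvg_maxr (T : Type) (F : set_system T) (FF : Filter F) (f g : T -> R)
    (a b : R) : f @ F --> a -> g @ F --> b ->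
  (fun x => Num.max (f x) (g x)) @ F --> Num.max a b.
Proof.
move=> fa gb; rewrite maxr_absE.
rewrite (_ : (fun _ => _) = fun x => (f x + g x + `|f x - g x|) / 2); last first.
  by apply/funext => x; rewrite maxr_absE.
by apply: cvgMr_tmp; apply: cvgD; [exact: cvgD|apply: cvg_norm; exact: cvgB].
Qed.

Lemma cvg_minr (T : Type) (F : set_system T) (FF : Filter F) (f g : T -> R)
    (a b : R) : f @ F --> a -> g @ F --> b ->
  (fun x => Num.min (f x) (g x)) @ F --> Num.min a b.
Proof.
move=> fa gb; rewrite minr_absE.
rewrite (_ : (fun _ => _) = fun x => (f x + g x - `|f x - g x|) / 2); last first.
  by apply/funext => x; rewrite minr_absE.
by apply: cvgMr_tmp; apply: cvgB; [exact: cvgD|apply: cvg_norm; exact: cvgB].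
Qed.

Lemma continuous_at_bound (T : topologicalType) (E : normedModType R)
    (f : T -> E) (b : T -> R) (x : T) : {for x, continuous b} -> b x = 0 ->
  (forall y, `|f y - f x| <= b y) -> {for x, continuous f}.
Proof.
move=> cb b0 fb; apply/cvgrPdist_lt => e e0.
have := @cvgr_lt R T (nbhs x) (nbhs_filter x) b (b x) cb e; rewrite b0 => /(_ e0).
by apply: filterS => y; rewrite distrC; apply: le_lt_trans.
Qed.

Lemma continuous_at_near (T U : topologicalType) (f g : T -> U) (x : T) :
  (\forall y \near x, f y = g y) -> {for x, continuous g} ->
  {for x, continuous f}.
Proof.
move=> fg cg A; rewrite (nbhs_singleton fg) => /cg gA.
have {}gA : nbhs x (g @^-1` A) := gA.
suff : nbhs x (f @^-1` A) by [].
by move: fg gA; apply: filterS2 => y /= ->.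
Qed.

Lemma continuous_at_if (T U : topologicalType) (P : T -> bool) (f g : T -> U)
    (x : T) : f x = g x -> {for x, continuous f} -> {for x, continuous g} ->
  {for x, continuous (fun y => if P y then f y else g y)}.
Proof.
move=> fg cf cg A /=; have -> : (if P x then f x else g x) = f x by case: ifP.
move=> fA; have gA := fA; rewrite fg in gA.
have {}fA : nbhs x (f @^-1` A) := cf _ fA.
have {}gA : nbhs x (g @^-1` A) := cg _ gA.
suff : nbhs x ((fun y => if P y then f y else g y) @^-1` A) by [].
by move: fA gA; apply: filterS2 => y /= Af Ag; case: ifP.
Qed.

Lemma continuous_at_max (T : topologicalType) (f g : T -> R) (x : T) :
  {for x, continuous f} -> {for x, continuous g} ->
  {for x, continuous (fun y => Num.max (f y) (g y))}.
Proof. by move=> cf cg; exact: cvg_maxr. Qed.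

Lemma continuous_at_pair (T U V : topologicalType) (f : T -> U) (g : T -> V)
    (x : T) : {for x, continuous f} -> {for x, continuous g} ->
  {for x, continuous (fun y => (f y, g y))}.
Proof. by move=> cf cg; exact: cvg_pair. Qed.

Lemma near_gt (T : topologicalType) (f : T -> R) (x : T) (a : R) :
  {for x, continuous f} -> a < f x -> \forall y \near x, a < f y.
Proof. by move=> cf; exact: (@cvgr_gt R T (nbhs x) (nbhs_filter x) f (f x) cf). Qed.

Lemma near_lt (T : topologicalType) (f : T -> R) (x : T) (a : R) :
  {for x, continuous f} -> f x < a -> \forall y \near x, f y < a.
Proof. by move=> cf; exact: (@cvgr_lt R T (nbhs x) (nbhs_filter x) f (f x) cf). Qed.

(** Extension into [E] is isolated as a property because it is stable under products, the only
    operation by which the ambient spaces grow. *)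
Definition tietze_target (Z E : topologicalType) : Prop :=
  forall (A : set Z) (f : Z -> E), closed A -> {within A, continuous f} ->
  exists2 g : Z -> E, continuous g & forall x, A x -> g x = f x.

Variable Z : topologicalType.
Hypotheses (hZ : hausdorff_space Z) (kZ : compact [set: Z]).

Lemma tietze_target_real : tietze_target Z R^o.
Proof.
move=> A f cA cf.
have kA := subclosed_compact cA kZ (@subsetT _ A).
have kfA := continuous_compact cf kA.
have [M [_ MfA]] := compact_bounded kfA.
pose N := Num.max M 0 + 1.
have MN : M < N by rewrite /N (le_lt_trans (_ : _ <= Num.max M 0)) ?le_max ?lexx// ltrDl.
have N0 : 0 < N by rewrite /N ltr_pwDr// le_max lexx orbT.
have [|g [fg cg _]] := continuous_bounded_extension (compact_normal hZ kZ) cA N0 cf.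
  by move=> x Ax; apply: MfA => //; exists x.
by exists g => // x Ax; rewrite fg// inE.
Qed.

Lemma tietze_target_prod (E F : topologicalType) :
  tietze_target Z E -> tietze_target Z F -> tietze_target Z (E * F)%type.
Proof.
move=> tE tF A f cA cf.
have [g cg gf] : exists2 g : Z -> E, continuous g & forall x, A x -> g x = (f x).1.
  by apply: (tE A (fun x => (f x).1)) => //; exact: (within_compT cf (@fst_continuous _ _)).
have [h ch hf] : exists2 h : Z -> F, continuous h & forall x, A x -> h x = (f x).2.
  by apply: (tF A (fun x => (f x).2)) => //; exact: (within_compT cf (@snd_continuous _ _)).
exists (fun x => (g x, h x)); first by move=> x; apply: cvg_pair; [exact: cg|exact: ch].
by move=> x Ax; rewrite gf// hf//; case: (f x).
Qed.

Lemma tietze_target_rV n : tietze_target Z 'rV[R]_n.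
Proof.
move=> A f cA cf.
have /choice[g gP] : forall i, exists g : Z -> R^o, continuous g /\
    forall x, A x -> g x = f x ord0 i.
  move=> i; have [|g cg gf] := tietze_target_real (A := A) (f := fun x => f x ord0 i) cA.
    by exact: (within_compT cf (@coord_continuous R 1 n ord0 i)).
  by exists g.
exists (fun x => \row_i g i x).
  apply: rV_continuous => i; rewrite (_ : (fun _ => _) = g i); first exact: (gP i).1.
  by apply/funext => x; rewrite mxE.
by move=> x Ax; apply/rowP => i; rewrite mxE (gP i).2.
Qed.

End Tietze.

(* A Euclidean neighbourhood retract, up to the choice of the ambient normed
   space, for which only Tietze's theorem on [Z] is required. *)
Definition nbhd_retract (R : realType) (Z K : topologicalType) (Y : set K) :=
  exists (E : normedModType R) (iota : K -> E) (r : E -> K) (O : set E),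
  [/\ tietze_target Z E, {within Y, continuous iota}, open O &
      forall y, Y y -> O (iota y) /\ r (iota y) = y] /\
  (forall e, O e -> Y (r e) /\ {for e, continuous r}).

Section AttachCell.
Variables (R : realType) (K : topologicalType) (Y : set K) (n : nat).
Variables (Phi : 'rV[R]_n -> K) (E : normedModType R).
Variables (iota : K -> E) (r : E -> K) (O : set E).
Hypotheses (hK : hausdorff_space K) (kY : compact Y)
  (cPhi : {within @disk R n, continuous Phi})
  (PhiS : forall u, sphere u -> Y (Phi u))
  (PhiY : forall u, open_disk u -> ~ Y (Phi u))
  (Phi_inj : forall u v, open_disk u -> open_disk v -> Phi u = Phi v -> u = v)
  (ciota : {within Y, continuous iota}) (oO : open O)
  (iotaO : forall y, Y y -> O (iota y))
  (rK : forall y, Y y -> r (iota y) = y)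
  (rY : forall e, O e -> Y (r e))
  (cr : forall e, O e -> {for e, continuous r}).

Local Notation V := 'rV[R]_n.

(** Radial extension of the attaching map, read in [E], to all of R^n. It is constant along rays
    from radius 1/2 outwards, and the factor 2|v| brings it to 0 at the origin, where the direction
    of [v] is undefined. *)
Let spread (v : V) : E := Num.min 1 (2 * nrm v) *: iota (Phi ((nrm v)^-1 *: v)).

Let spread_far v : 2^-1 <= nrm v -> spread v = iota (Phi ((nrm v)^-1 *: v)).
Proof.
by move=> v2; rewrite /spread min_l ?scale1r//; lra.
Qed.

Let spreadZ (c : R) v : 0 < c -> 2^-1 <= nrm v -> 2^-1 <= nrm (c *: v) ->
  spread (c *: v) = spread v.
Proof.
move=> c0 v2 cv2; rewrite !spread_far// nrmZ gtr0_norm// invfM scalerA.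
by rewrite mulrAC mulVf ?mul1r// gt_eqF.
Qed.

Let ciotaPhi : {within @sphere R n, continuous (iota \o Phi)}.
Proof.
apply: (within_comp PhiS) => //.
by apply: continuous_subspaceW cPhi; exact: sphere_disk.
Qed.

Let spread_continuous : continuous spread.
Proof.
move=> v; have [v0|v0] := ltP 0 (nrm v).
  have cn : {within [set u : V | 0 < nrm u], continuous (fun u => (nrm u)^-1 *: u)}.
    apply: continuous_in_subspaceT => u; rewrite inE => u0.
    apply: (@continuousZ _ _ _ (fun w : V => (nrm w)^-1)); last exact: cvg_id.
    by apply: continuousV; [rewrite lt0r_neq0|exact: nrm_continuous].
  have oN : open [set u : V | 0 < nrm u].
    have -> : [set u : V | 0 < nrm u] = (@nrm R n) @^-1` [set x | 0 < x] by [].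
    by apply: open_comp; [move=> u _; exact: nrm_continuous|exact: open_gt].
  have := within_comp (@sphere_normalize R n) cn ciotaPhi.
  rewrite continuous_open_subspace// => /(_ v); rewrite inE => /(_ v0) ci.
  apply: cvgZ ci; apply: cvg_minr; first exact: cvg_cst.
  by apply: cvgMl_tmp; exact: nrm_continuous.
have {}v0 : v = 0.
  by apply: nrm_eq0; apply/eqP; rewrite eq_le v0 nrm_ge0.
(* At the origin continuity is a squeeze: the attaching map is bounded on the compact sphere, so
   [spread u] is at most a multiple of |u|. *)
have [M [_ MP]] : bounded_set ((iota \o Phi) @` @sphere R n).
  by apply: compact_bounded; apply: continuous_compact => //; exact: sphere_compact.
pose N := Num.max M 0 + 1.
have N0 : 0 < N by rewrite /N ltr_pwDr// le_max lexx orbT.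
have MN : M < N by rewrite /N (le_lt_trans (_ : _ <= Num.max M 0)) ?le_max ?lexx// ltrDl.
have s0 : spread 0 = 0 by rewrite /spread nrm0 mulr0 min_r// scale0r.
have sN u : `|spread u| <= 2 * nrm u * N.
  rewrite /spread; have [->|u0] := eqVneq (nrm u) 0.
    by rewrite !mulr0 min_r// scale0r normr0 mul0r.
  have {}u0 : 0 < nrm u by rewrite lt_neqAle eq_sym u0 nrm_ge0.
  rewrite normrZ; apply: ler_pM => //.
    by rewrite ger0_norm ?ge_min ?lexx ?orbT// le_min ler01 mulr_ge0// nrm_ge0.
  apply: (MP N MN); exists ((nrm u)^-1 *: u) => //; exact: sphere_normalize.
rewrite v0; apply: (continuous_at_bound (b := fun u => 2 * nrm u * N)).
- apply: (@continuousM _ _ (fun u : V => 2 * nrm u)); last exact: cst_continuous.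
  apply: (@continuousM _ _ (fun=> 2) (@nrm R n)); first exact: cst_continuous.
  exact: nrm_continuous.
- by rewrite nrm0 mulr0 mul0r.
- by move=> u; rewrite s0 subr0.
Qed.

(** Radial retraction onto the disk; composing with it makes the characteristic map continuous on
    the whole of R^n, so that neighbourhoods need not be intersected with the disk. *)
Let clip (v : V) : V := (Num.max 1 (nrm v))^-1 *: v.

Let max1_gt0 (a : R) : 0 < Num.max 1 a.
Proof. by rewrite lt_max ltr01. Qed.

Let nrm_clip v : nrm (clip v) = Num.min 1 (nrm v).
Proof.
rewrite nrmZ ger0_norm ?invr_ge0 ?(ltW (max1_gt0 _))//.
have [v1|v1] := leP (nrm v) 1; first by rewrite invr1 mul1r.
by rewrite mulVf// gt_eqF// (lt_trans ltr01).
Qed.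

Let clip_disk v : disk (clip v).
Proof. by apply/disk_nrm; rewrite nrm_clip ge_min lexx. Qed.

Let clip_id v : disk v -> clip v = v.
Proof. by move=> /disk_nrm v1; rewrite /clip max_l// invr1 scale1r. Qed.

Let Phi_clip_continuous : continuous (Phi \o clip).
Proof.
apply/within_setT; apply: (within_comp (fun u _ => clip_disk u)) => //.
apply/within_setT => v.
apply: (@continuousZ _ _ _ (fun v : V => (Num.max 1 (nrm v))^-1)); last exact: cvg_id.
apply: (@continuousV _ _ (fun v : V => Num.max 1 (nrm v))).
  by rewrite gt_eqF.
by apply: continuous_at_max; [exact: cst_continuous|exact: nrm_continuous].
Qed.

(* The cell is embedded in [E * R * V] by [u |-> (spread u, 1 - |u|, (1 - |u|) u)]
   and [Y] by [y |-> (iota y, 0, 0)].  For [t > 0], [del y t w] is the distance of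
   [(y, t, w)] to the image of the cell, relative to [t].  Where [del <= 1], the
   retraction [ret] follows the cell coordinate [dir t w], pushed outwards so as to
   reach the boundary sphere at [del = 1]; elsewhere it is [r (kap y t w)], and
   [kap] makes the two formulas agree at [del = 1]. *)
Let dir (t : R) (w : V) : V := t^-1 *: w.
Let del (y : E) (t : R) (w : V) : R :=
  (`|y - spread (dir t w)| + `|nrm (dir t w) - (1 - t)|) / t.
Let kap (y : E) (t : R) (w : V) : E :=
  if t <= 0 then y else
  spread (dir t w) + Num.min 1 (Num.max 0 (del y t w - 1)) *: (y - spread (dir t w)).
Let push (y : E) (t : R) (w : V) : K :=
  Phi (clip ((1 + 4 * t * del y t w) *: dir t w)).
Let ret (y : E) (t : R) (w : V) : K :=
  if (0 < t) && (del y t w <= 1) then push y t w else r (kap y t w).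
Let dom (y : E) (t : R) (w : V) : Prop :=
  (0 < t /\ del y t w < 1) \/ (t < 8^-1 /\ O (kap y t w)).

Let del_ge0 y t w : 0 < t -> 0 <= del y t w.
Proof. by move=> t0; rewrite divr_ge0 ?addr_ge0// ltW. Qed.

Let del_spread y t w : 0 < t -> `|y - spread (dir t w)| <= del y t w * t.
Proof. by move=> t0; rewrite /del mulfVK ?gt_eqF// lerDl. Qed.

Let del_nrm y t w : 0 < t -> 1 - t - del y t w * t <= nrm (dir t w).
Proof.
move=> t0; rewrite /del mulfVK ?gt_eqF//.
have := ler_norm (- (nrm (dir t w) - (1 - t))); rewrite normrN.
by have := normr_ge0 (y - spread (dir t w)); lra.
Qed.

(** This gives continuity of [kap] at t = 0, where its formula degenerates. For [del] at least 2 the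
    correction vanishes; for [del] below 2 the point [y] is within 2t of [spread], and [kap] lies on
    the segment between them. *)
Let kap_bound y t w : `|kap y t w - y| <= 2 * Num.max t 0.
Proof.
rewrite /kap; have [t0|t0] := leP t 0; first by rewrite subrr normr0 mulr0.
set v := spread _; set m := Num.min _ _.
have -> : v + m *: (y - v) - y = (1 - m) *: (v - y).
  by rewrite scalerBl scale1r -scalerN opprB addrAC.
have [d2|d2] := leP 2 (del y t w).
  have -> : m = 1 by rewrite /m min_l// le_max; apply/orP; right; lra.
  by rewrite subrr scale0r normr0 mulr_ge0// ltW.
rewrite normrZ (distrC v); have m01 : `|1 - m| <= 1.
  have m1 : m <= 1 by rewrite ge_min lexx.
  have m0 : 0 <= m by rewrite le_min ler01 le_max lexx.
  by rewrite ger0_norm; lra.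
apply: (@le_trans _ _ (1 * (del y t w * t))).
  by apply: ler_pM => //; exact: del_spread.
by rewrite mul1r ler_pM2r// ltW.
Qed.

Section Composite.
Variables (T : topologicalType) (yy : T -> E) (tt : T -> R) (ww : T -> V) (x : T).
Hypotheses (cy : {for x, continuous yy}) (ct : {for x, continuous tt})
  (cw : {for x, continuous ww}).

Let cdir : 0 < tt x -> {for x, continuous (fun z => dir (tt z) (ww z))}.
Proof.
move=> t0; apply: (@continuousZ _ _ _ (fun z => (tt z)^-1)) => //.
by apply: continuousV => //; rewrite gt_eqF.
Qed.

Let cspread : 0 < tt x -> {for x, continuous (fun z => spread (dir (tt z) (ww z)))}.
Proof.
by move=> t0; apply: (continuous_comp (cdir t0)); exact: spread_continuous.
Qed.

Let cdel : 0 < tt x -> {for x, continuous (fun z => del (yy z) (tt z) (ww z))}.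
Proof.
move=> t0; apply: (@continuousM _ _ (fun z => _ + _) (fun z => (tt z)^-1)); last first.
  by apply: continuousV => //; rewrite gt_eqF.
apply: cvgD; apply: cvg_norm; apply: cvgB => //.
- exact: cspread.
- by apply: (continuous_comp (cdir t0)); exact: nrm_continuous.
- by apply: cvgB => //; exact: cvg_cst.
Qed.

Let ckap : {for x, continuous (fun z => kap (yy z) (tt z) (ww z))}.
Proof.
have [t0|t0] := leP (tt x) 0.
  apply: (continuous_at_bound
    (b := fun z => 2 * Num.max (tt z) 0 + `|yy z - yy x|)).
  - apply: cvgD.
      by apply: cvgMl_tmp; apply: cvg_maxr => //; exact: cvg_cst.
    by apply: cvg_norm; apply: cvgB => //; exact: cvg_cst.
  - by rewrite subrr normr0 addr0 max_r// mulr0.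
  - move=> z; rewrite {2}/kap t0 -(subrKA (yy z)).
    by apply: le_trans (ler_normD _ _) _; rewrite lerD2r kap_bound.
apply: (@continuous_at_near _ _ _ (fun z => spread (dir (tt z) (ww z)) +
    Num.min 1 (Num.max 0 (del (yy z) (tt z) (ww z) - 1)) *:
    (yy z - spread (dir (tt z) (ww z))))).
  by apply: filterS (near_gt ct t0) => z tz; rewrite /kap leNgt tz.
apply: cvgD; first exact: cspread.
apply: cvgZ; last by apply: cvgB => //; exact: cspread.
apply: cvg_minr; first exact: cvg_cst.
apply: cvg_maxr; first exact: cvg_cst.
by apply: cvgB; [exact: cdel|exact: cvg_cst].
Qed.

Let cpush : 0 < tt x -> {for x, continuous (fun z => push (yy z) (tt z) (ww z))}.
Proof.
move=> t0; apply: (@continuous_comp _ _ _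
  (fun z => (1 + 4 * tt z * del (yy z) (tt z) (ww z)) *: dir (tt z) (ww z)) (Phi \o clip)).
  apply: (@continuousZ _ _ _ (fun z => 1 + 4 * tt z * del (yy z) (tt z) (ww z))); last exact: cdir.
  apply: cvgD; first exact: cvg_cst.
  by apply: (@continuousM _ _ (fun z => 4 * tt z)); [apply: cvgMl_tmp|exact: cdel].
exact: Phi_clip_continuous.
Qed.

Let near_dom_push : 0 < tt x -> del (yy x) (tt x) (ww x) < 1 ->
  \forall z \near x, 0 < tt z /\ del (yy z) (tt z) (ww z) < 1.
Proof.
move=> t0 d1; apply: (filterS2 _ _ (near_gt ct t0) (near_lt (cdel t0) d1)) => z.
by split.
Qed.

Lemma near_dom : dom (yy x) (tt x) (ww x) ->
  \forall z \near x, dom (yy z) (tt z) (ww z).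
Proof.
case=> [[t0 d1]|[t8 Ok]].
  by apply: filterS (near_dom_push t0 d1) => z ?; left.
have Oz : \forall z \near x, O (kap (yy z) (tt z) (ww z)).
  exact: (ckap (open_nbhs_nbhs (conj oO Ok))).
by apply: filterS2 (near_lt ct t8) Oz => z ? ?; right.
Qed.

(* Near the old complex the fibre coordinate degenerates; compactness of the
   disk makes the collar points [Phi u] follow their base points uniformly. *)
Let cret_base : tt x <= 0 -> O (yy x) ->
  {for x, continuous (fun z => ret (yy z) (tt z) (ww z))}.
Proof.
move=> t0 Oy; have kx : kap (yy x) (tt x) (ww x) = yy x by rewrite /kap t0.
have rx : ret (yy x) (tt x) (ww x) = r (yy x) by rewrite /ret ltNge t0 /= kx.
move=> A; rewrite rx nbhsE => -[U [oU Ux] UA].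
have Ur : \forall z \near x, U (r (kap (yy z) (tt z) (ww z))).
  have cr' : {for kap (yy x) (tt x) (ww x), continuous r} by apply: cr; rewrite kx.
  have Uk : U (r (kap (yy x) (tt x) (ww x))) by rewrite kx.
  exact: (continuous_comp ckap cr' (open_nbhs_nbhs (conj oU Uk))).
pose b (u : V) : R := `|spread u - yy x| + (1 - nrm u).
have cb : continuous b.
  move=> u; apply: (@continuousD _ _ _ (fun u => `|spread u - yy x|)).
    apply: (@continuous_comp _ _ _ (fun u => spread u - yy x)); last exact: norm_continuous.
    apply: (@continuousB _ _ _ spread (fun=> yy x)); first exact: spread_continuous.
    exact: cst_continuous.
  apply: (@continuousB _ _ _ (fun=> 1 : R^o)); first exact: cst_continuous.
  exact: nrm_continuous.
(* [B] holds the points of the outer part of the disk that [Phi] sends outside [U]. A zero of [b]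
   there would be a boundary point with [iota (Phi u) = yy x], hence with [Phi u = r (yy x)] in [U].
   So [b] has a positive lower bound [e] on the compact set [B], whereas a collar point close to [x]
   has [b] below [e]. *)
pose B := (@disk R n `&` Phi @^-1` (~` U)) `&` [set u | 2^-1 <= nrm u].
have kB : compact B.
  apply: (@subclosed_compact _ _ (@disk R n)); [|exact: disk_compact|by move=> u [[]]].
  apply: closedI.
    have /within_closedP := cPhi; apply; first exact: disk_closed.
    exact: open_closedC.
  have -> : [set u : V | 2^-1 <= nrm u] = @nrm R n @^-1` [set a | 2^-1 <= a] by [].
  by apply: preimage_closed (@closed_ge R _) => u _; exact: nrm_continuous.
have [e e0 eB] : exists2 e : R, 0 < e & forall u, B u -> e <= b u.
  have cbB : closed (b @` B).
    apply: compact_closed; first exact: Rhausdorff.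
    by apply: continuous_compact => //; exact: continuous_subspaceT.
  have : nbhs (0 : R) (~` (b @` B)).
    apply: open_nbhs_nbhs; split; first exact: closed_openC.
    move=> [u [[u1 nU] /= u2] bu0].
    have /andP[/eqP su /eqP nu] : (`|spread u - yy x| == 0) && (1 - nrm u == 0).
      by rewrite -paddr_eq0//; [exact/eqP|rewrite subr_ge0; exact/disk_nrm].
    have {}nu : nrm u = 1 by lra.
    have uS : sphere u by apply/sphere_nrm.
    move/eqP : su; rewrite normr_eq0 subr_eq0 => /eqP su; apply: nU.
    by rewrite /= -su spread_far// nu invr1 scale1r rK// in Ux; exact: PhiS.
  move=> /nbhs_ballP[e e0 eb]; exists e => // u Bu; rewrite leNgt; apply/negP => bue.
  apply: (eb (b u)); last by exists u.
  have [[/disk_nrm u1 _] _] := Bu.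
  by rewrite /ball /= sub0r normrN ger0_norm// addr_ge0// subr_ge0.
have e3 : 0 < e / 8 by rewrite divr_gt0.
have ny : \forall z \near x, `|yy z - yy x| < e / 8.
  apply: near_lt; last by rewrite subrr normr0.
  by apply: cvg_norm; apply: cvgB => //; exact: cvg_cst.
have nt : \forall z \near x, tt z < Num.min 8^-1 (e / 8).
  by apply: near_lt => //; rewrite (le_lt_trans t0)// lt_min e3 andbT invr_gt0.
suff : nbhs x ((fun z => ret (yy z) (tt z) (ww z)) @^-1` A) by [].
near=> z; apply: UA; rewrite /ret; case: ifPn => [/andP[tz dz]|_]; last by near: z.
rewrite /push; set v := dir _ _; set c := 1 + _; set u := clip _.
have tz8 : tt z < 8^-1 /\ tt z < e / 8.
  by apply/andP; rewrite -lt_min; near: z.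
have nyz : `|yy z - yy x| < e / 8 by near: z.
have d0 := del_ge0 (yy z) (ww z) tz; set d := del _ _ _ in dz d0.
have dt : d * tt z <= tt z by rewrite ger_pMl.
have vn : 1 - 2 * tt z <= nrm v by have := del_nrm (yy z) (ww z) tz; rewrite -/d; lra.
have c1 : 1 <= c.
  by rewrite lerDl; apply: mulr_ge0 => //; apply: mulr_ge0; [by []|exact: ltW].
have un : 1 - 2 * tt z <= nrm u.
  rewrite nrm_clip le_min; apply/andP; split; first lra.
  by rewrite nrmZ ger0_norm; [nra|lra].
have [//|nU] := pselect (U (Phi u)).
have Bu : B u by split; [split => //; exact: clip_disk|rewrite /=; lra].
have su : spread u = spread v.
  rewrite /u /clip scalerA spreadZ//; first by rewrite mulr_gt0 ?invr_gt0//; lra.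
    by lra.
  by rewrite -scalerA -/(clip _) -/u; lra.
have := eB _ Bu; rewrite /b su => eb.
have h1 : `|spread v - yy x| <= `|yy z - spread v| + `|yy z - yy x|.
  by rewrite -(subrKA (yy z)) (distrC (yy z) (spread v)); exact: ler_normD.
have h2 := del_spread (yy z) (ww z) tz; rewrite -/d -/v in h2.
by lra.
Unshelve. all: by end_near. Qed.

Lemma ret_continuous : dom (yy x) (tt x) (ww x) ->
  {for x, continuous (fun z => ret (yy z) (tt z) (ww z))}.
Proof.
move=> Dx; have [t0|t0] := leP (tt x) 0.
  case: Dx => [[]|[_]]; first by rewrite ltNge t0.
  by rewrite /kap t0; exact: cret_base.
have [d1|d1|d1] := ltgtP (del (yy x) (tt x) (ww x)) 1.
- apply: (@continuous_at_near _ _ _ (fun z => push (yy z) (tt z) (ww z))); last exact: cpush.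
  by apply: filterS (near_dom_push t0 d1) => z [tz /ltW dz]; rewrite /ret tz dz.
- case: Dx => [[_ d1']|[_ Ok]]; first by have := lt_trans d1 d1'; rewrite ltxx.
  apply: (@continuous_at_near _ _ _ (fun z => r (kap (yy z) (tt z) (ww z)))).
    by apply: filterS (near_gt (cdel t0) d1) => z dz; rewrite /ret [_ <= 1]leNgt dz andbF.
  by apply: (continuous_comp ckap); exact: cr.
- case: Dx => [[_]|[t8 Ok]]; first by rewrite d1 ltxx.
  apply: continuous_at_if; [|exact: cpush|by apply: (continuous_comp ckap); exact: cr].
  rewrite /push /kap leNgt t0 /= d1 subrr maxxx min_r// scale0r addr0 mulr1.
  set v := dir _ _.
  have vn : 1 - 2 * tt x <= nrm v by have := del_nrm (yy x) (ww x) t0; rewrite d1 -/v; lra.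
  have v0 : 0 < nrm v by lra.
  rewrite spread_far; last by lra.
  rewrite rK; last by apply: PhiS; exact: sphere_normalize.
  (* Here the constants 4 and 1/8 are paid for: |v| is at least 1 - 2t, and (1 + 4t)(1 - 2t) = 1 +
     2t(1 - 4t) is at least 1 for t < 1/8. The pushed point thus reaches the sphere, where both
     formulas for [ret] give the same value. *)
  congr Phi; rewrite /clip nrmZ ger0_norm; last by lra.
  rewrite max_r; last by nra.
  by rewrite scalerA invfM mulrAC mulVf ?mul1r//; apply/eqP; lra.
Qed.

End Composite.

Let coords (u : V) : E * (R^o * V) := (spread u, (1 - nrm u, (1 - nrm u) *: u)).

Let iota' (z : K) : E * (R^o * V) :=
  if `[< Y z >] then (iota z, (0, 0))
  else coords (xget 0 [set u | disk u /\ Phi u = z]).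

Let iota'_base z : Y z -> iota' z = (iota z, (0, 0)).
Proof. by rewrite /iota'; case: asboolP. Qed.

Let iota'_cell u : disk u -> iota' (Phi u) = coords u.
Proof.
move=> /[dup] du /disk_split[uo|us]; last first.
  rewrite iota'_base; last exact: PhiS.
  move/sphere_nrm : us => u1; rewrite /coords u1 subrr scale0r spread_far ?u1//.
    by rewrite invr1 scale1r.
  by rewrite invf_le1// ler1n.
rewrite /iota'; case: asboolP => [Yu|_]; first by case: (PhiY uo Yu).
case: xgetP => [v vE [dv vu]|/(_ u) []//].
case/disk_split : dv => [vo|vs]; first by rewrite (Phi_inj vo uo vu).
by exfalso; apply: (PhiY uo); rewrite -vu; exact: PhiS.
Qed.

Let coords_continuous : continuous coords.
Proof.
move=> u; apply: continuous_at_pair; first exact: spread_continuous.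
have c : {for u, continuous (fun u : V => 1 - nrm u)}.
  apply: (@continuousB _ _ _ (fun=> 1 : R^o)); first exact: cst_continuous.
  exact: nrm_continuous.
apply: continuous_at_pair; first exact: c.
by apply: (@continuousZ _ _ _ (fun u : V => 1 - nrm u)) => //; exact: cvg_id.
Qed.

Lemma nbhd_retract_attach (Z : topologicalType) :
  hausdorff_space Z -> compact [set: Z] -> tietze_target Z E ->
  nbhd_retract R Z (Y `|` Phi @` @disk R n).
Proof.
move=> hZ kZ tE.
have kD : compact (Phi @` @disk R n).
  by apply: continuous_compact => //; exact: disk_compact.
exists ((E * (R^o * V))%type : normedModType R), iota'.
exists (fun p => ret p.1 p.2.1 p.2.2), [set p | dom p.1 p.2.1 p.2.2]; split; first split.
- apply: tietze_target_prod => //; apply: tietze_target_prod.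
    exact: tietze_target_real.
  exact: tietze_target_rV.
- apply: withinU_continuous; [exact: compact_closed|exact: compact_closed| |].
    apply: (@within_ext _ _ _ (fun z => (iota z, (0, 0)))).
      by move=> z Yz; rewrite iota'_base.
    by apply: within_pair => //; apply: continuous_subspaceT; exact: cst_continuous.
  apply: within_quotient hK cPhi _; first exact: disk_compact.
  apply: (@within_ext _ _ _ coords) => [u du|]; first by rewrite /= iota'_cell.
  exact: continuous_subspaceT.
- have -> : open [set p : E * (R^o * V) | dom p.1 p.2.1 p.2.2] =
      ([set p | dom p.1 p.2.1 p.2.2] `<=` [set p | dom p.1 p.2.1 p.2.2]°).
    by rewrite openE.
  move=> p Dp; exact: (near_dom (@fst_continuous _ _ p)
    (@fst_snd_continuous _ _ _ p) (@snd_snd_continuous _ _ _ p) Dp).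
- move=> z; have base : Y z -> dom (iota' z).1 (iota' z).2.1 (iota' z).2.2 /\
      ret (iota' z).1 (iota' z).2.1 (iota' z).2.2 = z.
    move=> Yz; rewrite iota'_base//=; split.
      by right; rewrite /kap lexx; split; [rewrite invr_gt0|exact: iotaO].
    by rewrite /ret ltxx /= /kap lexx rK.
  case=> [/base//|[u du uz]]; have [uo|us] := disk_split du; last first.
    by apply: base; rewrite -uz; exact: PhiS.
  rewrite -uz iota'_cell//=.
  have t0 : 0 < 1 - nrm u by rewrite subr_gt0; exact/open_disk_nrm.
  have du' : dir (1 - nrm u) ((1 - nrm u) *: u) = u.
    by rewrite /dir scalerA mulVf ?scale1r// gt_eqF.
  have d0 : del (spread u) (1 - nrm u) ((1 - nrm u) *: u) = 0.
    by rewrite /del du' subrr normr0 add0r subKr subrr normr0 mul0r.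
  split; first by left; rewrite d0; split.
  by rewrite /ret t0 d0 ler01 /= /push d0 mulr0 addr0 scale1r du' clip_id.
- move=> p Dp; split; last first.
    exact: (ret_continuous (@fst_continuous _ _ p)
      (@fst_snd_continuous _ _ _ p) (@snd_snd_continuous _ _ _ p) Dp).
  have Pp : (Y `|` Phi @` @disk R n) (push p.1 p.2.1 p.2.2).
    by right; exists (clip ((1 + 4 * p.2.1 * del p.1 p.2.1 p.2.2) *: dir p.2.1 p.2.2)).
  rewrite /ret; case: ifPn => // tn; case: Dp => [[t0 d1]|[_ Ok]].
    by move: tn; rewrite t0 (ltW d1).
  by left; exact: rY.
Qed.

End AttachCell.

(** * Finite subcomplexes *)

Section FiniteSubcomplexes.
Variables (R : realType) (K : topologicalType) (C : cw_structure R K).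

Let cell := cw_cell C.
Let Phi n (e : cell n) : 'rV[R]_n -> K := @cw_map R K C n e.

(** Generated by single attachments, with exactly the conditions under which [nbhd_retract_attach]
    applies, so that an induction on this predicate yields the retraction. *)
Inductive finite_subcomplex : set K -> Prop :=
| finite_subcomplex0 : finite_subcomplex set0
| finite_subcomplexU Y n (e : cell n) : finite_subcomplex Y ->
    (forall u, sphere u -> Y (Phi e u)) ->
    (forall u, open_disk u -> ~ Y (Phi e u)) ->
    finite_subcomplex (Y `|` Phi e @` @disk R n).

Let hK : hausdorff_space K := cw_hausdorff C.

Let Phi_eq n (e : cell n) u m (e' : cell m) v : open_disk u -> open_disk v ->
  Phi e u = Phi e' v -> existT _ n e = existT _ m e' :> {k & cell k}.
Proof.
move=> du dv uv; have E := cw_unique du dv uv.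
exact: (congr1 (fun s => existT (fun k => cell k) (projT1 s) (projT2 s).1) E).
Qed.

Let Phi_inj n (e : cell n) u v : open_disk u -> open_disk v ->
  Phi e u = Phi e v -> u = v.
Proof.
move=> du dv uv; have E := cw_unique du dv uv.
by have [] := Eqdep_dec.inj_pair2_eq_dec _ PeanoNat.Nat.eq_dec _ _ _ _ E.
Qed.

Let image_eq n (e : cell n) m (e' : cell m) :
  existT _ n e = existT _ m e' :> {k & cell k} ->
  Phi e @` @disk R n = Phi e' @` @disk R m.
Proof.
exact: (congr1 (fun s : {k & cell k} => Phi (projT2 s) @` @disk R (projT1 s))).
Qed.

Lemma finite_subcomplex_compact Y : finite_subcomplex Y -> compact Y.
Proof.
elim=> {Y} [|Y n e _ kY _ _]; first exact: compact0.
apply: compactU => //; apply: continuous_compact; last exact: disk_compact.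
exact: cw_continuous.
Qed.

Lemma finite_subcomplex_retract (Z : topologicalType) (x0 : K) Y :
  hausdorff_space Z -> compact [set: Z] -> finite_subcomplex Y ->
  nbhd_retract R Z Y.
Proof.
move=> hZ kZ; elim=> {Y} [|Y n e fY IH YS YD].
  exists (R^o : normedModType R), (fun=> 0), (fun=> x0), set0; split=> //.
  by split; [exact: tietze_target_real|exact: continuous_subspace0|exact: open0|].
have [E [iota [r [W [[tE ci oW rK] Wr]]]]] := IH.
apply: (@nbhd_retract_attach R K Y n (Phi e) E iota r W) => //.
- exact: finite_subcomplex_compact.
- exact: cw_continuous.
- exact: Phi_inj.
- by move=> y /rK[].
- by move=> y /rK[].
- by move=> x /Wr[].
- by move=> x /Wr[].
Qed.

(** A point of an open cell enters [Y] through the interior of some attached cell, or on its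
    boundary and so at an earlier stage. Open cells being disjoint, the attached cell is [e]
    itself. *)
Lemma finite_subcomplex_saturated Y n (e : cell n) u v : finite_subcomplex Y ->
  open_disk u -> open_disk v -> Y (Phi e u) -> Y (Phi e v).
Proof.
move=> fY du dv; elim: fY => // {}Y m e' fY IH YS _ [/IH|[w dw wu]]; first by left.
have [wo|ws] := disk_split dw; last by left; apply: IH; rewrite -wu; exact: YS.
right; rewrite (image_eq (Phi_eq wo du wu)); exists v => //; exact: open_disk_disk.
Qed.

(** Induction on the dimension: the boundary of [e] meets finitely many open cells, all of lower
    dimension, which are adjoined first. Then [Y1] either meets the open cell, and contains it by
    saturation, or is disjoint from it, and [e] can be attached. *)
Lemma finite_subcomplex_add Y n (e : cell n) : finite_subcomplex Y ->
  exists Y', [/\ finite_subcomplex Y', Y `<=` Y' & Phi e @` @disk R n `<=` Y'].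
Proof.
have [N] := ubnP n; elim: N => // N IH in Y n e * => nN fY.
have [M [c [cn cS]]] := cw_boundary e.
have [Y1 [fY1 YY1 cY1]] : exists Y1, [/\ finite_subcomplex Y1, Y `<=` Y1 &
    forall j, Phi (tagged (c j)) @` @disk R (tag (c j)) `<=` Y1].
  suff [Y1 [fY1 YY1 cY1]] : exists Y1, [/\ finite_subcomplex Y1, Y `<=` Y1 &
      forall j, j \in enum 'I_M -> Phi (tagged (c j)) @` @disk R (tag (c j)) `<=` Y1].
    by exists Y1; split => // j; apply: cY1; rewrite mem_enum.
  elim: (enum 'I_M) => [|j s [Y1 [fY1 YY1 cY1]]]; first by exists Y; split.
  have [|Y2 [fY2 Y12 jY2]] := IH Y1 (tag (c j)) (tagged (c j)) _ fY1.
    by apply: leq_trans (cn j) _; rewrite -ltnS.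
  exists Y2; split=> // [x /YY1/Y12//|i]; rewrite inE => /orP[/eqP ->//|/cY1 h].
  by move=> x /h/Y12.
have YS u : sphere u -> Y1 (Phi e u).
  move=> /cS[j [v [vo vu]]]; rewrite /Phi -vu; apply: (cY1 j); exists v => //.
  exact: open_disk_disk.
have [ [u [uo Yu]]|nY] := pselect (exists u, open_disk u /\ Y1 (Phi e u)).
  exists Y1; split=> // _ [v /disk_split[vo|vs] <-]; last exact: YS.
  exact: finite_subcomplex_saturated Yu.
exists (Y1 `|` Phi e @` @disk R n); split; last by right.
  by apply: finite_subcomplexU => // u uo Yu; apply: nY; exists u.
by move=> x /YY1; left.
Qed.

(* A set with at most one point in each open cell is closed, and so are its
   subsets; if it lies in a compact set it is therefore finite. *)
Let transversal (P : set K) := forall n (e : cell n) u v,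
  open_disk u -> open_disk v -> P (Phi e u) -> P (Phi e v) -> Phi e u = Phi e v.

Let transversal_finite P Y : transversal P -> finite_subcomplex Y ->
  finite_set (Y `&` P).
Proof.
move=> tP; elim=> {Y} [|Y n e _ fYP YS _]; first by rewrite set0I.
have [ [u [uo Pu]]|nP] := pselect (exists u, open_disk u /\ P (Phi e u)).
  apply: (@sub_finite_set _ _ ((Y `&` P) `|` [set Phi e u])).
    move=> x [[Yx|[v /disk_split[vo|vs] vx]] Px]; first by left.
      by right; rewrite /= -vx; apply: tP => //; rewrite vx.
    by left; split=> //; rewrite -vx; exact: YS.
  by rewrite finite_setU.
apply: sub_finite_set fYP => x [[//|[v /disk_split[vo|vs] vx]] Px].
  by exfalso; apply: nP; exists v; rewrite vx.
by split=> //; rewrite -vx; exact: YS.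
Qed.

(** In the weak topology closedness is tested on one closed cell at a time; that cell lies in a
    finite subcomplex and so meets [P] in finitely many points. *)
Let transversal_closed P : transversal P -> closed P.
Proof.
move=> tP; apply: (cw_weak (c := C)) => n e.
have [Y [fY _ eY]] := finite_subcomplex_add e finite_subcomplex0.
rewrite (_ : _ `&` _ = \bigcup_(x in Y `&` P) (@disk R n `&` Phi e @^-1` [set x])).
  apply: closed_bigcup => [|x _]; first exact: transversal_finite.
  have /within_closedP := @cw_continuous R K C n e; apply; first exact: disk_closed.
  exact: (accessible_closed_set1 (hausdorff_accessible hK)).
apply/seteqP; split=> [u [du Pu]|u [x [Yx Px] [du ux]]]; last first.
  by split=> //=; rewrite -[cw_map _ _]/(Phi e u) ux.
by exists (Phi e u) => //; split=> //; apply: eY; exists u.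
Qed.

(** One point of [A] is chosen in every open cell that [A] meets. The chosen points form a closed
    discrete subset of the compact set [A], hence a finite set, and finitely many cells can be
    adjoined. *)
Lemma compact_finite_subcomplex (A : set K) : compact A ->
  exists2 Y, finite_subcomplex Y & A `<=` Y.
Proof.
move=> kA; have [->|/set0P[x0 _]] := eqVneq A set0.
  by exists set0; [exact: finite_subcomplex0|].
pose pt (s : {k & cell k}) : K :=
  xget x0 (A `&` Phi (tagged s) @` @open_disk R (tag s)).
pose P : set K := [set x | exists s, x = pt s /\
  (A `&` Phi (tagged s) @` @open_disk R (tag s)) x].
have tP : transversal P.
  move=> n e u v uo vo [s [us [_ [u' uo' uu']]]] [s' [vs [_ [v' vo' vv']]]].
  have Es := Phi_eq uo' uo uu'; have Es' := Phi_eq vo' vo vv'.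
  rewrite us vs; congr pt; rewrite (_ : s = existT _ (tag s) (tagged s)); last by case: (s).
  by rewrite Es -Es'; case: (s').
have cP Q : Q `<=` P -> closed Q.
  move=> QP; apply: transversal_closed => n e u v uo vo /QP Pu /QP Pv.
  exact: tP.
have kP : compact P by apply: (subclosed_compact _ kA) => [|x [s [_ []]]//]; exact: cP.
have : finite_set P.
  pose Kp := HB.pack_for ptopologicalType K (isPointed.Build K x0).
  have : @cover_compact Kp P by rewrite -(@compact_cover Kp).
  (* The member of the cover indexed by [p] is open and meets [P] in [p] alone, so a finite subcover
     lists all of [P]. *)
  move=> /(_ K P (fun p => ~` (P `\` [set p])))[].
  - by move=> p _; apply: closed_openC; apply: cP => x [].
  - by move=> p Pp; exists p => // -[_ /(_ erefl)].
  - move=> D _ PD; apply: (sub_finite_set _ (finite_fset D)) => p Pp.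
    have [q qD] := PD p Pp.
    by have [->//|pq] := eqVneq p q; case; split=> // /eqP; rewrite (negbTE pq).
move=> /finite_seqP[D PD].
have [Y fY DY] : exists2 Y, finite_subcomplex Y & forall x, x \in D -> Y x.
  elim: D {PD} => [|x s [Y fY sY]].
    by exists set0; [exact: finite_subcomplex0|].
  have [n [e [u [uo ux]]]] := cw_cover C x.
  have [Y' [fY' YY' eY']] := finite_subcomplex_add e fY; exists Y' => // y.
  rewrite inE => /orP[/eqP ->|/sY/YY'//]; apply: eY'; exists u => //.
  exact: open_disk_disk.
exists Y => // x Ax; have [n [e [u [uo ux]]]] := cw_cover C x.
pose s : {k & cell k} := existT _ n e.
have As : (A `&` Phi e @` @open_disk R n) (pt s).
  by apply: (@xgetPex _ x0 (A `&` Phi e @` @open_disk R n)); exists x; split=> //; exists u.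
have Ps : P (pt s) by exists s.
have [_ [v vo vs]] := As; rewrite -ux; apply: (finite_subcomplex_saturated fY vo uo).
by rewrite vs; apply: DY; move: Ps; rewrite PD.
Qed.

End FiniteSubcomplexes.

(** * Lifting paths to the circle *)

Section Circle.
Variable R : realType.

Lemma circle_pointE (t : R) :
  circle_point t ord0 ord0 = cos (2 * pi * t) /\
  circle_point t ord0 (lift ord0 ord0) = sin (2 * pi * t).
Proof. by rewrite !mxE. Qed.

Lemma rV2P (u v : 'rV[R]_2) : u ord0 ord0 = v ord0 ord0 ->
  u ord0 (lift ord0 ord0) = v ord0 (lift ord0 ord0) -> u = v.
Proof.
move=> e0 e1; apply/rowP => i.
by case: (unliftP ord0 i) => [j ->|->//]; rewrite (ord1 j).
Qed.

Lemma sqnorm2 (u : 'rV[R]_2) :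
  sqnorm u = u ord0 ord0 ^+ 2 + u ord0 (lift ord0 ord0) ^+ 2.
Proof. by rewrite /sqnorm !big_ord_recl big_ord0 addr0. Qed.

Lemma circle_point_sphere (t : R) : sphere (circle_point t).
Proof.
have [c s] := circle_pointE t.
by rewrite /sphere /= sqnorm2 c s cos2Dsin2.
Qed.

Lemma circle_point_continuous : continuous (@circle_point R).
Proof.
apply: rV_continuous => i.
have cm : continuous (fun t : R => 2 * pi * t).
  by move=> t; apply: cvgMl_tmp; exact: cvg_id.
have [i0|i0] := eqVneq i ord0.
  rewrite (_ : (fun _ => _) = cos \o (fun t : R => 2 * pi * t)).
    by move=> t; apply: continuous_comp; [exact: cm|exact: continuous_cos].
  by apply/funext => t; rewrite mxE i0.
rewrite (_ : (fun _ => _) = sin \o (fun t : R => 2 * pi * t)).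
  by move=> t; apply: continuous_comp; [exact: cm|exact: continuous_sin].
by apply/funext => t; rewrite mxE (negbTE i0).
Qed.

Lemma circle_pointD1 (t : R) : circle_point (t + 1) = circle_point t.
Proof.
have [c s] := circle_pointE t; have [c1 s1] := circle_pointE (t + 1).
have e : 2 * pi * (t + 1) = 2 * pi * t + pi *+ 2 :> R by rewrite mulr2n; ring.
by apply: rV2P; rewrite ?c ?s ?c1 ?s1 e ?cosD2pi ?sinD2pi.
Qed.

Lemma circle_pointDn (t : R) (n : nat) : circle_point (t + n%:R) = circle_point t.
Proof.
elim: n => [|n IH]; first by rewrite addr0.
by rewrite -natr1 addrA circle_pointD1.
Qed.

Lemma circle_pointBn (t : R) (n : nat) : circle_point (t - n%:R) = circle_point t.
Proof. by rewrite -(circle_pointDn (t - n%:R) n) subrK. Qed.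

Lemma circle_pointDz (t : R) (k : int) : circle_point (t + k%:~R) = circle_point t.
Proof.
case: k => n; first exact: circle_pointDn.
by rewrite NegzE mulrNz; exact: circle_pointBn.
Qed.

Lemma circle_point_surj (a : R) (u : 'rV[R]_2) : sphere u ->
  exists2 s, 0 <= s < 1 & u = circle_point (a + s).
Proof.
rewrite /sphere /= sqnorm2; set x := u _ _; set y := u _ _ => xy.
have x1 : -1 <= x <= 1 by apply/andP; split; nra.
have pi2 : 2 * pi != 0 :> R by rewrite mulf_neq0// gt_eqF// pi_gt0.
have [t ut] : exists t, u = circle_point t.
  pose al := if 0 <= y then acos x else - acos x.
  exists (al / (2 * pi)); have [c s] := circle_pointE (al / (2 * pi)).
  have sy : sin (acos x) = `|y|.
    by rewrite sin_acos// (_ : 1 - x ^+ 2 = y ^+ 2) ?sqrtr_sqr//; lra.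
  apply: rV2P; rewrite ?c ?s mulrC divfK// /al.
    by case: ifP; rewrite ?cosN acosK// in_itv.
  case: ifPn => [y0|]; first by rewrite sy ger0_norm.
  by rewrite -ltNge => y0; rewrite sinN sy ltr0_norm ?opprK.
have /andP[f1 f2] := floor_itv (t - a).
exists (t - a - (Num.floor (t - a))%:~R).
  by rewrite subr_ge0 f1 ltrBlDr [1 + _]addrC -intrD1.
rewrite (_ : a + _ = t + (- Num.floor (t - a))%:~R) ?circle_pointDz//.
by rewrite mulrNz; ring.
Qed.

(** With d = s - t, the addition formula gives cos(2 pi d) = 1, the half-angle formula sin(pi d) =
    0, and sin has no zero strictly between 0 and pi. *)
Lemma circle_point_inj (s t : R) : circle_point s = circle_point t ->
  `|s - t| < 1 -> s = t.
Proof.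
have [cs ss] := circle_pointE s; have [ct st] := circle_pointE t.
move=> st' d12; have ec := congr1 (fun u : 'rV[R]_2 => u ord0 ord0) st'.
have es := congr1 (fun u : 'rV[R]_2 => u ord0 (lift ord0 ord0)) st'.
move: ec es d12; rewrite cs ct ss st => ec es; rewrite ltr_norml => /andP[d1 d2].
have c1 : cos (2 * pi * (s - t)) = 1.
  by rewrite mulrBr cosB ec es -!expr2 cos2Dsin2.
have h : cos (2 * pi * (s - t)) = 1 - sin (pi * (s - t)) ^+ 2 *+ 2.
  rewrite (_ : 2 * pi * (s - t) = (pi * (s - t)) *+ 2); last by rewrite -mulr_natl; ring.
  by rewrite cos_mulr2n cos2sin2; rewrite !mulr2n; ring.
have s0 : sin (pi * (s - t)) = 0.
  by apply/eqP; rewrite -sqrf_eq0; apply/eqP; move: h; rewrite c1 mulr2n; lra.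
have pi0 := pi_gt0 R.
have [d|d|/eqP] := ltgtP 0 (s - t); last by rewrite eq_sym subr_eq0 => /eqP.
  have : 0 < sin (pi * (s - t)) by apply: sin_gt0_pi; apply/andP; split; nra.
  by rewrite s0 ltxx.
have : 0 < sin (- (pi * (s - t))) by apply: sin_gt0_pi; apply/andP; split; nra.
by rewrite sinN s0 oppr0 ltxx.
Qed.

Lemma circle_point_eq (s t : R) : circle_point s = circle_point t ->
  exists k : int, s = t + k%:~R.
Proof.
move=> st; exists (Num.floor (s - t)); have /andP[f1 f2] := floor_itv (s - t).
apply: circle_point_inj; first by rewrite circle_pointDz.
by rewrite opprD addrA ger0_norm ?subr_ge0// ltrBlDr [1 + _]addrC -intrD1.
Qed.

(** Induction along the real interval by a supremum argument; it takes the place of a subdivision of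
    [0, 1] finer than a Lebesgue number. *)
Lemma interval_induction (Q : R -> Prop) : Q 0 ->
  (forall t, 0 <= t <= 1 -> exists2 e, 0 < e & forall s s',
    0 <= s -> s <= s' -> s' <= 1 -> `|s - t| < e -> `|s' - t| < e -> Q s -> Q s') ->
  Q 1.
Proof.
move=> Q0 Qe; pose S := [set t | 0 <= t <= 1 /\ Q t].
have S0 : S 0 by split => //; rewrite lexx ler01.
have hS : has_sup S by split; [exists 0|exists 1 => t [/andP[]]].
have c0 : 0 <= sup S by apply: sup_upper_bound.
have c1 : sup S <= 1 by apply: ge_sup; [exists 0|move=> t [/andP[]]].
have [|e e0 he] := Qe (sup S); first by rewrite c0.
have [s [/andP[s0 s1] Qs] se] := sup_adherent e0 hS.
have sc : s <= sup S by apply: sup_upper_bound => //; split => //; rewrite s0.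
(* A step beyond the supremum: [Q s'] contradicts maximality unless the minimum is 1, which is the
   conclusion. *)
pose s' := Num.min 1 (sup S + e / 2).
have s'1 : s' <= 1 by rewrite ge_min lexx.
have ss' : s <= s' by rewrite le_min s1 (le_trans sc)// lerDl divr_ge0// ltW.
have Qs' : Q s'.
  apply: (he s s') => //; first by rewrite ler0_norm; lra.
  have : s' <= sup S + e / 2 by rewrite ge_min lexx orbT.
  have : sup S <= s' by rewrite le_min c1 lerDl divr_ge0// ltW.
  by move=> *; rewrite ger0_norm; lra.
have : s' <= sup S by apply: sup_upper_bound => //; split=> //; rewrite (le_trans s0 ss').
rewrite ge_min => /orP[h|]; last by lra.
by move: Qs'; rewrite /s' min_l//; lra.
Qed.

Lemma asin0 : asin 0 = 0 :> R.
Proof.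
have p0 := pi_gt0 R.
by rewrite -[X in asin X]sin0 sinK// in_itv /=; apply/andP; split; lra.
Qed.

Lemma itv_setU (a b c : R) : a <= b -> b <= c ->
  `[a, c] `<=` (`[a, b] `|` `[b, c] : set R).
Proof.
move=> ab bc x /=; rewrite !in_itv /= => /andP[ax xc].
by have [xb|/ltW bx] := leP x b; [left|right]; rewrite ?ax ?bx.
Qed.

(* Consecutive points of a fine subdivision make an angle less than pi/2, which
   the arcsine of their cross product recovers. *)
Lemma circle_lift (w : R -> 'rV[R]_2) : {within `[0, 1], continuous w} ->
  (forall t, 0 <= t <= 1 -> sphere (w t)) ->
  exists2 eta : R -> R, {within `[0, 1], continuous eta} &
    forall t, 0 <= t <= 1 -> circle_point (eta t) = w t.
Proof.
move=> cw ws.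
pose Q (t : R) := exists2 eta : R -> R, {within `[0, t], continuous eta} &
  forall x, 0 <= x <= t -> circle_point (eta x) = w x.
suff : Q 1 by [].
have h01 : 0 <= (0 : R) <= 1 by rewrite lexx ler01.
apply: (@interval_induction Q) => [|t t01].
  have [s _ w0] := circle_point_surj 0 (ws 0 h01).
  exists (fun=> 0 + s); first by apply: continuous_subspaceT; exact: cst_continuous.
  by move=> x; rewrite -eq_le => /eqP <-.
pose x0 (u : 'rV[R]_2) := u ord0 ord0.
pose x1 (u : 'rV[R]_2) := u ord0 (lift ord0 ord0).
have cx0 : continuous x0 by exact: coord_continuous.
have cx1 : continuous x1 by exact: coord_continuous.
(* Two points within 1/4 of [w t] in each coordinate differ by less than 1/2 in each. For unit
   vectors the scalar product is 1 minus half the squared distance, hence positive, and the angle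
   between them is less than pi/2. *)
have [e e0 he] : exists2 e, 0 < e & forall x, 0 <= x <= 1 -> `|x - t| < e ->
    `|x0 (w x) - x0 (w t)| < 4^-1 /\ `|x1 (w x) - x1 (w t)| < 4^-1.
  pose U := [set u : 'rV[R]_2 | `|x0 u - x0 (w t)| < 4^-1] `&`
            [set u | `|x1 u - x1 (w t)| < 4^-1].
  have oU : open U.
    apply: openI.
      have -> : [set u : 'rV[R]_2 | `|x0 u - x0 (w t)| < 4^-1] =
        x0 @^-1` (ball (x0 (w t)) 4^-1) by apply/seteqP; split=> u; rewrite /ball /= distrC.
      by apply: open_comp => [u _|]; [exact: cx0|exact: ball_open].
    have -> : [set u : 'rV[R]_2 | `|x1 u - x1 (w t)| < 4^-1] =
      x1 @^-1` (ball (x1 (w t)) 4^-1) by apply/seteqP; split=> u; rewrite /ball /= distrC.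
    by apply: open_comp => [u _|]; [exact: cx1|exact: ball_open].
  have Ut : U (w t) by split; rewrite /= subrr normr0 invr_gt0.
  have [W [oW Wt WU]] := (withinP _ _).1 cw t t01 U oU Ut.
  have /nbhs_ballP[e e0 eW] := open_nbhs_nbhs (conj oW Wt).
  exists e => // x x01 xt; apply: (WU x) => //.
  by apply: eW; rewrite /ball /= distrC.
exists e => // s s' s0 ss' s'1 st s't [eta ceta etaw].
have s1 : s <= 1 by exact: le_trans ss' s'1.
pose p := w s.
pose cr x := x0 p * x1 (w x) - x1 p * x0 (w x).
have dotcr x : s <= x <= s' -> -1 < cr x < 1 /\
    cos (asin (cr x)) = x0 p * x0 (w x) + x1 p * x1 (w x).
  move=> /andP[sx xs'].
  have xt : `|x - t| < e.
    by move: st s't; rewrite !ltr_norml => /andP[? ?] /andP[? ?]; apply/andP; split; lra.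
  have x01 : 0 <= x <= 1 by apply/andP; split; lra.
  have [a0 a1] := he x x01 xt; have [b0 b1] : `|x0 p - x0 (w t)| < 4^-1 /\ `|x1 p - x1 (w t)| < 4^-1.
    by apply: he => //; rewrite s0.
  have := ws x x01; have := ws s; rewrite s0 => /(_ s1).
  rewrite /sphere /= !sqnorm2 -/p -/(x0 _) -/(x1 _) -/(x0 (w x)) -/(x1 (w x)) => np nx.
  move: a0 a1 b0 b1 np nx; rewrite /cr.
  set a := x0 p; set b := x1 p; set c := x0 (w x); set d := x1 (w x).
  rewrite !ltr_norml => /andP[a1 a2] /andP[a3 a4] /andP[a5 a6] /andP[a7 a8] np nx.
  have dot : 0 < a * c + b * d.
    have e1 : 0 < (2^-1 - (a - c)) * (2^-1 + (a - c)) by apply: mulr_gt0; lra.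
    have e2 : 0 < (2^-1 - (b - d)) * (2^-1 + (b - d)) by apply: mulr_gt0; lra.
    by nra.
  have id : (a * d - b * c) ^+ 2 + (a * c + b * d) ^+ 2 = 1.
    rewrite (_ : _ + _ = (a ^+ 2 + b ^+ 2) * (c ^+ 2 + d ^+ 2)); last by ring.
    by rewrite np nx mulr1.
  have c1 : -1 < a * d - b * c < 1 by apply/andP; split; nra.
  split => //; rewrite cos_asin; last first.
    by case/andP: c1 => /ltW -> /ltW ->.
  rewrite (_ : 1 - _ = (a * c + b * d) ^+ 2) ?sqrtr_sqr ?gtr0_norm//.
  by move: id; lra.
pose ext x := eta s + asin (cr x) / (2 * pi).
have pi2 : 2 * pi != 0 :> R by rewrite mulf_neq0// gt_eqF// pi_gt0.
have exts : ext s = eta s.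
  by rewrite /ext (_ : cr s = 0) ?asin0 ?mul0r ?addr0// /cr -/p mulrC subrr.
exists (fun x => if x <= s then eta x else ext x); last first.
  move=> x /andP[x0' xs']; case: ifPn => [xs|]; first by apply: etaw; rewrite x0'.
  rewrite -ltNge => sx; have [|/andP[c1 c2] cosc] := dotcr x.
    by rewrite (ltW sx).
  have sinc : sin (asin (cr x)) = cr x.
    by rewrite asinK// in_itv /= (ltW c1) (ltW c2).
  have := etaw s; rewrite s0 lexx => /(_ isT) ps.
  have [cp sp] := circle_pointE (eta s); have [cx sx'] := circle_pointE (ext x).
  have := ws s; rewrite s0 => /(_ s1); rewrite /sphere /= sqnorm2 -/p => np.
  rewrite ps -/p in cp sp.
  have arg : 2 * pi * ext x = 2 * pi * eta s + asin (cr x).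
    by rewrite /ext mulrDr; congr (_ + _); rewrite mulrC divfK.
  apply: rV2P; rewrite ?cx ?sx' arg ?cosD ?sinD cosc sinc -cp -sp /cr /x0 /x1.
    rewrite -[RHS]mul1r -np; ring.
  by rewrite -[RHS]mul1r -np; ring.
apply: (continuous_subspaceW (itv_setU s0 ss')).
apply: withinU_continuous; [exact: itv_closed|exact: itv_closed| |].
  apply: within_ext ceta => x /=; rewrite in_itv /= => /andP[_ ->] //.
apply: (@within_ext _ _ _ ext).
  move=> x /=; rewrite in_itv /= => /andP[sx _]; case: ifPn => // xs.
  by rewrite (_ : x = s)//; apply/eqP; rewrite eq_le xs.
have ccr : {within `[s, s'], continuous cr}.
  have cw' : {within `[s, s'], continuous w}.
    apply: continuous_subspaceW cw => x /=; rewrite !in_itv /= => /andP[? ?].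
    by apply/andP; split; lra.
  move=> x; apply: cvgB; apply: cvgMl_tmp.
    exact: (within_compT cw' cx1).
  exact: (within_compT cw' cx0).
have casin : {within [set c : R | -1 < c < 1], continuous (@asin R)}.
  by apply: continuous_in_subspaceT => c; rewrite inE => c1; exact: continuous_asin.
have cac : {within `[s, s'], continuous (@asin R \o cr)}.
  by apply: (within_comp _ ccr casin) => x; rewrite /= in_itv => /dotcr[].
by move=> x; apply: cvgD; [exact: cvg_cst|apply: cvgMr_tmp; exact: cac].
Qed.

End Circle.

(** * Loops and maps of the disk *)

Section Loops.
Variables (R : realType) (K : topologicalType).
Local Notation I := (`[0, 1]%classic : set R).

Lemma itv01P (t : R) : I t <-> 0 <= t <= 1.
Proof. by rewrite /= in_itv. Qed.

(** A straight-line homotopy pushed forward by [r]. It is stated for a general convex situation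
    because it serves the disk, simplices, balls of the ambient space and the real line. *)
Lemma loop_homotopic_convex (V : normedModType R) (C : set V) (r : V -> K)
    (w w' : R -> V) (x0 : K) :
  {within C, continuous r} -> {within I, continuous w} ->
  {within I, continuous w'} ->
  (forall s t, 0 <= s <= 1 -> 0 <= t <= 1 -> C ((1 - t) *: w s + t *: w' s)) ->
  w 0 = w' 0 -> w 1 = w' 1 -> r (w 0) = x0 -> r (w 1) = x0 ->
  loop_homotopic x0 (r \o w) (r \o w').
Proof.
move=> cr cw cw' Cw e0 e1 r0 r1.
exists (fun p => r ((1 - p.2) *: w p.1 + p.2 *: w' p.1)); split; last first.
  move=> s s01; split => /=.
  - by rewrite subr0 scale1r scale0r addr0.
  - by rewrite subrr scale0r scale1r add0r.
  - by rewrite -e0 -scalerDl subrK scale1r.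
  - by rewrite -e1 -scalerDl subrK scale1r.
have cwf : {within I `*` I, continuous (fun p => w p.1)}.
  apply: (within_comp (f := fst) _ _ cw) => [p []//|].
  by apply: continuous_subspaceT; exact: fst_continuous.
have cwf' : {within I `*` I, continuous (fun p => w' p.1)}.
  apply: (within_comp (f := fst) _ _ cw') => [p []//|].
  by apply: continuous_subspaceT; exact: fst_continuous.
have cs : {within I `*` I, continuous (@snd R R)}.
  by apply: continuous_subspaceT; exact: snd_continuous.
apply: (@within_comp (R * R)%type V K (I `*` I) C (fun p => (1 - p.2) *: w p.1 + p.2 *: w' p.1) r) => //.
  by move=> [s t] [/itv01P s01 /itv01P t01]; exact: Cw.
apply: withinD; apply: withinZ => //.
by apply: (@withinB _ R^o) => //; exact: within_cst.
Qed.

Lemma loop_homotopic_ext (x0 : K) (f g : R -> K) : loop x0 f ->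
  (forall t, 0 <= t <= 1 -> f t = g t) -> loop_homotopic x0 f g.
Proof.
move=> [cf f0 f1] fg; exists (fun p => f p.1); split.
  apply: (within_comp (f := fst) _ _ cf) => [p []//|].
  by apply: continuous_subspaceT; exact: fst_continuous.
by move=> s s01; split => //; exact: fg.
Qed.

Lemma loop_ext (x0 : K) (f g : R -> K) : loop x0 f ->
  (forall t, 0 <= t <= 1 -> f t = g t) -> loop x0 g.
Proof.
move=> [cf f0 f1] fg; split; rewrite -?fg ?lexx ?ler01//.
by apply: within_ext cf => t /itv01P/fg.
Qed.

Lemma loop_cat_continuous (a b : R -> R) : a 1 = b 0 ->
  {within I, continuous a} -> {within I, continuous b} ->
  {within I, continuous (loop_cat a b)}.
Proof.
move=> ab ca cb.
have h0 : (0 : R) <= 2^-1 by rewrite invr_ge0.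
have h1 : (2^-1 : R) <= 1 by rewrite invf_le1// ler1n.
apply: (continuous_subspaceW (itv_setU h0 h1)).
have aff (x y : R) : continuous (fun s : R => x * s - y).
  by move=> s; apply: cvgB; [apply: cvgMl_tmp; exact: cvg_id|exact: cvg_cst].
apply: withinU_continuous; [exact: itv_closed|exact: itv_closed| |].
  apply: (@within_ext _ _ _ (a \o (fun s => 2 * s - 0))).
    by move=> s /=; rewrite in_itv /= /loop_cat => /andP[_ ->]; rewrite subr0.
  apply: (within_comp _ _ ca); last by apply: continuous_subspaceT; exact: aff.
  by move=> s /=; rewrite !in_itv /= => /andP[? ?]; apply/andP; split; lra.
apply: (@within_ext _ _ _ (b \o (fun s => 2 * s - 1))).
  move=> s /=; rewrite in_itv /= /loop_cat => /andP[s2 _].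
  case: ifPn => // s2'; have -> : s = 2^-1 by apply/eqP; rewrite eq_le s2 s2'.
  by rewrite mulfV// subrr -ab.
apply: (within_comp _ _ cb); last by apply: continuous_subspaceT; exact: aff.
by move=> s /=; rewrite !in_itv /= => /andP[? ?]; apply/andP; split; lra.
Qed.

Lemma loop_cat0 (a b : R -> R) : loop_cat a b 0 = a 0.
Proof. by rewrite /loop_cat invr_ge0 ler0n mulr0. Qed.

Lemma loop_cat1 (a b : R -> R) : loop_cat a b 1 = b 1.
Proof. by rewrite /loop_cat ifN ?mulr1 ?addrK// -ltNge invf_lt1// ltr1n. Qed.

Lemma affine_path_continuous (a b : R) :
  {within I, continuous (fun t : R => a + b * t : R)}.
Proof.
apply: continuous_subspaceT => t.
by apply: cvgD; [exact: cvg_cst|apply: cvgMl_tmp; exact: cvg_id].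
Qed.

(* Both sides say that [F] factors through the quotient of the square by three of
   its sides. *)
Lemma disk_extensionP (F : R -> K) (a : R) : continuous F ->
  hausdorff_space K -> (forall t, F (t + 1) = F t) ->
  (exists2 H : 'rV[R]_2 -> K, {within @disk R 2, continuous H} &
     forall t, H (circle_point t) = F t) <->
  loop_homotopic (F a) (fun t => F (a + t)) (fun=> F a).
Proof.
move=> cF hK F1; split=> [[H cH HF]|[H [cH Hb]]].
  have -> : (fun t => F (a + t)) = H \o (fun t => circle_point (a + t)).
    by apply/funext => t; rewrite /= HF.
  have -> : (fun=> F a) = H \o (fun=> circle_point a) :> (R -> K).
    by apply/funext => t; rewrite /= HF.
  apply: (@loop_homotopic_convex _ (@disk R 2) H _ _ _ cH).
  - apply: (@within_ext _ _ _ (fun t : R => circle_point (a + 1 * t))).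
      by move=> t _; rewrite mul1r.
    exact: (within_compT (@affine_path_continuous a 1) (@circle_point_continuous R)).
  - by apply: continuous_subspaceT; exact: cst_continuous.
  - move=> s t s01 t01; apply: disk_convex => //; apply: sphere_disk; exact: circle_point_sphere.
  - by rewrite addr0.
  - by rewrite circle_pointD1.
  - by rewrite addr0 HF.
  - by rewrite circle_pointD1 HF.
pose P (p : R * R) : 'rV[R]_2 := (1 - p.2) *: circle_point (a + p.1).
have cP : continuous P.
  move=> p; apply: (@continuousZ _ _ _ (fun p : R * R => 1 - p.2)).
    by apply: (@continuousB _ _ _ (fun=> 1 : R^o)); [exact: cst_continuous|exact: snd_continuous].
  apply: (@continuous_comp _ _ _ (fun p : R * R => a + p.1)); last exact: circle_point_continuous.
  by apply: (@continuousD _ _ _ (fun=> a : R^o)); [exact: cst_continuous|exact: fst_continuous].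
have nP p : (I `*` I) p -> nrm (P p) = 1 - p.2.
  move=> [_ /itv01P/andP[? ?]]; rewrite nrmZ ger0_norm ?subr_ge0//.
  by rewrite (sphere_nrm _).1 ?mulr1//; exact: circle_point_sphere.
have Psurj u : disk u -> exists2 p, (I `*` I) p & P p = u.
  move=> /disk_nrm u1; have [u0|u0] := eqVneq (nrm u) 0.
    exists (0, 1); first by split; apply/itv01P; rewrite ?lexx ?ler01.
    by rewrite /P subrr scale0r (nrm_eq0 u0).
  have {}u0 : 0 < nrm u by rewrite lt_neqAle eq_sym u0 nrm_ge0.
  have [s /andP[s0 s1] us] := circle_point_surj a (sphere_normalize u0).
  exists (s, 1 - nrm u).
    split; apply/itv01P; first by rewrite s0 ltW.
    by rewrite subr_ge0 u1 gerBl (ltW u0).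
  by rewrite /P /= subKr -us scalerA mulfV ?scale1r// gt_eqF.
(* [P] identifies only the points of the side t = 1, all sent to the origin, and the points (0, t)
   and (1, t). On these three sides the homotopy takes the single value [F a], so [H] factors
   through [P]. *)
have HP p p' : (I `*` I) p -> (I `*` I) p' -> P p = P p' -> H p = H p'.
  case: p p' => s t [s' t'] [/= /itv01P s01 /itv01P t01] [/= /itv01P s01' /itv01P t01'] E.
  have tt' : t = t'.
    have := congr1 (@nrm R 2) E; rewrite !nP /=; try by split; apply/itv01P.
    by move=> ?; lra.
  rewrite -tt' in t01' E *; have [t1|t1] := eqVneq t 1.
    by rewrite t1; have [_ -> _ _] := Hb s s01; have [_ -> _ _] := Hb s' s01'.
  have {}E : circle_point (a + s) = circle_point (a + s').
    apply: (@scalerI _ _ (1 - t)); last exact: E.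
    by rewrite subr_eq0 eq_sym.
  have [ss|ss] := ltP `|s - s'| 1.
    have : a + s = a + s' by apply: circle_point_inj => //; rewrite opprD addrACA subrr add0r.
    by move/addrI ->.
  have [_ _ H0 H1] := Hb t t01.
  case/andP: s01 => ? ?; case/andP: s01' => ? ?.
  have : (s = 0 /\ s' = 1) \/ (s = 1 /\ s' = 0).
    by move: ss; rewrite ler_normr => /orP[?|?]; [right|left]; split; lra.
  by case=> -[-> ->]; rewrite H0 H1.
have /choice[sec secP] : forall u, exists p, disk u -> (I `*` I) p /\ P p = u.
  move=> u; have [du|du] := pselect (disk u); last by exists 0.
  by have [p Ip Pp] := Psurj u du; exists p.
have dP p : (I `*` I) p -> disk (P p).
  move=> Ip; apply/disk_nrm; rewrite nP// gerBl.
  by have [_ /itv01P/andP[]] := Ip.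
have imP : P @` (I `*` I) = @disk R 2.
  by apply/seteqP; split=> [_ [p Ip <-]|u /Psurj[p Ip <-]]; [exact: dP|exists p].
exists (H \o sec); last first.
  move=> t; have [s s01 ts] := circle_point_surj a (circle_point_sphere t).
  have [k kt] := circle_point_eq ts.
  have Is : (I `*` I) (s, 0).
    by case/andP: s01 => s0 s1; split; apply/itv01P; rewrite ?s0 ?(ltW s1) ?lexx ?ler01.
  have -> : circle_point t = P (s, 0) by rewrite /P subr0 scale1r.
  have [Isec Psec] := secP _ (dP _ Is).
  rewrite /= (HP _ _ Isec Is Psec).
  have /Hb[-> _ _ _] : 0 <= s <= 1 by case/andP: s01 => -> /ltW ->.
  have Fn x (n : nat) : F (x + n%:R) = F x.
    by elim: n x => [|n IH] x; [rewrite addr0|rewrite -natr1 addrA F1 IH].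
  rewrite kt; case: k {kt} => n; first by rewrite [_%:~R]/(n%:R) Fn.
  by rewrite NegzE mulrNz -[in LHS](subrK (n.+1%:R) (a + s)) Fn.
rewrite -imP; apply: (within_quotient (f := P)).
- by apply: compact_setX; exact: segment_compact.
- exact: norm_hausdorff.
- exact: continuous_subspaceT.
- apply: within_ext cH => p Ip; have [Isec Psec] := secP _ (dP _ Ip).
  exact: HP.
Qed.

End Loops.

(** The isomorphisms at different base points are chosen independently of one another; each
    computation with [cls] therefore stays at one base point. *)
Definition pi1_classifier (R : realType) (K : topologicalType) (G : groupType)
    (cls : K -> (R -> K) -> G) : Prop :=
  forall x0 : K,
  [/\ forall a : G, exists2 f, loop x0 f & cls x0 f = a,
      forall f g, loop x0 f -> loop x0 g ->
        (cls x0 f = cls x0 g <-> loop_homotopic x0 f g)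
    & forall f g, loop x0 f -> loop x0 g ->
        cls x0 (loop_cat f g) = (cls x0 f * cls x0 g)%g].

(** * Powers of a circle map in the fundamental group *)

Section CircleMaps.
Variables (R : realType) (K : topologicalType) (G : groupType).
Variable cls : K -> (R -> K) -> G.
Hypotheses (clsP : pi1_classifier cls) (hK : hausdorff_space K).
Local Notation I := (`[0, 1]%classic : set R).

Let cls_ext x0 (f g : R -> K) : loop x0 f -> (forall t, 0 <= t <= 1 -> f t = g t) ->
  cls x0 f = cls x0 g.
Proof.
move=> lf fg; have [_ hom _] := clsP x0.
by apply/hom => //; [exact: loop_ext lf fg|exact: loop_homotopic_ext].
Qed.

Let loop_cst (x0 : K) : @loop R K x0 (fun=> x0).
Proof. by split => //; exact: within_cst. Qed.

Lemma cls_cst x0 : cls x0 (fun=> x0) = 1%g.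
Proof.
have [_ _ cat] := clsP x0.
have := cat _ _ (loop_cst x0) (loop_cst x0).
rewrite (_ : loop_cat _ _ = fun=> x0); last by apply/funext => s; rewrite /loop_cat; case: ifP.
by move=> e; apply: (mulgI (cls x0 (fun=> x0))); rewrite mulg1 -e.
Qed.

Section PeriodicPath.
Variable F : R -> K.
Hypothesis cF : continuous F.

Let loop_path (x0 : K) (th : R -> R) : {within I, continuous th} ->
  F (th 0) = x0 -> F (th 1) = x0 -> loop x0 (F \o th).
Proof. by move=> cth e; split => //; exact: within_compT. Qed.

(** The real line is convex, so the class of [F \o th] depends only on the end points of [th]. *)
Let cls_path (x0 : K) (th th' : R -> R) : {within I, continuous th} ->
  {within I, continuous th'} -> th 0 = th' 0 -> th 1 = th' 1 ->
  F (th 0) = x0 -> F (th 1) = x0 -> cls x0 (F \o th) = cls x0 (F \o th').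
Proof.
move=> cth cth' e0 e1 f0 f1; have [_ hom _] := clsP x0; apply/hom.
- exact: loop_path.
- by apply: loop_path => //; rewrite -?e0 -?e1.
- apply: (@loop_homotopic_convex _ _ R^o setT) => //.
  exact: continuous_subspaceT.
Qed.

Let cls_loop_cat (x0 : K) (th th' th'' : R -> R) : {within I, continuous th} ->
  {within I, continuous th'} -> {within I, continuous th''} ->
  th 1 = th' 0 -> th'' 0 = th 0 -> th'' 1 = th' 1 ->
  F (th 0) = x0 -> F (th 1) = x0 -> F (th' 1) = x0 ->
  cls x0 (F \o th'') = (cls x0 (F \o th) * cls x0 (F \o th'))%g.
Proof.
move=> cth cth' cth'' m e0 e1 f0 f1 f2; have [_ _ cat] := clsP x0.
rewrite -cat; [|exact: loop_path|by apply: loop_path; rewrite -?m].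
have -> : loop_cat (F \o th) (F \o th') = F \o loop_cat th th'.
  by apply/funext => s; rewrite /loop_cat /=; case: ifP.
apply: cls_path => //.
- exact: loop_cat_continuous.
- by rewrite loop_cat0.
- by rewrite loop_cat1.
- by rewrite e0.
- by rewrite e1.
Qed.

Hypothesis F1 : forall t, F (t + 1) = F t.

Let Fn (t : R) (n : nat) : F (t + n%:R) = F t.
Proof. by elim: n => [|n IH]; [rewrite addr0|rewrite -natr1 addrA F1]. Qed.

Definition turn (a : R) : G := cls (F a) (fun t => F (a + t)).

(** The path of length n + 1 is one turn followed by n turns starting at a + 1; periodicity of [F]
    brings the second piece back to [a]. *)
Let turnX (a : R) (n : nat) : cls (F a) (fun t => F (a + n%:R * t)) = (turn a ^+ n)%g.
Proof.
elim: n => [|n IH].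
  rewrite expg0 -(cls_cst (F a)); congr cls; apply/funext => t /=.
  by rewrite mul0r addr0.
rewrite expgS -IH (_ : turn a = cls (F a) (F \o (fun t => a + 1 * t))); last first.
  by congr cls; apply/funext => t; rewrite /= mul1r.
rewrite (_ : (fun t => F (a + n%:R * t)) = F \o (fun t => (a + 1) + n%:R * t)).
  apply: (@cls_loop_cat (F a) (fun t => a + 1 * t) (fun t => (a + 1) + n%:R * t)
    (fun t => a + n.+1%:R * t)); try exact: affine_path_continuous.
  - by rewrite mulr1 mulr0 addr0.
  - by rewrite !mulr0.
  - by rewrite !mulr1 -natr1; ring.
  - by rewrite mulr0 addr0.
  - by rewrite mulr1 F1.
  - by rewrite mulr1 Fn F1.
by apply/funext => t /=; rewrite -(F1 (a + _)); congr F; ring.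
Qed.

(** Going n turns forward and then n turns back is a path with equal ends, so it has the class of a
    constant loop. *)
Let turnV (a : R) (n : nat) :
  cls (F a) (fun t => F (a + (- n%:R) * t)) = (turn a ^- n)%g.
Proof.
have e : cls (F a) (F \o (fun t => a + 0 * t)) = 1%g.
  rewrite -(cls_cst (F a)); congr cls; apply/funext => t /=.
  by rewrite mul0r addr0.
apply: (mulgI (turn a ^+ n)%g); rewrite mulgV -e -turnX.
rewrite (_ : (fun t => F (a + - n%:R * t)) = F \o (fun t => (a + n%:R) + - n%:R * t)).
  apply/esym/(@cls_loop_cat (F a) (fun t => a + n%:R * t)
    (fun t => (a + n%:R) + - n%:R * t) (fun t => a + 0 * t));
    try exact: affine_path_continuous.
  - by rewrite mulr1 mulr0 addr0.
  - by rewrite !mulr0.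
  - by rewrite !mulr1; ring.
  - by rewrite mulr0 addr0.
  - by rewrite mulr1 Fn.
  - by rewrite mulr1 addrK.
by apply/funext => t /=; rewrite -(Fn (a + _) n); congr F; ring.
Qed.

Lemma cls_winding (th : R -> R) (n : nat) : {within I, continuous th} ->
  (th 1 = th 0 + n%:R -> cls (F (th 0)) (F \o th) = (turn (th 0) ^+ n)%g) /\
  (th 1 = th 0 - n%:R -> cls (F (th 0)) (F \o th) = (turn (th 0) ^- n)%g).
Proof.
move=> cth; split=> e; rewrite -(turnX, turnV).
  apply: (cls_path (th' := fun t => th 0 + n%:R * t)) => //.
  - exact: affine_path_continuous.
  - by rewrite mulr0 addr0.
  - by rewrite mulr1.
  - by rewrite e Fn.
apply: (cls_path (th' := fun t => th 0 + - n%:R * t)) => //.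
- exact: affine_path_continuous.
- by rewrite mulr0 addr0.
- by rewrite mulr1.
- by rewrite e -(Fn _ n) subrK.
Qed.

(** The form, free of base points, of the condition that the N-th power of the class of [F] is
    trivial. *)
Definition bounds_disk (N : nat) : Prop :=
  exists2 H : 'rV[R]_2 -> K, {within @disk R 2, continuous H} &
    forall t, H (circle_point t) = F (N%:R * t).

Lemma bounds_diskP (N : nat) (a : R) : (0 < N)%N ->
  bounds_disk N <-> (turn a ^+ N)%g = 1%g.
Proof.
move=> N0; have N0' : N%:R != 0 :> R by rewrite pnatr_eq0 -lt0n.
have cFN : continuous (fun t : R => F (N%:R * t)).
  by move=> t; apply: continuous_comp; [apply: cvgMl_tmp; exact: cvg_id|exact: cF].
have FN1 t : F (N%:R * (t + 1)) = F (N%:R * t) by rewrite mulrDr mulr1 Fn.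
(* The circle is based at a/N because the N-fold map sends that parameter to [a]. *)
have := disk_extensionP (a / N%:R) cFN hK FN1.
rewrite (_ : N%:R * (a / N%:R) = a); last by rewrite mulrCA mulfV// mulr1.
rewrite (_ : (fun t => F (N%:R * _)) = fun t => F (a + N%:R * t)); last first.
  by apply/funext => t; rewrite mulrDr mulrCA mulfV// mulr1.
rewrite -turnX => iff; apply: (iff_trans iff).
have lF : loop (F a) (fun t => F (a + N%:R * t)).
  apply: (@loop_path _ (fun t => a + N%:R * t)).
  - exact: affine_path_continuous.
  - by rewrite mulr0 addr0.
  - by rewrite mulr1 Fn.
have [_ hom _] := clsP (F a); rewrite -(cls_cst (F a)).
by apply: iff_sym; apply: hom.
Qed.

End PeriodicPath.

Section Pullback.
Variables (F F' : R -> K) (th : R -> R).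
Hypotheses (cF : continuous F) (F1 : forall t, F (t + 1) = F t)
  (cF' : continuous F') (F1' : forall t, F' (t + 1) = F' t)
  (cth : {within I, continuous th})
  (FF' : forall t, 0 <= t <= 1 -> F' t = F (th t)).

Let turn_winding (n : nat) :
  (th 1 = th 0 + n%:R -> turn F' 0 = (turn F (th 0) ^+ n)%g) /\
  (th 1 = th 0 - n%:R -> turn F' 0 = (turn F (th 0) ^- n)%g).
Proof.
have e0 : F' 0 = F (th 0) by rewrite FF'// lexx ler01.
have -> : turn F' 0 = cls (F (th 0)) (F \o th).
  rewrite /turn -e0; apply: cls_ext.
    split; rewrite ?add0r// ?addr0//; last by rewrite -(F1' 0) add0r.
    by apply: continuous_subspaceT => t; apply: continuous_comp; [apply: cvgD; [exact: cvg_cst|exact: cvg_id]|exact: cF'].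
  by move=> t t01; rewrite add0r FF'.
exact: cls_winding.
Qed.

(** The class of [F'] is the k-th power of that of [F], with k of either sign, so it inherits a
    trivial N-th power. *)
Lemma bounds_disk_pullback (N : nat) (k : int) : (0 < N)%N ->
  th 1 = th 0 + k%:~R -> bounds_disk F N -> bounds_disk F' N.
Proof.
move=> N0 thk /(bounds_diskP cF F1 (th 0) N0) tN.
apply/(bounds_diskP cF' F1' 0 N0).
case: k thk => n thk.
  by rewrite (turn_winding n).1// expgnAC tN expg1n.
have e : th 1 = th 0 - n.+1%:R by rewrite thk NegzE mulrNz.
by rewrite (turn_winding n.+1).2// expVgn expgnAC tN expg1n invg1.
Qed.

Hypothesis th2 : th 1 - th 0 = 2.

Let turn2 : turn F' 0 = (turn F (th 0) ^+ 2)%g.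
Proof. by apply: (turn_winding 2).1; rewrite -th2; ring. Qed.

(** The class of [F'] is the square of that of [F]: passing to the attaching map halves the
    exponent, which drives the induction for 2-groups. *)
Lemma bounds_disk_half (N : nat) : (0 < N)%N ->
  bounds_disk F (2 * N) -> bounds_disk F' N.
Proof.
move=> N0 FN; apply/(bounds_diskP cF' F1' 0 N0).
rewrite turn2 -expgnA; apply/(bounds_diskP cF F1 (th 0)) => //.
by rewrite muln_gt0.
Qed.

(** The same square read the other way; this is the point at which torsion-freeness acts. *)
Lemma bounds_disk_double : torsion_free G -> bounds_disk F' 1 -> bounds_disk F 1.
Proof.
move=> tfG /(bounds_diskP cF' F1' 0 (ltn0Sn 0)); rewrite expg1 turn2 => t2.
apply/(bounds_diskP cF F1 (th 0) (ltn0Sn 0)); rewrite expg1.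
exact: (tfG _ 2 isT t2).
Qed.

End Pullback.

End CircleMaps.

(** * Simplices *)

Section SimplexGeometry.
Variables (R : realType) (n : nat).
Implicit Types (s t : {set 'I_n}) (x y : 'rV[R]_n) (K : {set {set 'I_n}}).

(** The carrier of a point of a simplex: the face whose relative interior contains it. *)
Definition support_face x : {set 'I_n} := finset (fun i => x ord0 i != 0).

Lemma simplex_support s x :
  simplex R s x -> simplex R (support_face x) x /\ support_face x \subset s.
Proof.
move=> [x0 x1 xs]; split.
  by split=> // i; rewrite inE negbK => /eqP.
by apply/fintype.subsetP => i; rewrite inE; apply: contraR => /xs ->.
Qed.

Lemma simplexS s t x : s \subset t -> simplex R s x -> simplex R t x.
Proof.
move=> /fintype.subsetP st [x0 x1 xs]; split=> // i it; apply: xs.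
by apply: contra it; exact: st.
Qed.

Lemma support_face_gt0 s x : simplex R s x -> (0 < #|support_face x|)%N.
Proof.
move=> [x0 x1 _]; rewrite card_gt0; apply/set0Pn.
have [[i xi]|x00] := pselect (exists i, x ord0 i != 0).
  by exists i; rewrite inE.
move: x1; rewrite big1 => [/esym/eqP|i _]; first by rewrite oner_eq0.
by apply/eqP; apply/negPn/negP => xi; apply: x00; exists i.
Qed.

Lemma support_faceP s x i : simplex R s x ->
  (i \in support_face x) = (0 < x ord0 i).
Proof. by move=> [x0 _ _]; rewrite inE lt_neqAle eq_sym x0 andbT. Qed.

Lemma simplex_le1 s x i : simplex R s x -> x ord0 i <= 1.
Proof.
by move=> [x0 <- _]; rewrite (bigD1 i)//= lerDl; apply: sumr_ge0 => j _.
Qed.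

Lemma coord_cont (i : 'I_n) : continuous (fun x => x ord0 i).
Proof. exact: coord_continuous. Qed.

Lemma simplex_closed s : closed (simplex R s).
Proof.
have -> : simplex R s = (\bigcap_(i in [set: 'I_n]) [set x : 'rV[R]_n | 0 <= x ord0 i]) `&`
    ([set x : 'rV[R]_n | \sum_i x ord0 i = 1] `&`
    \bigcap_(i in [set i | i \notin s]) [set x : 'rV[R]_n | x ord0 i = 0]).
  apply/seteqP; split=> x; first by case=> x0 x1 xs; split; [move=> i _; exact: x0|split].
  by move=> [x0 [x1 xs]]; split => // i; exact: x0.
apply: closedI; last apply: closedI.
- apply: closed_bigI => i _.
  exact: (closed_preimage (@coord_cont i) (@closed_ge R 0)).
- apply: (closed_preimage _ (@closed_eq R 1)).
  by apply: sum_continuous => i; exact: coord_cont.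
- apply: closed_bigI => i _.
  exact: (closed_preimage (@coord_cont i) (@closed_eq R 0)).
Qed.

Lemma simplex_compact s : compact (simplex R s).
Proof.
apply: (@rV_bounded_compact _ _ _ 1); first exact: simplex_closed.
by move=> x i xs; rewrite ger0_norm ?(simplex_le1 _ xs)//; case: xs.
Qed.

Lemma simplex_boundary_closed s : closed (simplex_boundary R s).
Proof.
have -> : simplex_boundary R s = simplex R s `&`
    \bigcup_(i in [set i | i \in s]) [set x : 'rV[R]_n | x ord0 i = 0].
  by apply/seteqP; split=> x [xs [i ? ?]]; split=> //; exists i.
apply: closedI; first exact: simplex_closed.
apply: closed_bigcup => [|i _]; first exact: finite_finset.
exact: (closed_preimage (@coord_cont i) (@closed_eq R 0)).
Qed.

Lemma realization_compact K : compact (realization R K).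
Proof.
rewrite /realization (_ : \bigcup_(s in _) _ = \big[setU/set0]_(s <- enum K) simplex R s).
  by apply: bigsetU_compact => s _; exact: simplex_compact.
rewrite -bigcup_seq; apply: eq_bigcupl; split=> s /=; by rewrite mem_enum.
Qed.

Lemma realization_support K x : complex2 K -> realization R K x ->
  support_face x \in K /\ simplex R (support_face x) x.
Proof.
move=> cK [s /= sK xs]; have [xx xsub] := simplex_support xs.
by split=> //; apply: (cK s sK).2 => //; exact: support_face_gt0 xs.
Qed.

Lemma skeleton1_complex K : complex2 K -> complex2 (skeleton1 K).
Proof.
move=> cK s; rewrite inE => /andP[sK s2]; split; first exact: (cK s sK).1.
move=> t ts t0; rewrite inE (cK s sK).2//=.
exact: leq_trans (subset_leq_card ts) s2.
Qed.

Lemma skeleton1_realization K : realization R (skeleton1 K) `<=` realization R K.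
Proof. by move=> x [s /=]; rewrite inE => /andP[sK _] xs; exists s. Qed.

Lemma skeleton1P K x : complex2 K -> realization R K x ->
  realization R (skeleton1 K) x <-> (#|support_face x| <= 2)%N.
Proof.
move=> cK Kx; split=> [[s /=]|x2].
  rewrite inE => /andP[sK s2] /simplex_support[_ xs].
  exact: leq_trans (subset_leq_card xs) s2.
have [xK xx] := realization_support cK Kx.
by exists (support_face x) => //=; rewrite inE xK.
Qed.

Lemma simplex_boundaryP s x : #|s| = 3%N -> simplex R s x ->
  simplex_boundary R s x <-> (#|support_face x| <= 2)%N.
Proof.
move=> s3 xs; have [_ xsub] := simplex_support xs; split=> [[_ [i si xi]]|x2].
  rewrite -ltnS -s3; apply: proper_card; apply/properP; split=> //.
  by exists i => //; rewrite inE xi eqxx.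
have [[i /andP[si xi]]|nx] := pselect (exists i, (i \in s) && (x ord0 i == 0)).
  by split=> //; exists i => //; exact/eqP.
suff : s \subset support_face x by move=> /subset_leq_card; rewrite s3 leqNgt ltnS x2.
apply/fintype.subsetP => i si; rewrite inE; apply/negP => xi; apply: nx.
by exists i; rewrite si.
Qed.

Lemma simplex_interior s x : simplex R s x -> ~ simplex_boundary R s x ->
  support_face x = s.
Proof.
move=> xs xb; have [_ xsub] := simplex_support xs.
apply/eqP; rewrite finset.eqEsubset xsub; apply/fintype.subsetP => i si; rewrite inE.
by apply/negP => /eqP xi; apply: xb; split=> //; exists i.
Qed.

Lemma barycenterE s i : barycenter R s ord0 i = if i \in s then #|s|%:R^-1 else 0.
Proof. by rewrite mxE. Qed.

Lemma barycenter_simplex s : (0 < #|s|)%N -> simplex R s (barycenter R s).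
Proof.
move=> s0; split=> [i||i si].
- by rewrite barycenterE; case: ifP; rewrite ?invr_ge0.
- under eq_bigr do rewrite barycenterE.
  rewrite -big_mkcond /= sumr_const -[LHS]mulr_natl mulfV// pnatr_eq0 -lt0n//.
- by rewrite barycenterE (negbTE si).
Qed.

Lemma simplex_convex s x y (a : R) : 0 <= a <= 1 ->
  simplex R s x -> simplex R s y -> simplex R s ((1 - a) *: x + a *: y).
Proof.
case/andP=> a0 a1 [x0 x1 xs] [y0 y1 ys]; split=> [i||i si]; rewrite ?mxE.
- by rewrite addr_ge0// mulr_ge0// subr_ge0.
- under eq_bigr do rewrite !mxE.
  by rewrite big_split /= -!mulr_sumr x1 y1 !mulr1 subrK.
- by rewrite xs// ys// !mulr0 addr0.
Qed.

Lemma cone_point_support s y (a : R) : (0 < #|s|)%N -> 0 < a <= 1 ->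
  simplex R s y -> support_face ((1 - a) *: y + a *: barycenter R s) = s.
Proof.
move=> s0 /andP[a0 a1] ys; have bs := barycenter_simplex s0.
have cs : simplex R s ((1 - a) *: y + a *: barycenter R s).
  by apply: simplex_convex => //; rewrite (ltW a0).
apply: simplex_interior => // -[_ [i si]]; rewrite !mxE si.
have : 0 < a * #|s|%:R^-1 by rewrite mulr_gt0// invr_gt0 ltr0n.
have : 0 <= (1 - a) * y ord0 i by rewrite mulr_ge0 ?subr_ge0//; case: ys.
by move=> *; lra.
Qed.

(** At a vertex [i] where [y] vanishes, the cone point has coordinate a/|s|, while the other
    expression gives at least a'/|s|. Hence a' is at most a, and by symmetry they are equal. *)
Lemma cone_point_inj s y y' (a a' : R) : (0 < #|s|)%N -> 0 <= a <= 1 -> 0 <= a' <= 1 ->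
  simplex_boundary R s y -> simplex_boundary R s y' ->
  (1 - a) *: y + a *: barycenter R s = (1 - a') *: y' + a' *: barycenter R s ->
  a = a' /\ (a < 1 -> y = y').
Proof.
have le z z' (b b' : R) : (0 < #|s|)%N -> 0 <= b' <= 1 ->
    simplex_boundary R s z -> simplex_boundary R s z' ->
    (1 - b) *: z + b *: barycenter R s = (1 - b') *: z' + b' *: barycenter R s ->
    b' <= b.
  move=> s0 /andP[b0 b1] [_ [i si zi]] [[z'0 _ _] _] /rowP/(_ i).
  rewrite !mxE si zi mulr0 add0r => E.
  rewrite -(@ler_pM2r _ #|s|%:R^-1) ?invr_gt0 ?ltr0n// E lerDr.
  by rewrite mulr_ge0// subr_ge0.
move=> s0 a01 a01' yb yb' E; have aa : a = a'.
  by apply/eqP; rewrite eq_le (le _ _ _ _ _ _ yb' yb (esym E))// (le _ _ _ _ _ _ yb yb' E).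
split=> // a1; move: E; rewrite -aa => /addIr.
by apply: scalerI; rewrite subr_eq0 gt_eqF.
Qed.

Lemma cone_point_surj s x : (0 < #|s|)%N -> simplex R s x ->
  x = barycenter R s \/ exists y a, [/\ simplex_boundary R s y, 0 <= a < 1 &
    x = (1 - a) *: y + a *: barycenter R s].
Proof.
move=> s0 [x0 x1 xs]; have s0' : 0 < #|s|%:R :> R by rewrite ltr0n.
have /card_gt0P[i0 i0s] := s0.
have [i si xmin] : exists2 i, i \in s & forall j, j \in s -> x ord0 i <= x ord0 j.
  by case: (arg_minP (fun i => x ord0 i) i0s) => i si h; exists i.
(* The cone parameter is forced: the boundary point has a zero coordinate, so the least coordinate
   of [x] must equal a/|s|. *)
pose a := #|s|%:R * x ord0 i.
have sumx : \sum_(j in s) x ord0 j = 1.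
  by rewrite -x1 [RHS](bigID (mem s)) /= [X in _ + X]big1 ?addr0// => j /xs.
have a1 : a <= 1.
  by rewrite -sumx /a mulr_natl -sumr_const; apply: ler_sum => j; exact: xmin.
have a0 : 0 <= a by rewrite mulr_ge0// ltW.
have xi : x ord0 i = a * #|s|%:R^-1 by rewrite /a mulrAC mulfV ?mul1r// gt_eqF.
have [a1'|a1'] := eqVneq a 1.
  left; apply/rowP => j; rewrite barycenterE; case: ifPn => sj; last exact: xs.
  have e : \sum_(j in s) (x ord0 j - x ord0 i) == 0.
    by rewrite sumrB sumx sumr_const -mulr_natl -/a a1' subrr.
  move: e; rewrite psumr_eq0 => [/allP/(_ j)|k sk]; last by rewrite subr_ge0 xmin.
  rewrite mem_index_enum sj subr_eq0 => /(_ isT)/eqP ->.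
  by rewrite xi a1' mul1r.
right; have {}a1 : a < 1 by rewrite lt_neqAle a1' a1.
have d0 : 1 - a != 0 by rewrite subr_eq0 eq_sym.
exists ((1 - a)^-1 *: (x - a *: barycenter R s)), a; split; last first.
- by rewrite scalerA mulfV// scale1r subrK.
- by rewrite a0.
split; last first.
  by exists i => //; rewrite !mxE si xi subrr mulr0.
split=> [j||j sj].
- rewrite !mxE mulr_ge0 ?invr_ge0 ?subr_ge0 ?(ltW a1)//.
  by case: ifPn => sj; [rewrite -xi xmin|rewrite mulr0].
- under eq_bigr do rewrite !mxE.
  rewrite -mulr_sumr sumrB x1 -mulr_sumr.
  have [_ b1 _] := barycenter_simplex s0.
  under eq_bigr do rewrite -barycenterE.
  by rewrite b1 mulr1 mulVf.
- by rewrite !mxE xs// (negbTE sj) mulr0 subrr mulr0.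
Qed.

End SimplexGeometry.

(** * Disks do not embed in graphs *)

Section GraphDimension.
Variable R : realType.
Local Notation I := (`[0, 1]%classic : set R).

(* By the intermediate value theorem [g] takes the mean of [g (0, 0)] and
   [g (1, 1)] on each of the paths [(t, t)] and [(t, t ^+ 2)], which meet only at
   these two corners. *)
Lemma square_not_in_line (g : R * R -> R) : {within I `*` I, continuous g} ->
  (forall p p', (I `*` I) p -> (I `*` I) p' -> g p = g p' -> p = p') -> False.
Proof.
move=> cg gi.
have I0 : I 0 by apply/itv01P; rewrite lexx ler01.
have I1 : I 1 by apply/itv01P; rewrite lexx ler01.
pose v := (g (0, 0) + g (1, 1)) / 2.
have path (l : R -> R) : {within I, continuous l} -> (forall t, I t -> I (l t)) ->
    l 0 = 0 -> l 1 = 1 -> exists2 t, I t & g (t, l t) = v.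
  move=> cl lI l0 l1.
  have cgl : {within I, continuous (fun t => g (t, l t))}.
    apply: (within_comp (f := fun t => (t, l t)) _ _ cg) => [t It|].
      by split => //; exact: lI.
    by apply: within_pair => //; apply: continuous_subspaceT => x; exact: cvg_id.
  have [|t t01 gt] := IVT ler01 cgl (v := v); last by exists t.
  by rewrite l0 l1 /v ge_min le_max; case: (leP (g (0, 0)) (g (1, 1))) => ?;
    apply/andP; split; apply/orP; [left|right|right|left]; lra.
have [t It gt] : exists2 t, I t & g (t, t) = v.
  by apply: path => //; apply: continuous_subspaceT => x; exact: cvg_id.
have [t' It' gt'] : exists2 t, I t & g (t, t ^+ 2) = v.
  apply: (path (fun t => t ^+ 2)); rewrite ?expr0n ?expr1n//.
    by apply: continuous_subspaceT; exact: exprn_continuous.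
  by move=> x /itv01P/andP[x0 x1]; apply/itv01P; apply/andP; split; nra.
have It2 : I (t' ^+ 2).
  by move/itv01P : It' => /andP[x0 x1]; apply/itv01P; apply/andP; split; nra.
have [tt tt2] : (t, t) = (t', t' ^+ 2) by apply: gi => //; rewrite gt gt'.
have t01 : t * (t - 1) = 0 by rewrite mulrBr mulr1 -expr2 {1}tt -tt2 subrr.
have g01 : g (0, 0) = g (1, 1).
  move/eqP : t01; rewrite mulf_eq0 subr_eq0 => /orP[/eqP t0|/eqP t1].
    by move: gt; rewrite t0 /v => ?; lra.
  by move: gt; rewrite t1 /v => ?; lra.
have [/eqP] : (0 : R, 0 : R) = (1, 1) by exact: gi.
by rewrite eq_sym oner_eq0.
Qed.

(** Supplies a small copy of the interval with one end at [a], running to the left when [a] is in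
    the right half; it lets a square be shrunk towards any of its points. *)
Let subinterval (a e : R) : I a -> 0 < e ->
  exists c, [/\ c != 0, `|c| < e & forall s, I s -> I (a + c * s)].
Proof.
move=> /itv01P/andP[a0 a1] e0; pose d := Num.min (e / 2) 2^-1.
have d0 : 0 < d by rewrite lt_min divr_gt0//= invr_gt0.
have de : d <= e / 2 by rewrite ge_min lexx.
have d2 : d <= 2^-1 by rewrite ge_min lexx orbT.
have [a2|a2] := leP a 2^-1.
  exists d; split; [by rewrite gt_eqF|by rewrite gtr0_norm//; lra|].
  by move=> s /itv01P/andP[s0 s1]; apply/itv01P; apply/andP; split; nra.
exists (- d); split; [by rewrite oppr_eq0 gt_eqF|by rewrite normrN gtr0_norm//; lra|].
by move=> s /itv01P/andP[s0 s1]; apply/itv01P; apply/andP; split; nra.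
Qed.

(** If some point lands inside an edge, a small subsquare does too, and one barycentric coordinate
    embeds it in a line. Otherwise every point of the square lands on a vertex. *)
Lemma square_not_in_graph (n : nat) (K : {set {set 'I_n}}) (f : R * R -> 'rV[R]_n) :
  complex2 K -> {within I `*` I, continuous f} ->
  (forall p, (I `*` I) p -> realization R (skeleton1 K) (f p)) ->
  (forall p p', (I `*` I) p -> (I `*` I) p' -> f p = f p' -> p = p') -> False.
Proof.
move=> cK cf fK fi.
have fsupp p : (I `*` I) p -> simplex R (support_face (f p)) (f p) /\
    (0 < #|support_face (f p)| <= 2)%N.
  move=> /fK fp; have [sK fs] := realization_support (skeleton1_complex cK) fp.
  by split=> //; rewrite (support_face_gt0 fs); move: sK; rewrite inE => /andP[].
have [[p [Ip p2]]|vert] := pselect (exists p, (I `*` I) p /\ #|support_face (f p)| = 2%N).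
  have [[f0 f1 _] _] := fsupp p Ip.
  have /cards2P[i [j [ij supp]]] : #|support_face (f p)| == 2%N by rewrite p2.
  have fpos k : k \in support_face (f p) -> 0 < f p ord0 k.
    by rewrite (support_faceP _ (fsupp p Ip).1).
  pose U := [set x : 'rV[R]_n | 0 < x ord0 i] `&` [set x | 0 < x ord0 j].
  have oU : open U.
    apply: openI.
      exact: (open_comp (f := fun x : 'rV[R]_n => x ord0 i)
        (fun x _ => @coord_cont R n i x) (@open_gt R 0)).
    exact: (open_comp (f := fun x : 'rV[R]_n => x ord0 j)
      (fun x _ => @coord_cont R n j x) (@open_gt R 0)).
  have Up : U (f p) by split; apply: fpos; rewrite supp !inE eqxx ?orbT.
  have [W [oW Wp WU]] := (withinP _ _).1 cf p Ip U oU Up.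
  have /nbhs_ballP[e e0 eW] := open_nbhs_nbhs (conj oW Wp).
  have [c [c0 ce cI]] := subinterval Ip.1 e0; have [d [d0 de dI]] := subinterval Ip.2 e0.
  pose m (q : R * R) := (p.1 + c * q.1, p.2 + d * q.2).
  have mI q : (I `*` I) q -> (I `*` I) (m q).
    by move=> [q1 q2]; split; [exact: cI|exact: dI].
  have mb (x b s : R) : `|b| < e -> I s -> ball x e (x + b * s).
    move=> be /itv01P/andP[s0 s1]; rewrite /ball /= opprD addrA subrr add0r normrN normrM.
    by rewrite (ger0_norm s0); have := normr_ge0 b; nra.
  have mU q : (I `*` I) q -> U (f (m q)).
    move=> Iq; apply: WU; last exact: mI.
    by apply: eW; have [q1 q2] := Iq; split; exact: mb.
  have cm : continuous m.
    move=> q; apply: (@continuous_at_pair _ _ _ (fun q : R * R => p.1 + c * q.1)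
      (fun q : R * R => p.2 + d * q.2) q).
      by apply: cvgD; [exact: cvg_cst|apply: cvgMl_tmp; exact: cvg_fst].
    by apply: cvgD; [exact: cvg_cst|apply: cvgMl_tmp; exact: cvg_snd].
  apply: (@square_not_in_line (fun q => f (m q) ord0 i)).
    have cfm : {within I `*` I, continuous (fun q => f (m q))}.
      by apply: (within_comp (f := m) mI _ cf); exact: continuous_subspaceT.
    exact: (within_compT cfm (@coord_cont R n i)).
  move=> q q' Iq Iq' E.
  have line q1 : (I `*` I) q1 -> support_face (f (m q1)) = support_face (f p) /\
      f (m q1) ord0 i + f (m q1) ord0 j = 1.
    move=> Iq1; have [fs /andP[_ s2]] := fsupp _ (mI _ Iq1); have [Ui Uj] := mU _ Iq1.
    have s12 : support_face (f (m q1)) = support_face (f p).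
      apply/esym/eqP; rewrite eqEcard p2 s2 andbT supp; apply/fintype.subsetP => k.
      by rewrite !inE => /orP[/eqP ->|/eqP ->]; rewrite gt_eqF.
    split=> //; have [_ <- z] := fs; rewrite (bigD1 i)//= (bigD1 j) /=; last by rewrite eq_sym.
    rewrite big1 ?addr0// => k /andP[ki kj]; apply: z.
    by rewrite s12 supp !inE negb_or ki kj.
  have [s1 x1] := line _ Iq; have [s2 x2] := line _ Iq'.
  have [[_ _ z1] _] := fsupp _ (mI _ Iq); have [[_ _ z2] _] := fsupp _ (mI _ Iq').
  have : m q = m q'.
    apply: fi; [exact: mI|exact: mI|]; apply/rowP => k.
    have [->|ki] := eqVneq k i; first exact: E.
    have [->|kj] := eqVneq k j; first by move: E => /= E; lra.
    by rewrite z1 ?z2// ?s1 ?s2 supp !inE negb_or ki kj.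
  case: q q' {Iq Iq' E s1 x1 s2 x2 z1 z2} => a b [a' b'] [] /= /addrI/(mulfI c0) -> /addrI/(mulfI d0) ->.
  by [].
(* There are at most n vertices, so n + 1 distinct points of the square suffice for a
   contradiction. *)
pose pt (k : 'I_n.+1) : R * R := (k%:R / n.+1%:R, 0).
have Ipt k : (I `*` I) (pt k).
  split; apply/itv01P; last by rewrite lexx ler01.
  by rewrite divr_ge0//= ler_pdivrMr// mul1r ler_nat ltnW.
have /choice[v vP] : forall k, exists i, support_face (f (pt k)) = finset.set1 i.
  move=> k; have [_ /andP[s0 s2]] := fsupp _ (Ipt k).
  have /cards1P[i] : #|support_face (f (pt k))| == 1%N; last by exists i.
  rewrite eqn_leq s0 andbT -ltnS ltn_neqAle s2 andbT; apply/eqP => e2.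
  by apply: vert; exists (pt k).
have vi : injective v.
  move=> k l vkl; have : pt k = pt l.
    apply: fi => //; apply/rowP => i.
    have val k' : f (pt k') ord0 i = (i == v k')%:R.
      have [[_ f1 fz] _] := fsupp _ (Ipt k'); have [->|iv] := eqVneq i (v k').
        rewrite -f1 (bigD1 (v k'))//= big1 ?addr0// => j jv.
        by apply: fz; rewrite vP inE.
      by apply: fz; rewrite vP inE.
    by rewrite !val vkl.
  case=> /(mulIf _); rewrite invr_eq0 pnatr_eq0 => /(_ isT)/eqP.
  by rewrite eqr_nat => /eqP/val_inj.
by have := leq_card v vi; rewrite !card_ord ltnn.
Qed.

(** Serves to show that the old 1-skeleton contains no triangle of the next triangulation. The
    division by 3 leaves the third barycentric coordinate of [m] positive. *)
Lemma simplex_not_in_graph (n d : nat) (s : {set 'I_d}) (K : {set {set 'I_n}})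
    (f : 'rV[R]_d -> 'rV[R]_n) : #|s| = 3%N -> complex2 K ->
  {within simplex R s, continuous f} ->
  (forall x, simplex R s x -> realization R (skeleton1 K) (f x)) ->
  (forall x y, simplex R s x -> simplex R s y -> f x = f y -> x = y) -> False.
Proof.
move=> s3 cK cf fK fi.
have /card_gt2P[i [j [k [[si sj sk] [ij jk ki]]]]] : (2 < #|s|)%N by rewrite s3.
pose m (p : R * R) : 'rV[R]_d := \row_l (if l == i then p.1 / 3 else
  if l == j then p.2 / 3 else if l == k then 1 - (p.1 + p.2) / 3 else 0).
have mi p : m p ord0 i = p.1 / 3 by rewrite mxE eqxx.
have mj p : m p ord0 j = p.2 / 3 by rewrite mxE eq_sym (negbTE ij) eqxx.
have mk p : m p ord0 k = 1 - (p.1 + p.2) / 3.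
  by rewrite mxE (negbTE ki) eq_sym (negbTE jk) eqxx.
have ms p : (I `*` I) p -> simplex R s (m p).
  case: p => x y [/= /itv01P/andP[x0 x1] /itv01P/andP[y0 y1]]; split=> [l||l ls].
  - by rewrite mxE; do !case: ifP => _ //=; lra.
  - rewrite (bigD1 i)//= (bigD1 j) /=; last by rewrite eq_sym.
    rewrite (bigD1 k) /=; last by rewrite ki eq_sym.
    rewrite mi mj mk big1 => [|l /andP[/andP[li lj] lk]] /=; first by lra.
    by rewrite mxE (negbTE li) (negbTE lj) (negbTE lk).
  - rewrite mxE; case: eqP => [E|_]; first by rewrite E si in ls.
    case: eqP => [E|_]; first by rewrite E sj in ls.
    by case: eqP => [E|//]; rewrite E sk in ls.
have cm : continuous m.
  have c1 : continuous (fun p : R * R => p.1 / 3).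
    by move=> p; apply: cvgMr_tmp; exact: cvg_fst.
  have c2 : continuous (fun p : R * R => p.2 / 3).
    by move=> p; apply: cvgMr_tmp; exact: cvg_snd.
  have c3 : continuous (fun p : R * R => 1 - (p.1 + p.2) / 3).
    move=> p; apply: cvgB; first exact: cvg_cst.
    by apply: cvgMr_tmp; apply: cvgD; [exact: cvg_fst|exact: cvg_snd].
  apply: rV_continuous => l.
  have -> : (fun p => m p ord0 l) = (if l == i then fun p => p.1 / 3 else
      if l == j then fun p => p.2 / 3 else
      if l == k then fun p => 1 - (p.1 + p.2) / 3 else fun=> 0).
    by apply/funext => p; rewrite mxE; do !case: ifP => _.
  by do !case: ifP => _ //; exact: cst_continuous.
apply: (@square_not_in_graph n K (fun p => f (m p)) cK).
- by apply: (within_comp (f := m) ms _ cf); exact: continuous_subspaceT.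
- by move=> p /ms/fK.
- move=> p p' Ip Ip' /(fi _ _ (ms _ Ip) (ms _ Ip')) E.
  have := congr1 (fun u : 'rV[R]_d => u ord0 i) E.
  have := congr1 (fun u : 'rV[R]_d => u ord0 j) E.
  rewrite !mi !mj; case: p p' {Ip Ip' E} => x y [x' y'] /= ey ex.
  by congr pair; lra.
Qed.

(** Serves to find a triangle in stage 0, which is a disk. *)
Lemma disk_not_in_graph (n : nat) (K : {set {set 'I_n}}) (f : 'rV[R]_2 -> 'rV[R]_n) :
  complex2 K -> {within @disk R 2, continuous f} ->
  (forall u, disk u -> realization R (skeleton1 K) (f u)) ->
  (forall u v, disk u -> disk v -> f u = f v -> u = v) -> False.
Proof.
move=> cK cf fK fi.
pose m (p : R * R) : 'rV[R]_2 := \row_l (if l == ord0 then p.1 / 2 else p.2 / 2).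
have md p : (I `*` I) p -> disk (m p).
  case: p => x y [/= /itv01P/andP[x0 x1] /itv01P/andP[y0 y1]].
  by rewrite /disk /= sqnorm2 !mxE /=; nra.
have cm : continuous m.
  apply: rV_continuous => l.
  have -> : (fun p => m p ord0 l) = (if l == ord0 then fun p => p.1 / 2 else fun p => p.2 / 2).
    by apply/funext => p; rewrite mxE; case: ifP.
  by case: ifP => _ p; apply: cvgMr_tmp; [exact: cvg_fst|exact: cvg_snd].
apply: (@square_not_in_graph n K (fun p => f (m p)) cK).
- by apply: (within_comp (f := m) md _ cf); exact: continuous_subspaceT.
- by move=> p /md/fK.
- move=> p p' Ip Ip' /(fi _ _ (md _ Ip) (md _ Ip')) E.
  have := congr1 (fun u : 'rV[R]_2 => u ord0 ord0) E.
  have := congr1 (fun u : 'rV[R]_2 => u ord0 (lift ord0 ord0)) E.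
  rewrite !mxE /=; case: p p' {Ip Ip' E} => x y [x' y'] /= ey ex.
  by congr pair; lra.
Qed.

End GraphDimension.

(** * Extension over triangles *)

Section ConeExtension.
Variables (R : realType) (K : topologicalType).
Local Notation I := (`[0, 1]%classic : set R).

Lemma circle_map_continuous (h : 'rV[R]_2 -> K) :
  {within @sphere R 2, continuous h} -> continuous (fun t => h (circle_point t)).
Proof.
move=> ch; apply/within_setT.
apply: (within_comp (f := @circle_point R) _ _ ch).
  by move=> t _; exact: circle_point_sphere.
by apply/within_setT; exact: circle_point_continuous.
Qed.

Lemma bounds_disk1P (F : R -> K) : bounds_disk F 1 <->
  exists2 H : 'rV[R]_2 -> K, {within @disk R 2, continuous H} &
    forall t, H (circle_point t) = F t.
Proof.
by split=> -[H cH HF]; exists H => // t; rewrite HF mul1r.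
Qed.

Lemma sphere_circle_point (u : 'rV[R]_2) : sphere u ->
  exists2 t, 0 <= t <= 1 & u = circle_point t.
Proof.
move=> /(circle_point_surj 0)[t /andP[t0 t1] ->].
by exists t; rewrite ?add0r// t0 ltW.
Qed.

Lemma convex_bounds_disk (V : normedModType R) (C : set V) (r : V -> K)
    (w : R -> V) : hausdorff_space K -> {within C, continuous r} -> continuous w ->
  (forall t, w (t + 1) = w t) ->
  (forall x y a, C x -> C y -> 0 <= a <= 1 -> C ((1 - a) *: x + a *: y)) ->
  (forall t, C (w t)) -> bounds_disk (r \o w) 1.
Proof.
move=> hK cr cw w1 convC Cw; apply/bounds_disk1P.
have crw : continuous (r \o w).
  by apply/within_setT; apply: (within_comp _ _ cr) => //; exact/within_setT.
apply/(disk_extensionP 0 crw hK); first by move=> t; rewrite /= w1.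
apply: (@loop_homotopic_convex _ _ V C r (fun t => w (0 + t)) (fun=> w 0) _ cr).
- by apply: (@within_ext _ _ _ w) => [t _|]; [rewrite add0r|exact: continuous_subspaceT].
- exact: within_cst.
- by move=> s t _ t01; exact: convC.
- by rewrite addr0.
- by rewrite add0r -[in LHS](add0r 1) w1.
- by rewrite addr0.
- by rewrite w1.
Qed.

(** The product of circle and interval maps onto the simplex by [P] and into the disk by [Q], in
    both cases collapsing the end t = 1. Each fibre of [P] lies in a fibre of [Q], so [D \o Q]
    descends to the simplex. *)
Lemma cone_extension (n : nat) (s : {set 'I_n}) (phi : 'rV[R]_2 -> 'rV[R]_n)
    (h : 'rV[R]_n -> K) : (0 < #|s|)%N ->
  homeo_on (@sphere R 2) (simplex_boundary R s) phi ->
  bounds_disk (fun t => h (phi (circle_point t))) 1 ->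
  exists2 H : 'rV[R]_n -> K, {within simplex R s, continuous H} &
    forall y, simplex_boundary R s y -> H y = h y.
Proof.
move=> s0 [g [[cphi _] phiP gP]] /bounds_disk1P[D cD DF].
have Dphi u : sphere u -> D u = h (phi u).
  by move=> /sphere_circle_point[t _ ->]; rewrite DF.
pose A : set ('rV[R]_2 * R) := @sphere R 2 `*` I.
pose P (p : 'rV[R]_2 * R) := (1 - p.2) *: phi p.1 + p.2 *: barycenter R s.
pose Q (p : 'rV[R]_2 * R) := (1 - p.2) *: p.1.
have cA1 (V : normedModType R) (f : 'rV[R]_2 -> V) : {within @sphere R 2, continuous f} ->
    {within A, continuous (fun p => f p.1)}.
  move=> cf; apply: (within_comp (f := fst) _ _ cf) => [p []//|].
  by apply: continuous_subspaceT; exact: fst_continuous.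
have c2 : {within A, continuous (@snd 'rV[R]_2 R)}.
  by apply: continuous_subspaceT; exact: snd_continuous.
have c12 : {within A, continuous (fun p => 1 - p.2)}.
  by apply: (@withinB _ R^o) => //; exact: within_cst.
have cP : {within A, continuous P}.
  by apply: withinD; apply: withinZ => //; [exact: cA1|exact: within_cst].
have cQ : {within A, continuous Q}.
  apply: withinZ => //.
  by apply: (cA1 _ idfun); apply: continuous_subspaceT => x; exact: cvg_id.
have Qd p : A p -> disk (Q p).
  move=> [/sphere_nrm p1 /itv01P/andP[t0 t1]]; apply/disk_nrm.
  by rewrite nrmZ p1 mulr1 ger0_norm ?subr_ge0// gerBl.
have Pinj p p' : A p -> A p' -> P p = P p' -> Q p = Q p'.
  case: p p' => u t [u' t'] [/= us /itv01P t01] [/= us' /itv01P t01'] E.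
  have [tt uu] := cone_point_inj s0 t01 t01' (phiP _ us).1 (phiP _ us').1 E.
  rewrite /Q /= -tt; have [t1|t1] := eqVneq t 1; first by rewrite t1 subrr !scale0r.
  rewrite -(phiP _ us).2 -(phiP _ us').2 uu// lt_neqAle t1.
  by case/andP: t01.
have PA : P @` A = simplex R s.
  apply/seteqP; split=> [_ [[u t] [/= us /itv01P t01] <-]|x xs].
    apply: simplex_convex => //; last exact: barycenter_simplex.
    by have [] := (phiP _ us).1.
  have [xb|[y [a [yb /andP[a0 a1] xE]]]] := cone_point_surj s0 xs.
    exists (circle_point 0, 1).
      by split; [exact: circle_point_sphere|apply/itv01P; rewrite lexx ler01].
    by rewrite /P /= subrr scale0r add0r scale1r.
  exists (g y, a).
    by split; [exact: (gP _ yb).1|apply/itv01P; rewrite a0 ltW].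
  by rewrite /P /= (gP _ yb).2.
have /choice[sec secP] : forall x, exists p, simplex R s x -> A p /\ P p = x.
  move=> x; have [xs|nx] := pselect (simplex R s x); last by exists 0.
  by move: (xs); rewrite -PA => -[p Ap Px]; exists p.
have PS p : A p -> simplex R s (P p) by move=> Ap; rewrite -PA; exists p.
exists (fun x => D (Q (sec x))).
  rewrite -PA; apply: (within_quotient (f := P)) => //.
  - by apply: compact_setX; [exact: sphere_compact|exact: segment_compact].
  - apply: (@within_ext _ _ _ (D \o Q)); last exact: within_comp Qd cQ cD.
    move=> p Ap /=; have [As Ps] := secP _ (PS _ Ap).
    by rewrite (Pinj _ _ As Ap Ps).
move=> y yb; have [ygs phig] := gP _ yb.
have Ay : A (g y, 0) by split=> //; apply/itv01P; rewrite lexx ler01.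
have Py : P (g y, 0) = y by rewrite /P /= subr0 scale1r scale0r addr0.
have ys : simplex R s y by case: yb.
have [As Ps] := secP _ ys.
by rewrite (Pinj _ (g y, 0) As Ay) ?Ps ?Py// /Q /= subr0 scale1r Dphi// phig.
Qed.

Lemma simplex_map_bounds_disk (n : nat) (s : {set 'I_n})
    (phi : 'rV[R]_2 -> 'rV[R]_n) (H : 'rV[R]_n -> K) : hausdorff_space K ->
  homeo_on (@sphere R 2) (simplex_boundary R s) phi ->
  {within simplex R s, continuous H} ->
  bounds_disk (fun t => H (phi (circle_point t))) 1.
Proof.
move=> hK [g [[cphi _] phiP _]] cH.
apply: (@convex_bounds_disk _ (simplex R s) H (fun t => phi (circle_point t))) => //.
- apply/within_setT; apply: (within_comp (f := @circle_point R) _ _ cphi).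
    by move=> t _; exact: circle_point_sphere.
  by apply/within_setT; exact: circle_point_continuous.
- by move=> t; rewrite circle_pointD1.
- by move=> x y a xs ys a01; exact: simplex_convex.
- by move=> t; have [[]] := phiP _ (circle_point_sphere t).
Qed.

Lemma skeleton_extension (n : nat) (L : {set {set 'I_n}}) (h : 'rV[R]_n -> K) :
  complex2 L -> {within realization R (skeleton1 L), continuous h} ->
  (forall s, s \in L -> #|s| = 3%N ->
     exists2 H : 'rV[R]_n -> K, {within simplex R s, continuous H} &
       forall y, simplex_boundary R s y -> H y = h y) ->
  exists2 G : 'rV[R]_n -> K, {within realization R L, continuous G} &
    (forall y, realization R (skeleton1 L) y -> G y = h y).
Proof.
move=> cL ch ext.
have /choice[H HP] : forall s, exists H : 'rV[R]_n -> K, s \in L -> #|s| = 3%N ->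
    {within simplex R s, continuous H} /\
    forall y, simplex_boundary R s y -> H y = h y.
  move=> s; have [/andP[sL /eqP s3]|ns] := boolP ((s \in L) && (#|s| == 3%N)).
    by have [H cH Hh] := ext s sL s3; exists H.
  by exists h => sL s3; rewrite sL s3 in ns.
pose G y := if (#|support_face y| <= 2)%N then h y else H (support_face y) y.
have Gh y : realization R (skeleton1 L) y -> G y = h y.
  move=> yL; have := (skeleton1P cL (@skeleton1_realization _ _ _ _ yL)).1 yL.
  by rewrite /G => ->.
have GH s y : s \in L -> #|s| = 3%N -> simplex R s y -> G y = H s y.
  move=> sL s3 ys; have [cH Hh] := HP s sL s3.
  have yb := simplex_boundaryP s3 ys.
  rewrite /G; case: ifPn => [/yb.2/Hh//|y3].
  by rewrite (simplex_interior ys)// => /yb.1; rewrite (negbTE y3).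
exists G => //.
(* The finite closed cover to be glued over: [None] stands for the 1-skeleton, [Some s] for a
   triangle. *)
pose A (o : option {set 'I_n}) : set 'rV[R]_n :=
  if o is Some s then simplex R s else realization R (skeleton1 L).
pose P (o : option {set 'I_n}) : Prop :=
  if o is Some s then (s \in L) /\ #|s| = 3%N else True.
apply: (@within_cover _ _ _ P A) => [[s|] _|[s [sL s3]|_]|x xL].
- exact: simplex_closed.
- by apply: compact_closed; [exact: rV_hausdorff|exact: realization_compact].
- have [cH _] := HP s sL s3; apply: within_ext cH => y ys; exact/esym/GH.
- by apply: within_ext ch => y /Gh.
- have [xs|xs] := boolP (#|support_face x| <= 2)%N.
    by exists None => //=; apply/(skeleton1P cL xL).
  have [sL sx] := realization_support cL xL; exists (Some (support_face x)) => //.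
  split=> //; apply/eqP; rewrite eqn_leq ltnNge xs andbT.
  by have [/andP[]] := cL _ sL.
Qed.

End ConeExtension.

(** * Triangulations *)

Section Triangulations.
Variables (R : realType) (P : topologicalType) (L : triangulation R P).
Local Notation V := 'rV[R]_(tri_size L).
Local Notation real := (realization R (tri_complex L)).

Let tri_inverse : exists co : P -> V, [/\ continuous co,
  {within real, continuous (tri_map L)},
  forall x, real x -> co (tri_map L x) = x & forall z, real (co z) /\ tri_map L (co z) = z].
Proof.
have [g [[ct cg] tP gP]] := tri_homeo L; exists g; split => //.
- exact/within_setT.
- by move=> x /tP[].
- by move=> z; have [] := gP z I.
Qed.

Definition tri_coord : P -> V := projT1 (cid tri_inverse).

Lemma tri_coord_continuous : continuous tri_coord.
Proof. by have [] := projT2 (cid tri_inverse). Qed.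

Lemma tri_map_continuous : {within real, continuous (tri_map L)}.
Proof. by have [co []] := tri_inverse. Qed.

Lemma tri_coordK x : real x -> tri_coord (tri_map L x) = x.
Proof. by have [_ _ h _] := projT2 (cid tri_inverse); exact: h. Qed.

Lemma tri_coord_real z : real (tri_coord z).
Proof. by have [_ _ _ h] := projT2 (cid tri_inverse); have [] := h z. Qed.

Lemma tri_mapK z : tri_map L (tri_coord z) = z.
Proof. by have [_ _ _ h] := projT2 (cid tri_inverse); have [] := h z. Qed.

Lemma simplex_real s : s \in tri_complex L -> simplex R s `<=` real.
Proof. by move=> sL x xs; exists s. Qed.

Lemma tri_cellP s z : s \in tri_complex L ->
  tri_cell L s z <-> simplex R s (tri_coord z).
Proof.
move=> sL; split=> [[x xs <-]|zs]; first by rewrite tri_coordK//; exact: simplex_real xs.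
by exists (tri_coord z) => //; exact: tri_mapK.
Qed.

Lemma skel1_real : skel1 (L := L) `<=` real.
Proof. exact: skeleton1_realization. Qed.

Lemma skel1P x : real x -> skel1 x <-> (#|support_face x| <= 2)%N.
Proof. exact: (skeleton1P (tri_complexP (t := L))). Qed.

Lemma boundary_skel1 s x : is_tri s -> simplex_boundary R s x -> skel1 (L := L) x.
Proof.
move=> [sL s3] xb; have xs : simplex R s x by case: xb.
by apply/skel1P; [exact: simplex_real xs|exact/(simplex_boundaryP s3 xs)].
Qed.

Lemma skel1_boundary s x : is_tri (L := L) s -> simplex R s x -> skel1 (L := L) x ->
  simplex_boundary R s x.
Proof.
move=> [sL s3] xs xk; apply/(simplex_boundaryP s3 xs).
exact/(skel1P (simplex_real sL xs)).
Qed.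

(** No simplex has more than three vertices, so positivity on [s] already forces the carrier to be
    [s]. The complement of an open triangle is thus a finite union of closed conditions on
    coordinates. *)
Lemma open_triangleP s z : is_tri (L := L) s ->
  support_face (tri_coord z) = s <-> forall i, i \in s -> 0 < tri_coord z ord0 i.
Proof.
move=> [sL s3]; have [w wL wz] := tri_coord_real z.
split=> [<- i|pos]; first by rewrite (support_faceP _ wz).
have [_ zw] := simplex_support wz.
apply/esym/eqP; rewrite eqEcard s3; apply/andP; split.
  by apply/fintype.subsetP => i /pos; rewrite (support_faceP _ wz).
apply: leq_trans (subset_leq_card zw) _.
by have [/andP[]] := tri_complexP wL.
Qed.

Lemma support_barycenter (s : {set 'I_(tri_size L)}) : #|s| = 3%N ->
  support_face (barycenter R s) = s.
Proof.
move=> s3; apply/setP => i; rewrite inE barycenterE.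
by case: ifP; rewrite ?eqxx// invr_eq0 s3 pnatr_eq0.
Qed.

End Triangulations.

(** * Projection of the disk from an interior point onto its boundary circle *)

Section RadialProjection.
Variables (R : realType) (c : 'rV[R]_2).
Hypothesis c1 : open_disk c.

Let x0 (u : 'rV[R]_2) := u ord0 ord0.
Let x1 (u : 'rV[R]_2) := u ord0 (lift ord0 ord0).
Let aa u := sqnorm (u - c).
Let bb u := x0 c * x0 (u - c) + x1 c * x1 (u - c).
Let cc := 1 - sqnorm c.
(** The positive root of [aa] l^2 + 2 [bb] l - [cc] = 0, which says that c + l(u - c) has norm 1;
    its constant term is negative because [c] lies inside the disk. *)
Let lam u := (- bb u + Num.sqrt (bb u ^+ 2 + aa u * cc)) / aa u.

Definition radial_projection (u : 'rV[R]_2) : 'rV[R]_2 := c + lam u *: (u - c).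

Let cc0 : 0 < cc. Proof. by rewrite subr_gt0; exact: c1. Qed.

Let aa0 u : u <> c -> 0 < aa u.
Proof.
move=> uc; rewrite lt_neqAle sqnorm_ge0 andbT; apply/eqP => e.
apply: uc; apply/eqP; rewrite -subr_eq0; apply/eqP/nrm_eq0.
by rewrite /nrm -[sqnorm _]/(aa u) -e sqrtr0.
Qed.

Let sq u (l : R) : sqnorm (c + l *: (u - c)) = 1 - cc + 2 * l * bb u + l ^+ 2 * aa u.
Proof. by rewrite /cc /aa /bb !sqnorm2 /x0 /x1 !mxE; ring. Qed.

Lemma radial_projection_sphere u : u <> c -> sphere (radial_projection u).
Proof.
move=> /aa0 a0; rewrite /sphere /= /radial_projection sq.
have d0 : 0 <= bb u ^+ 2 + aa u * cc by rewrite addr_ge0 ?sqr_ge0// mulr_ge0 ?ltW.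
have := sqr_sqrtr d0; set r := Num.sqrt _ => r2.
have e : (lam u * aa u + bb u) ^+ 2 = bb u ^+ 2 + aa u * cc.
  by rewrite /lam -/r divfK ?gt_eqF// addrAC addNr add0r.
have E (l a b k : R) : a * (l ^+ 2 * a + 2 * l * b - k) =
  (l * a + b) ^+ 2 - (b ^+ 2 + a * k) by ring.
have := E (lam u) (aa u) (bb u) cc; rewrite e subrr.
by move/eqP; rewrite mulf_eq0 gt_eqF//= => /eqP; lra.
Qed.

Lemma radial_projection_id u : sphere u -> radial_projection u = u.
Proof.
move=> us; have uc : u <> c by move=> uc; rewrite uc in us; exact: sphere_open_disk us c1.
have a0 := aa0 uc; have e := sq u 1.
rewrite scale1r addrC subrK in e; move: us e; rewrite /sphere /= => -> e.
have cE : cc = 2 * bb u + aa u by lra.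
have r : Num.sqrt (bb u ^+ 2 + aa u * cc) = aa u + bb u.
  rewrite (_ : _ + _ = (aa u + bb u) ^+ 2); last by rewrite cE; ring.
  by rewrite sqrtr_sqr ger0_norm//; have := cc0; lra.
have l1 : lam u = 1 by rewrite /lam r addrC addrK mulfV ?gt_eqF.
by rewrite /radial_projection l1 scale1r addrC subrK.
Qed.

Lemma radial_projection_continuous (T : topologicalType) (f : T -> 'rV[R]_2) (x : T) :
  {for x, continuous f} -> f x <> c ->
  {for x, continuous (fun y => radial_projection (f y))}.
Proof.
move=> cf fc.
have cw : {for x, continuous (fun y => f y - c)} by apply: cvgB => //; exact: cvg_cst.
have ca : {for x, continuous (fun y => aa (f y))}.
  by apply: (continuous_comp cw); exact: sqnorm_continuous.
have cx0 : {for x, continuous (fun y => x0 (f y - c))}.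
  by apply: (continuous_comp cw); exact: coord_continuous.
have cx1 : {for x, continuous (fun y => x1 (f y - c))}.
  by apply: (continuous_comp cw); exact: coord_continuous.
have cb : {for x, continuous (fun y => bb (f y))}.
  by apply: cvgD; apply: cvgMl_tmp.
have cl : {for x, continuous (fun y => lam (f y))}.
  apply: (@continuousM _ _ (fun y => _ + _) (fun y => (aa (f y))^-1)); last first.
    by apply: continuousV => //; rewrite gt_eqF// aa0.
  apply: cvgD; first exact: cvgN.
  apply: (@continuous_comp _ _ _ (fun y => bb (f y) ^+ 2 + aa (f y) * cc) Num.sqrt);
    last exact: sqrt_continuous.
  apply: cvgD; last exact: cvgMr_tmp.
  apply: (@continuous_comp _ _ _ (fun y => bb (f y)) (fun z => z ^+ 2)) => //.
  exact: exprn_continuous.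
by apply: cvgD; [exact: cvg_cst|exact: cvgZ].
Qed.

End RadialProjection.

(** * One step of the construction *)

Section PontryaginStep.
Variables (R : realType) (P P' : topologicalType).
Variables (L : triangulation R P) (L' : triangulation R P') (q : P' -> P).
Local Notation V := 'rV[R]_(tri_size L).
Local Notation face := {set 'I_(tri_size L)}.
Local Notation is_tri := (is_tri (L := L)).
Local Notation skel1 := (skel1 (L := L)).

(** Surjectivity is the intermediate value theorem: a lift whose ends differ by 2 passes through
    every angle. *)
Lemma degree_two_onto (C : set V) (f : 'rV[R]_2 -> V) : degree_two C f ->
  (forall u, sphere u -> C (f u)) /\
  (forall y, C y -> exists2 u, sphere u & f u = y).
Proof.
move=> [phi [th [[g [_ phiC gC]] cth fphi th2]]]; split.
  move=> u /sphere_circle_point[t t01 ->]; rewrite fphi//.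
  exact: (phiC _ (circle_point_sphere _)).1.
move=> y /gC[gy <-]; have [s /andP[s0 s1] ->] := circle_point_surj (th 0) gy.
have [|t t01 ths] := IVT ler01 cth (v := th 0 + s).
  by rewrite ge_min le_max; apply/andP; split; apply/orP; [left|right]; lra.
exists (circle_point t); first exact: circle_point_sphere.
by rewrite fphi ?ths//; move: t01; rewrite in_itv.
Qed.

Variables (att : face -> 'rV[R]_2 -> V) (inc : V -> P') (att_disk : face -> 'rV[R]_2 -> P')
  (collar : face -> 'rV[R]_2 * R -> 'rV[R]_2).
Hypotheses (attP : forall s, is_tri s -> {within @sphere R 2, continuous (att s)} /\
    degree_two (simplex_boundary R s) (att s))
  (attach : is_attachment att inc att_disk)
  (subdiv : forall y, skel1 y -> exists s, [/\ s \in tri_complex L',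
     tri_cell L' s `<=` inc @` skel1 & tri_cell L' s (inc y)])
  (cq : continuous q) (q_inc : forall y, skel1 y -> q (inc y) = tri_map L y)
  (collarP : forall s, is_tri s ->
      [/\ (forall z, disk_core L' (att_disk s) z ->
             q z = tri_map L (barycenter R s)),
          homeo_on (@sphere R 2 `*` (`[0, 1[%classic : set R))
            (@disk R 2 `\` att_disk s @^-1` disk_core L' (att_disk s)) (collar s),
          (forall u, sphere u -> collar s (u, 0) = u)
        & (forall u t, sphere u -> 0 <= t < 1 ->
             q (att_disk s (collar s (u, t))) =
             tri_map L ((1 - t) *: att s u + t *: barycenter R s))])
  (hP' : hausdorff_space P').

Let skel1_compact : compact skel1.
Proof. exact: realization_compact. Qed.

Lemma step_inc_continuous : {within skel1, continuous inc}.
Proof.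
have [_ top _ _ _] := attach; apply/within_closedP => [|C /top[]//].
by apply: compact_closed; [exact: rV_hausdorff|exact: skel1_compact].
Qed.

Lemma step_disk_continuous s : is_tri s -> {within @disk R 2, continuous (att_disk s)}.
Proof.
move=> ts; have [_ top _ _ _] := attach.
apply/within_closedP => [|C /top[_]]; [exact: disk_closed|exact].
Qed.

Lemma step_att_boundary s u : is_tri s -> sphere u -> simplex_boundary R s (att s u).
Proof. by move=> /attP[_ /degree_two_onto[h _]]; exact: h. Qed.

Lemma step_att_skel1 s u : is_tri s -> sphere u -> skel1 (att s u).
Proof. by move=> ts us; apply: (boundary_skel1 ts); exact: step_att_boundary. Qed.

Lemma step_cells z : (exists2 y, skel1 y & z = inc y) \/
  exists s u, [/\ is_tri s, open_disk u & z = att_disk s u].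
Proof.
have [cover _ _ glue _] := attach.
case: (cover z) => [[y ky <-]|[s [u [ts /disk_split[uo|us] <-]]]].
- by left; exists y.
- by right; exists s, u.
- by left; exists (att s u); [exact: step_att_skel1|exact: glue].
Qed.

(** A point of the core goes to the barycenter. A collar point goes to a cone point of parameter t,
    and t = 0 is excluded since [collar s (v, 0)] is on the circle; so the barycenter has positive
    weight and every coordinate on [s] is positive. *)
Lemma step_support_open s u : is_tri s -> open_disk u ->
  support_face (tri_coord L (q (att_disk s u))) = s.
Proof.
move=> ts uo; have [sL s3] := ts; have s0 : (0 < #|s|)%N by rewrite s3.
have [core [g [_ _ gP]] c0 colq] := collarP ts.
have [uc|uc] := pselect (disk_core L' (att_disk s) (att_disk s u)).
  rewrite core// tri_coordK; first exact: support_barycenter.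
  exact: simplex_real (barycenter_simplex R s0).
have [|[us /=]] := gP u; first by split=> //; exact: open_disk_disk.
case: (g u) us => v t /= vs; rewrite in_itv /= => /andP[t0 t1] col.
have vb := step_att_boundary ts vs; have vs' : simplex R s (att s v) by case: vb.
have t01 : 0 <= t <= 1 by rewrite t0 ltW.
rewrite -col colq ?t0// tri_coordK; last first.
  by apply: simplex_real (simplex_convex t01 vs' (barycenter_simplex R s0)).
apply: cone_point_support => //; rewrite (ltW t1) andbT lt_neqAle t0 andbT eq_sym.
apply/eqP => te; rewrite te c0// in col; rewrite -col in uo.
exact: sphere_open_disk vs uo.
Qed.

(** Open disks lie over open triangles, so [q] is injective over the old 1-skeleton, with inverse
    [inc]. This is what lets the 1-skeleton of a stage embed in the inverse limit. *)
Lemma step_fiber_skel1 z y : skel1 y -> q z = tri_map L y -> z = inc y.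
Proof.
move=> ky; have yr := skel1_real ky; have [_ _ inj _ _] := attach.
have [[y' ky' ->]|[s [u [ts uo ->]]]] := step_cells z => qz.
  congr inc; rewrite q_inc// in qz.
  by have := congr1 (tri_coord L) qz; rewrite !tri_coordK//; exact: skel1_real.
have := step_support_open ts uo; rewrite qz tri_coordK// => ys.
have := (skel1P yr).1 ky; rewrite ys; by case: ts => _ ->.
Qed.

Lemma step_coord_inc y : skel1 y -> tri_coord L (q (inc y)) = y.
Proof. by move=> ky; rewrite q_inc// tri_coordK//; exact: skel1_real. Qed.

(** [subdiv] covers the old 1-skeleton by simplices of [L'] without bounding their dimension. A
    triangle among them would be embedded by [tri_coord L \o q] in the graph [skel1]. *)
Lemma step_inc_skel1 y : skel1 y ->
  Defs.skel1 (L := L') (tri_coord L' (inc y)).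
Proof.
move=> ky; have [s [sL' sub /(tri_cellP _ sL') ys]] := subdiv ky.
apply/skel1P; first exact: tri_coord_real.
rewrite leqNgt; apply/negP => y3.
have [_ ysub] := simplex_support ys.
have s3 : #|s| = 3%N.
  apply/eqP; rewrite eqn_leq (leq_trans y3 (subset_leq_card ysub)) andbT.
  by have [/andP[]] := tri_complexP sL'.
have cell x : simplex R s x -> exists2 y', skel1 y' & inc y' = tri_map L' x.
  by move=> xs; apply: sub; exists x.
apply: (@simplex_not_in_graph R _ _ s (tri_complex L)
  (fun x => tri_coord L (q (tri_map L' x))) s3 (tri_complexP (t := L))).
- apply: within_compT; last exact: tri_coord_continuous.
  apply: within_compT => //; apply: continuous_subspaceW (@tri_map_continuous _ _ L').
  exact: simplex_real.
- by move=> x /cell[y' ky' <-]; rewrite step_coord_inc.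
- move=> x x' xs xs'; have [y1 k1 e1] := cell _ xs; have [y2 k2 e2] := cell _ xs'.
  rewrite -e1 -e2 !step_coord_inc// => y12.
  by rewrite -(tri_coordK (simplex_real sL' xs)) -(tri_coordK (simplex_real sL' xs'))
    -e1 -e2 y12.
Qed.

Lemma step_cell_disk s z : is_tri s -> simplex R s (tri_coord L (q z)) ->
  exists2 u, disk u & z = att_disk s u.
Proof.
move=> ts; have [sL s3] := ts; have [_ _ _ glue _] := attach.
have [[y ky ->]|[s' [u [ts' uo ->]]]] := step_cells z.
  rewrite step_coord_inc// => ys.
  have [_ onto] := degree_two_onto (attP ts).2.
  have [u us <-] := onto y (skel1_boundary ts ys ky).
  by exists u; [exact: sphere_disk|rewrite glue].
move=> /simplex_support[_]; rewrite step_support_open// => s's.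
have -> : s = s'.
  by apply/esym/eqP; rewrite eqEcard s's s3; case: ts' => _ ->.
by exists u => //; exact: open_disk_disk.
Qed.

(** Otherwise the core is empty and the collar is the whole disk. The radial coordinate would then
    be continuous on a compact set, and yet take values arbitrarily close to 1 without reaching
    it. *)
Lemma step_core_triangle s : is_tri s -> exists s',
  [/\ s' \in tri_complex L', #|s'| = 3%N &
      tri_cell L' s' `<=` att_disk s @` @open_disk R 2].
Proof.
move=> ts; apply: contrapT => nos'.
have nocore z : ~ disk_core L' (att_disk s) z.
  by move=> [s' [? ? ? _]]; apply: nos'; exists s'.
have [_ [g [[_ cg] gC gP]] _ _] := collarP ts.
have k : compact ((fun u => (g u).2) @` @disk R 2).
  apply: continuous_compact; last exact: disk_compact.
  apply: (within_compT _ (@snd_continuous _ _)).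
  by apply: continuous_subspaceW cg => u du; split=> //; exact: nocore.
have op : open (~` ((fun u => (g u).2) @` @disk R 2)).
  by apply: closed_openC; exact: compact_closed (@Rhausdorff R) k.
have n1 : (~` ((fun u => (g u).2) @` @disk R 2)) 1.
  move=> [u du gu1]; have [|[_]] := gP u; first by split=> //; exact: nocore.
  by rewrite /= in_itv /= gu1 ltxx andbF.
have /nbhs_ballP[e /= e0 eb] := open_nbhs_nbhs (conj op n1).
(* A height in [0, 1) within [e] of 1; the collar point at this height gives the contradiction. *)
pose t : R := Num.max 0 (1 - e / 2).
have t0 : 0 <= t by rewrite le_max lexx.
have t1 : t < 1 by rewrite gt_max ltr01 /= gtrBl divr_gt0.
have te : 1 - e / 2 <= t by rewrite le_max lexx orbT.
apply: (eb t); first by rewrite /ball /= ger0_norm; lra.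
have [|[cd _] gc] := gC (circle_point 0, t).
  by split; [exact: circle_point_sphere|rewrite /= in_itv /= t0].
by exists (collar s (circle_point 0, t)) => //; rewrite gc.
Qed.

Lemma step_disk_eq s u v : is_tri s -> disk u -> open_disk v ->
  att_disk s u = att_disk s v -> u = v.
Proof.
have [_ _ _ glue sep] := attach.
move=> ts /disk_split[uo|us] vo e; have [sep1 sep2] := sep s v ts vo.
  by have [] := sep2 s u ts uo (esym e).
by case: (sep1 (att s u) (step_att_skel1 ts us)); rewrite -e glue.
Qed.

(* Radial projection from the barycentre of [s'] pushes the disk punctured by the
   interior of [s'] onto its boundary circle. *)
Lemma step_puncture (K : topologicalType) s s' (h : V -> K) : is_tri s ->
  s' \in tri_complex L' -> #|s'| = 3%N ->
  tri_cell L' s' `<=` att_disk s @` @open_disk R 2 ->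
  {within simplex_boundary R s, continuous h} ->
  exists h' : P' -> K,
  [/\ {within [set z | (att_disk s @` @disk R 2) z /\
        support_face (tri_coord L' z) != s'], continuous h'},
      forall y, simplex_boundary R s y -> h' (inc y) = h y
    & forall phi, homeo_on (@sphere R 2) (simplex_boundary R s') phi ->
      exists u : 'rV[R]_2 -> 'rV[R]_2,
      [/\ {within @sphere R 2, continuous u}, forall v, sphere v -> sphere (u v)
        & forall v, sphere v -> h' (tri_map L' (phi v)) = h (att s (u v))]].
Proof.
move=> ts sL' s3' sub ch; have [_ _ inj glue sep] := attach.
have s0' : (0 < #|s'|)%N by rewrite s3'.
have [c co cE] : (att_disk s @` @open_disk R 2) (tri_map L' (barycenter R s')).
  by apply: sub; exists (barycenter R s') => //; exact: barycenter_simplex.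
have cbar : tri_coord L' (att_disk s c) = barycenter R s'.
  by rewrite cE tri_coordK//; apply: simplex_real (barycenter_simplex R s0').
pose pr := radial_projection c.
have [_ onto] := degree_two_onto (attP ts).2.
pose D := [set u | disk u /\ support_face (tri_coord L' (att_disk s u)) != s'].
have Dc u : D u -> u <> c.
  by move=> [_ un] uc; move: un; rewrite uc cbar support_barycenter ?eqxx.
have openP z := @open_triangleP _ _ L' s' z (conj sL' s3').
have cD : closed D.
  have -> : D = @disk R 2 `&` att_disk s @^-1`
      \bigcup_(i in [set i | i \in s']) [set z | tri_coord L' z ord0 i <= 0].
    apply/seteqP; split=> u [du].
      move=> us; split=> //; apply: contrapT => nu; move/negP : us; apply; apply/eqP.
      apply/openP => i si; rewrite ltNge; apply/negP => ui.
      by apply: nu; exists i.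
    move=> [i si /= ui]; split=> //; apply/eqP => /openP/(_ i si).
    by rewrite ltNge ui.
  have /within_closedP := step_disk_continuous ts; apply; first exact: disk_closed.
  apply: closed_bigcup => [|i _]; first exact: finite_finset.
  apply: (closed_preimage (f := fun z => tri_coord L' z ord0 i) _ (@closed_le R 0)).
  move=> z; apply: (@continuous_comp _ _ _ (tri_coord L')
    (fun x : 'rV[R]_(tri_size L') => x ord0 i)); first exact: tri_coord_continuous.
  exact: coord_continuous.
have kD : compact D by apply: subclosed_compact cD (@disk_compact R 2) _ => u [].
(* The value does not depend on the preimage chosen in the disk: interior preimages are unique, and
   boundary preimages of one point have the same image under [att s] because [inc] is injective. *)
have [h' h'P] : exists h' : P' -> K,
    forall u, D u -> h' (att_disk s u) = h (att s (pr u)).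
  pose h' z := h (att s (pr (xget c [set u | disk u /\ att_disk s u = z]))).
  exists h' => u Du; have [du _] := Du; rewrite /h'.
  case: xgetP => [v _ [dv vu]|/(_ u)[]//].
  have [uo|us] := disk_split du; first by rewrite (step_disk_eq ts dv uo vu).
  have [vo|vs] := disk_split dv; first by rewrite (step_disk_eq ts du vo (esym vu)).
  rewrite /pr !radial_projection_id//; congr h; apply: inj; try exact: step_att_skel1.
  by rewrite -!glue.
have cpr : {within D, continuous pr}.
  apply: continuous_in_subspaceT => u; rewrite inE => /Dc uc.
  have idu : {for u, continuous (fun u : 'rV[R]_2 => u)} by exact: cvg_id.
  exact: (radial_projection_continuous idu uc).
have prS u : D u -> sphere (pr u) by move=> /Dc; exact: radial_projection_sphere.
have [catt _] := attP ts.
exists h'; split.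
- have -> : [set z | (att_disk s @` @disk R 2) z /\
      support_face (tri_coord L' z) != s'] = att_disk s @` D.
    by apply/seteqP; split=> [_ [[u du <-] us]|_ [u [du us] <-]]; [exists u|split=> //; exists u].
  apply: within_quotient kD hP' _ _.
    by apply: continuous_subspaceW (step_disk_continuous ts) => u [].
  apply: (@within_ext _ _ _ (h \o (att s \o pr))) => [u Du|]; first by rewrite /= h'P.
  apply: (within_comp _ _ ch) => [u Du|]; first by apply: step_att_boundary => //; exact: prS.
  exact: within_comp prS cpr catt.
- move=> y yb; have [u us uy] := onto y yb; have du := sphere_disk us.
  rewrite -uy -glue// h'P ?/pr ?radial_projection_id//; split=> //; rewrite glue//.
  apply/eqP => e; have ku := step_att_skel1 ts us.
  have := (skel1P (tri_coord_real L' _)).1 (step_inc_skel1 ku).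
  by rewrite e s3'.
move=> phi [g [[cphi _] phiP _]].
pose B := @disk R 2 `&` att_disk s @^-1` tri_cell L' s'.
have ctri : {within simplex R s', continuous (tri_map L')}.
  apply: continuous_subspaceW (@tri_map_continuous _ _ L'); exact: simplex_real.
have kcell : compact (tri_cell L' s').
  by apply: continuous_compact => //; exact: simplex_compact.
have kB : compact B.
  apply: (@subclosed_compact _ _ (@disk R 2)); [|exact: disk_compact|by move=> u []].
  have /within_closedP := step_disk_continuous ts; apply; first exact: disk_closed.
  exact: compact_closed.
(* The closed triangle [s'] lies in the open disk, where [att_disk s] is injective, so it lifts back
   to the disk; [u] is this lift along [phi] followed by the radial projection. *)
have /choice[sec secP] : forall z, exists u, tri_cell L' s' z -> open_disk u /\ att_disk s u = z.
  move=> z; have [/sub[u uo uz]|nz] := pselect (tri_cell L' s' z); last by exists 0.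
  by exists u.
have csec : {within tri_cell L' s', continuous sec}.
  have -> : tri_cell L' s' = att_disk s @` B.
    apply/seteqP; split=> [z zs|_ [u [_ us] <-]//]; have [uo uz] := secP z zs.
    by exists (sec z) => //; split; [exact: open_disk_disk|rewrite /= uz].
  apply: within_quotient kB hP' _ _.
    by apply: continuous_subspaceW (step_disk_continuous ts) => u [].
  apply: (@within_ext _ _ _ idfun); last by apply: continuous_subspaceT => x; exact: cvg_id.
  move=> u [du us]; have [vo vu] := secP _ us.
  exact: (step_disk_eq ts du vo (esym vu)).
have phi_cell v : sphere v -> tri_cell L' s' (tri_map L' (phi v)).
  by move=> /phiP[[vs _] _]; exists (phi v).
have phi_D v : sphere v -> D (sec (tri_map L' (phi v))).
  move=> vs; have [uo ue] := secP _ (phi_cell v vs); split; first exact: open_disk_disk.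
  have [vb _] := phiP v vs; have vs' : simplex R s' (phi v) by case: vb.
  rewrite ue tri_coordK; last exact: simplex_real vs'.
  apply/eqP => e; have := (simplex_boundaryP s3' vs').1 vb.
  by rewrite e s3'.
exists (fun v => pr (sec (tri_map L' (phi v)))); split.
- apply: (within_comp phi_D _ cpr).
  apply: (within_comp (f := fun v => tri_map L' (phi v)) phi_cell _ csec).
  by apply: (within_comp _ cphi ctri) => v /phiP[[]].
- by move=> v vs; apply: prS; exact: phi_D.
- move=> v vs; have [_ ue] := secP _ (phi_cell v vs).
  by rewrite -[in LHS]ue h'P//; exact: phi_D.
Qed.

End PontryaginStep.

(** * The inverse limit *)

(** Coordinates above [k] come from dependent choice, those below from the bonding maps. The
    induction shifts the whole sequence, so that the choice always starts at index 0. *)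
Lemma thread_exists (T : nat -> Type) (q : forall k, T k.+1 -> T k)
    (A : forall k, set (T k)) (k : nat) (y : T k) :
  (forall n z, A n z -> exists2 z', A n.+1 z' & q n z' = z) -> A k y ->
  exists2 x : forall n, T n, forall n, q n (x n.+1) = x n & x k = y.
Proof.
elim: k T q A y => [|k IH] T q A y step Ay.
  have next n (z : {z : T n | A n z}) :
      {z' : T n.+1 | A n.+1 z' /\ q n z' = projT1 z}.
    by apply: cid; have [z' Az' qz'] := step n _ (projT2 z); exists z'.
  pose x := fix x n : {z : T n | A n z} :=
    if n is m.+1 then exist _ (projT1 (next m (x m))) (projT2 (next m (x m))).1
    else exist _ y Ay.
  by exists (fun n => projT1 (x n)) => // n; have [] := projT2 (next n (x n)).
have [x qx xk] := IH (fun n => T n.+1) (fun n => q n.+1) (fun n => A n.+1) y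
  (fun n z => step n.+1 z) Ay.
pose x' n : T n := match n with 0 => q 0%N (x 0%N) | m.+1 => x m end.
by exists x' => // -[|n] //=; exact: qx.
Qed.

Section InverseLimit.
Variables (R : realType) (S : pontryagin_sequence R).
Local Notation X := (pontryagin_disk S).
Local Notation stage := (pd_stage S).

Definition coord_at (k : nat) (x : X) : stage k := (\val x : forall n, stage n) k.

Lemma coord_at_continuous k : continuous (@coord_at k).
Proof.
move=> x; apply: (@continuous_comp _ (prod_topology (fun n => stage n)) _
  (fun x : X => \val x) (fun f => f k)).
  exact: initial_continuous.
exact: proj_continuous.
Qed.

Lemma coord_at_bond k (x : X) : pd_bond (coord_at k.+1 x) = coord_at k x.
Proof. by case: x => x xX; move/set_mem : (xX); exact. Qed.

Lemma coord_at_inj (x y : X) : (forall k, coord_at k x = coord_at k y) -> x = y.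
Proof. by move=> xy; apply: val_inj; apply: functional_extensionality_dep. Qed.

Lemma coord_at_down (x y : X) k n : coord_at (n + k) x = coord_at (n + k) y ->
  coord_at k x = coord_at k y.
Proof.
elim: n => [//|n IH] xy; apply: IH.
by have := congr1 (@pd_bond R S (n + k)) xy; rewrite !coord_at_bond.
Qed.

Lemma thread_point (z : forall n, stage n) :
  (forall n, pd_bond (z n.+1) = z n) -> exists x : X, forall n, coord_at n x = z n.
Proof.
move=> zX; have zX' : z \in [set x : prod_topology (fun k => stage k) |
    forall k, pd_bond (x k.+1) = x k] by rewrite inE.
by exists (exist _ z zX').
Qed.

Lemma stage_hausdorff k : hausdorff_space (stage k).
Proof. exact: metric_hausdorff. Qed.

Lemma stage_compact k : compact [set: stage k].
Proof.
have -> : [set: stage k] = tri_map (pd_tri S k) @`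
    realization R (tri_complex (pd_tri S k)).
  apply/seteqP; split=> // z _; exists (tri_coord (pd_tri S k) z).
    exact: tri_coord_real.
  exact: tri_mapK.
apply: continuous_compact; first exact: tri_map_continuous.
exact: realization_compact.
Qed.

Lemma pontryagin_disk_hausdorff : hausdorff_space X.
Proof.
move=> x y xy; apply: coord_at_inj => k; apply: stage_hausdorff => U W Ux Wy.
have [z [Uz Wz]] := xy _ _ (coord_at_continuous Ux) (coord_at_continuous Wy).
by exists (coord_at k z).
Qed.

Lemma pontryagin_disk_compact : compact [set: X].
Proof.
pose A := [set x : prod_topology (fun k => stage k) | forall k, pd_bond (x k.+1) = x k].
have cq k : continuous (@pd_bond R S k).
  by have [att [inc [att_disk [collar [_ _ _ [cq _] _]]]]] := pd_step S k.
have cA : closed A.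
  have -> : A = \bigcap_(k in [set: nat])
      [set x : prod_topology (fun k => stage k) | pd_bond (x k.+1) = x k].
    by apply/seteqP; split=> x xA k; [move=> _; exact: xA|exact: xA].
  apply: closed_bigI => k _.
  apply: closed_equalizer; first exact: stage_hausdorff.
    move=> z; apply: (@continuous_comp _ _ _
      (fun f : prod_topology (fun k => stage k) => f k.+1)); last exact: cq.
    exact: proj_continuous.
  by move=> z; exact: proj_continuous.
have kA : compact A.
  have := tychonoff (fun k => @stage_compact k) => kT.
  by apply: (subclosed_compact cA kT).
move=> F PF _; have GA : ((fun x : X => \val x) @ F) A.
  have FA : F ((fun x : X => \val x) @^-1` A).
    have -> : (fun x : X => \val x) @^-1` A = setT.
      by apply/seteqP; split=> // -[x xA] _ k; move/set_mem : (xA); exact.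
    exact: filterT.
  exact: FA.
have [p [Ap clp]] := kA _ (fmap_proper_filter _ PF) GA.
exists (exist _ p (mem_set Ap)); split=> // B U FB [_ [[W oW <-] Wp WU]].
have : ((fun x : X => \val x) @` B `&` W) !=set0.
  have FvB : F ((fun x : X => \val x) @^-1` ((fun x : X => \val x) @` B)).
    by apply: filterS FB => x Bx; exists x.
  exact: clp FvB (open_nbhs_nbhs (conj oW Wp)).
by move=> [_ [[x Bx <-] Wx]]; exists x; split=> //; exact: WU.
Qed.

(** Each point of the compact complement of [W'] is separated from [x] at some stage and at all
    later ones, so a single stage [n] separates them all. There the image of the complement is
    compact and misses a ball around the image of [x]. *)
Lemma cylinder_nbhs (x : X) (W : set X) : nbhs x W ->
  exists n e, 0 < e /\ forall z, mdist (coord_at n x) (coord_at n z) < e -> W z.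
Proof.
rewrite nbhsE => -[W' [oW' W'x] W'W].
have kC : compact (~` W').
  by apply: (subclosed_compact _ pontryagin_disk_compact) => //; exact: open_closedC.
have [n _ nC] : \forall n \near \oo, ~` W' `<=` [set z | coord_at n z <> coord_at n x].
  have /compact_near_coveringP ncC := kC.
  apply: (ncC nat \oo (fun n z => coord_at n z <> coord_at n x)) => z Wz.
  have [k zk] : exists k, coord_at k z <> coord_at k x.
    apply: contrapT => zx; apply: Wz; rewrite (_ : z = x)//.
    by apply: coord_at_inj => k; apply: contrapT => zk; apply: zx; exists k.
  have : nbhs z [set z' | coord_at k z' <> coord_at k x].
    have oU : open (~` [set coord_at k x]).
      apply: closed_openC.
      exact: accessible_closed_set1 (hausdorff_accessible (@stage_hausdorff k)) _.
    exact: (@coord_at_continuous k z _ (open_nbhs_nbhs (conj oU zk))).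
  move=> zn; exists ([set z' | coord_at k z' <> coord_at k x], [set n | (k <= n)%N]).
    by split=> //; exists k.
  move=> [z' n] [/= z'k kn] e; apply: z'k.
  by move: e; rewrite -(subnK kn); exact: coord_at_down.
have kn : compact (coord_at n @` ~` W').
  by apply: continuous_compact => //; apply: continuous_subspaceT; exact: coord_at_continuous.
have on : open (~` (coord_at n @` ~` W')).
  by apply: closed_openC; apply: compact_closed kn; exact: stage_hausdorff.
have xn : (~` (coord_at n @` ~` W')) (coord_at n x).
  by move=> [z Wz zx]; exact: (nC n (leqnn n) z Wz).
have /nbhs_ballP[e e0 eb] := open_nbhs_nbhs (conj on xn).
exists n, e; split=> // z ze; apply: W'W; apply: contrapT => Wz.
by apply: (eb (coord_at n z)); [rewrite ballEmdist|exists z].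
Qed.

(** Guarantees that the supremum in [mesh] is taken over a bounded set, hence really bounds the
    distances. *)
Lemma stage_bounded k : exists M : R, forall a b : stage k, mdist a b <= M.
Proof.
have [[a0 _]|na] := pselect (exists a : stage k, True); last first.
  by exists 0 => a; exfalso; apply: na; exists a.
have /compact_near_coveringP nc := @stage_compact k.
have [n _ nP] : \forall n \near \oo, [set: stage k] `<=` [set z | mdist a0 z <= n%:R].
  apply: (nc nat \oo (fun n z => mdist a0 z <= n%:R)) => z _.
  have [N zN] : exists N : nat, mdist a0 z + 1 <= N%:R.
    by exists (Num.truncn (mdist a0 z + 1)).+1; rewrite ltW// truncnS_gt.
  exists (ball z 1, [set n | (N <= n)%N]).
    by split; [exact: nbhsx_ballx|exists N].
  move=> [z' n] [/=]; rewrite ballEmdist /= => zz Nn.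
  apply: le_trans (metric_triangle _ z _) _.
  by apply: le_trans (le_trans zN _); [rewrite lerD2l ltW|rewrite ler_nat].
exists (n%:R + n%:R) => a b; apply: le_trans (metric_triangle _ a0 _) _.
by rewrite metric_sym lerD//; apply: (nP n (leqnn n)).
Qed.

Lemma coords_continuous k :
  continuous (fun x : X => tri_coord (pd_tri S k) (coord_at k x)).
Proof.
move=> x; apply: (@continuous_comp _ _ _ (@coord_at k)); first exact: coord_at_continuous.
exact: tri_coord_continuous.
Qed.

Definition cylinder k (s : {set 'I_(tri_size (pd_tri S k))}) : set X :=
  [set x | simplex R s (tri_coord (pd_tri S k) (coord_at k x))].

Lemma cylinder_closed k s : closed (@cylinder k s).
Proof.
exact: (closed_preimage (@coords_continuous k) (@simplex_closed R _ s)).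
Qed.

Lemma coord_at_iter n i (x : X) :
  bond_iter (@pd_bond R S) (coord_at (i + n) x) = coord_at n x.
Proof. by elim: i => //= i IH; rewrite coord_at_bond. Qed.

Lemma cylinder_mesh n i s x y : s \in tri_complex (pd_tri S (i + n)) ->
  cylinder s x -> cylinder s y ->
  mdist (coord_at n x) (coord_at n y) <=
    mesh (pd_tri S (i + n)) (@bond_iter _ (@pd_bond R S) n i).
Proof.
move=> sL sx sy; apply: ub_le_sup.
  have [M MP] := stage_bounded n.
  by exists M => _ [t [a [b [_ _ _ ->]]]]; exact: MP.
exists s, (coord_at (i + n) x), (coord_at (i + n) y).
by split => //; [exact/tri_cellP|exact/tri_cellP|rewrite !coord_at_iter].
Qed.

(** A Lebesgue number argument. In a fixed stage [n], half of the radius given by [cylinder_nbhs] is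
    spent on the distance from [x] to [y], half on the image of the simplex, which the mesh
    condition makes small. The point [y] records that the cylinder is nonempty. *)
Lemma small_cylinders (W : X -> set X) : (forall x, nbhs x (W x)) ->
  exists N, forall k, (N <= k)%N -> forall s, s \in tri_complex (pd_tri S k) ->
  forall y, cylinder s y -> exists x, @cylinder k s `<=` W x.
Proof.
move=> nW; have /compact_near_coveringP nc := pontryagin_disk_compact.
have [N _ NP] : \forall k \near \oo, [set: X] `<=` [set y |
    forall s, s \in tri_complex (pd_tri S k) -> cylinder s y ->
    exists x, @cylinder k s `<=` W x].
  apply: (nc nat \oo (fun k y => forall s, s \in tri_complex (pd_tri S k) ->
    cylinder s y -> exists x, @cylinder k s `<=` W x)) => x _.
  have [n [e [e0 eW]]] := cylinder_nbhs (nW x).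
  have e2 : 0 < e / 2 by rewrite divr_gt0.
  have /cvgrPdist_lt/(_ _ e2)[M _ MP] := @pd_mesh_lim R S n.
  exists ([set y | mdist (coord_at n x) (coord_at n y) < e / 2], [set k | (M + n <= k)%N]).
    split; last by exists (M + n)%N.
    have := @coord_at_continuous n x _ (@nbhsx_ballx _ _ (coord_at n x) _ e2).
    by rewrite ballEmdist.
  move=> [y k] [/= xy Mk] s sL sy; exists x => z sz; apply: eW.
  have nk : (n <= k)%N by exact: leq_trans (leq_addl _ _) Mk.
  have Mi : (M <= k - n)%N by rewrite leq_subRL// addnC.
  move: (k - n)%N (subnK nk) Mi => i ik Mi; subst k.
  have := MP i Mi; rewrite sub0r normrN => me.
  apply: le_lt_trans (metric_triangle _ (coord_at n y) _) _.
  rewrite [e]splitr ltrD//; apply: le_lt_trans (cylinder_mesh sL sy sz) _.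
  exact: le_lt_trans (ler_norm _) me.
by exists N => k Nk s sL y sy; exact: (NP k Nk y).
Qed.

End InverseLimit.

(** * Torsion-free groups *)

Section Stages.
Variables (R : realType) (S : pontryagin_sequence R).
Local Notation X := (pontryagin_disk S).
Local Notation tri := (pd_tri S).
Local Notation coords k x := (tri_coord (tri k) (coord_at k x)).

Lemma bond_fiber_skel1 k (z : pd_stage S k.+1) :
  skel1 (tri_coord (tri k) (pd_bond z)) ->
  skel1 (tri_coord (tri k.+1) z) /\ forall z', pd_bond z' = pd_bond z -> z' = z.
Proof.
have [att [inc [att_disk [collar [attP attach subdiv [cq q_inc] collarP]]]]] := pd_step S k.
set y := tri_coord _ _ => ky.
have fib z' : pd_bond z' = pd_bond z -> z' = inc y.
  move=> zz; apply: (step_fiber_skel1 attP attach q_inc collarP ky).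
  by rewrite zz tri_mapK.
split=> [|z' zz]; last by rewrite (fib z' zz) -(fib z).
rewrite (fib z)//; exact: (step_inc_skel1 subdiv cq q_inc ky).
Qed.

Lemma bond_onto_skel1 k (y : 'rV_(tri_size (tri k))) : skel1 y ->
  exists z : pd_stage S k.+1, pd_bond z = tri_map (tri k) y.
Proof.
have [att [inc [att_disk [collar [_ _ _ [_ q_inc] _]]]]] := pd_step S k.
by move=> ky; exists (inc y); exact: q_inc.
Qed.

Lemma coords_skel1_up k (x : X) : skel1 (coords k x) -> skel1 (coords k.+1 x).
Proof. by rewrite -coord_at_bond => /bond_fiber_skel1[]. Qed.

(** Once a thread lies in the 1-skeleton of a stage it stays in the later 1-skeletons, and each next
    coordinate is the only point of its fibre. *)
Lemma coords_skel1_inj k (x y : X) : skel1 (coords k x) ->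
  coord_at k x = coord_at k y -> x = y.
Proof.
move=> kx xy.
have up n : skel1 (coords (n + k) x) /\ coord_at (n + k) x = coord_at (n + k) y.
  elim: n => [//|n [IHk IHe]]; split; first exact: coords_skel1_up.
  have := IHk; rewrite -coord_at_bond => /bond_fiber_skel1[_ h].
  by apply/esym/h; rewrite !coord_at_bond IHe.
apply: coord_at_inj => n; apply: (@coord_at_down R S x y n k).
by rewrite addnC; exact: (up n).2.
Qed.

Lemma skel1_point k (y : 'rV_(tri_size (tri k))) : skel1 y ->
  exists x : X, coords k x = y.
Proof.
move=> ky; have yr := skel1_real ky.
have [||x /thread_point[x' xx'] xk] := @thread_exists (pd_stage S) (@pd_bond R S)
  (fun n => [set z | skel1 (tri_coord (tri n) z)]) k (tri_map (tri k) y).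
- move=> n z kz; have [z' zz'] := bond_onto_skel1 kz; rewrite tri_mapK in zz'.
  by exists z' => //; apply: (bond_fiber_skel1 (z := z') _).1; rewrite zz'.
- by rewrite /= tri_coordK.
- by exists x'; rewrite xx' xk tri_coordK.
Qed.

Lemma pontryagin_disk_inhabited : exists x : X, True.
Proof.
have [f _] := pd_disk S.
have [sL sx] := realization_support (tri_complexP (t := tri 0%N)) (tri_coord_real (tri 0%N) (f 0)).
have /card_gt0P[i si] := support_face_gt0 sx.
have iL : finset.set1 i \in tri_complex (tri 0%N).
  by apply: (tri_complexP sL).2; rewrite ?finset.sub1set ?cards1.
have [|x _] := @skel1_point 0%N (barycenter R (finset.set1 i)); last by exists x.
exists (finset.set1 i); first by rewrite /= inE iL cards1.
by apply: barycenter_simplex; rewrite cards1.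
Qed.

(** The 1-skeleton of every stage sits in the limit: [j] inverts the coordinate map, which is
    injective on the compact preimage of the 1-skeleton, so it is continuous. *)
Lemma skel1_section k : exists j : 'rV_(tri_size (tri k)) -> X,
  {within skel1 (L := tri k), continuous j} /\
  forall y, skel1 y -> coords k (j y) = y.
Proof.
have [x0 _] := pontryagin_disk_inhabited.
have /choice[j jP] : forall y, exists x : X, skel1 (L := tri k) y -> coords k x = y.
  move=> y; have [ky|ny] := pselect (skel1 (L := tri k) y); last by exists x0.
  by have [x xy] := skel1_point ky; exists x.
exists j; split => //; pose A := [set x : X | skel1 (coords k x)].
have ccont : continuous (fun x : X => coords k x) := @coords_continuous R S k.
have kA : compact A.
  apply: (subclosed_compact _ (@pontryagin_disk_compact R S)) => //.
  apply: (closed_preimage ccont).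
  by apply: compact_closed; [exact: rV_hausdorff|exact: realization_compact].
have -> : skel1 (L := tri k) = (fun x => coords k x) @` A.
  apply/seteqP; split=> [y ky|_ [x kx <-]//].
  by exists (j y); [rewrite /A /= jP|exact: jP].
apply: within_quotient kA (@rV_hausdorff _ _) _ _; first exact: continuous_subspaceT.
apply: (@within_ext _ _ _ idfun); last by apply: continuous_subspaceT => x; exact: cvg_id.
move=> x kx; apply: (@coords_skel1_inj k) => //.
by rewrite -(tri_mapK (tri k) (coord_at k x)) -(jP _ kx) tri_mapK.
Qed.

(** Without a triangle, stage 0 would be its own 1-skeleton and the disk would embed in a graph. *)
Lemma has_triangle : exists s, is_tri (L := tri 0%N) s.
Proof.
have [f [g [[cf _] fK _]]] := pd_disk S; apply: contrapT => notri.
apply: (@disk_not_in_graph R _ (tri_complex (tri 0%N)) (fun u => tri_coord (tri 0%N) (f u))).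
- exact: tri_complexP.
- exact: (within_compT cf (@tri_coord_continuous _ _ _)).
- move=> u _; have ur := tri_coord_real (tri 0%N) (f u); apply/(skeleton1P _ ur).
    exact: tri_complexP.
  have [sL _] := realization_support (tri_complexP (t := tri 0%N)) ur.
  rewrite leqNgt; apply/negP => s3; apply: notri; exists (support_face (tri_coord (tri 0%N) (f u))).
  by split=> //; apply/eqP; rewrite eqn_leq s3 andbT; have [/andP[]] := tri_complexP sL.
- move=> u v du dv e; rewrite -(fK u du).2 -(fK v dv).2.
  by rewrite -(tri_mapK (tri 0%N) (f u)) e tri_mapK.
Qed.

End Stages.

Section NotExtensor.
Variables (R : realType) (S : pontryagin_sequence R).
Variables (K : topologicalType) (G : groupType) (cls : K -> (R -> K) -> G).
Hypotheses (clsP : pi1_classifier cls) (hK : hausdorff_space K).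
Local Notation X := (pontryagin_disk S).
Local Notation tri := (pd_tri S).
Local Notation coords k x := (tri_coord (tri k) (coord_at k x)).

(** [g] and [h] are compared only at the points of the limit lying over the 1-skeleton; elsewhere
    [h] is free. This weak agreement is what survives the descent from one stage to the previous
    one. *)
Definition stage_approximation (g : X -> K) (k : nat) : Prop :=
  exists2 h : 'rV_(tri_size (tri k)) -> K,
    {within realization R (tri_complex (tri k)), continuous h} &
    forall x, skel1 (coords k x) -> h (coords k x) = g x.

Lemma stage_approximation_down (g : X -> K) (k : nat) : torsion_free G ->
  stage_approximation g k.+1 -> stage_approximation g k.
Proof.
move=> tf [H cH Hg].
have [att [inc [att_disk [collar [attP attach subdiv [cq q_inc] collarP]]]]] := pd_step S k.
have [_ _ inj glue _] := attach.
pose H' z := H (tri_coord (tri k.+1) z).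
have cH' : continuous H'.
  apply/within_setT; apply: (within_comp (f := tri_coord (tri k.+1)) _ _ cH).
    by move=> z _; exact: tri_coord_real.
  by apply/within_setT; exact: tri_coord_continuous.
have ch : {within skel1 (L := tri k), continuous (fun y => H' (inc y))}.
  exact: (within_compT (step_inc_continuous attach) cH').
have [|h ch' hh] := skeleton_extension (tri_complexP (t := tri k)) ch.
  move=> s sL s3; have ts : is_tri (L := tri k) s by [].
  have [catt [phi [th [hphi cth attphi th2]]]] := attP s ts.
  have [g' [[cphi _] phiP _]] := hphi.
  apply: (cone_extension (phi := phi)) => //; first by rewrite s3.
  apply: (bounds_disk_double clsP hK (F' := fun t => H' (inc (att s (circle_point t)))) (th := th)) => //.
  - apply: (circle_map_continuous (h := fun u => H' (inc (phi u)))).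
    apply: (within_comp _ cphi ch) => u us.
    by apply: (boundary_skel1 ts); exact: (phiP u us).1.
  - by move=> t; rewrite circle_pointD1.
  - apply: (circle_map_continuous (h := fun u => H' (inc (att s u)))).
    apply: (within_comp _ catt ch) => u us.
    exact: (step_att_skel1 attP ts us).
  - by move=> t; rewrite circle_pointD1.
  - by move=> t t01; rewrite attphi.
  - apply/bounds_disk1P; exists (fun u => H' (att_disk s u)).
      exact: (within_compT (step_disk_continuous attach ts) cH').
    by move=> t; rewrite glue//; exact: circle_point_sphere.
exists h => // x kx; rewrite hh// /H'.
rewrite (_ : inc (coords k x) = coord_at k.+1 x); first by apply: Hg; exact: coords_skel1_up.
apply/esym/(step_fiber_skel1 attP attach q_inc collarP kx).
by rewrite coord_at_bond tri_mapK.
Qed.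

(** For fine stages, [iota \o g] sends each nonempty cylinder of a simplex into a ball inside the
    domain of the retraction [r]. The boundary loop of a triangle contracts in this convex ball, and
    [r] carries the contraction to [K]. *)
Lemma stage_approximation_exists (C : cw_structure R K) (g : X -> K) :
  continuous g -> exists N, stage_approximation g N.
Proof.
move=> cg; have kX := @pontryagin_disk_compact R S.
have [x0 _] := pontryagin_disk_inhabited S.
have kgX : compact (g @` [set: X]).
  by apply: continuous_compact => //; exact: continuous_subspaceT.
have [Y fY gY] := compact_finite_subcomplex C kgX.
have [E [iota [r [U [[_ ci oU rK] Ur]]]]] := finite_subcomplex_retract (g x0)
  (@pontryagin_disk_hausdorff R S) kX fY.
have gYx x : Y (g x) by apply: gY; exists x.
have cig : continuous (fun x => iota (g x)).
  by apply/within_setT; apply: (within_comp (f := g) _ _ ci) => //; exact/within_setT.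
have /choice[e eP] : forall x, exists e : R, 0 < e /\ ball (iota (g x)) e `<=` U.
  move=> x; have [Ux _] := rK _ (gYx x).
  by have /nbhs_ballP[e e0 eU] := open_nbhs_nbhs (conj oU Ux); exists e.
have [|N NP] := @small_cylinders R S (fun x => [set z | ball (iota (g x)) (e x) (iota (g z))]).
  by move=> x; apply: (cig x); apply: nbhsx_ballx; exact: (eP x).1.
exists N; have [j [cj jP]] := skel1_section S N.
have cgj : {within skel1 (L := tri N), continuous (fun y => g (j y))}.
  exact: (within_compT cj cg).
have [|h ch hh] := skeleton_extension (tri_complexP (t := tri N)) cgj.
  move=> s sL s3; have ts : is_tri (L := tri N) s by [].
  have [att [inc [att_disk [collar [attP _ _ _ _]]]]] := pd_step S N.
  have [_ [phi [th [hphi _ _ _]]]] := attP s ts.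
  have [g' [[cphi _] phiP _]] := hphi.
  have phik u : sphere u -> skel1 (L := tri N) (phi u).
    by move=> us; apply: (boundary_skel1 ts); exact: (phiP u us).1.
  have jcyl u : sphere u -> cylinder s (j (phi u)).
    by move=> us; rewrite /cylinder /= jP; [have [[]] := phiP u us|exact: phik].
  have [x sx] := NP N (leqnn N) s sL _ (jcyl _ (circle_point_sphere 0)).
  apply: (cone_extension (phi := phi)) => //; first by rewrite s3.
  have -> : (fun t : R => g (j (phi (circle_point t)))) =
      r \o (fun t => iota (g (j (phi (circle_point t))))).
    by apply/funext => t /=; rewrite (rK _ (gYx _)).2.
  apply: (@convex_bounds_disk R K E (ball (iota (g x)) (e x)) r) => //.
  - by apply: (within_at oU (eP x).2) => y /Ur[].
  - apply: (circle_map_continuous (h := fun u => iota (g (j (phi u))))).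
    exact: (within_compT (within_comp phik cphi cj) cig).
  - by move=> t; rewrite circle_pointD1.
  - move=> a b t; rewrite -ball_normE /= => xa xb /andP[t0 t1].
    have -> : iota (g x) - ((1 - t) *: a + t *: b) =
        (1 - t) *: (iota (g x) - a) + t *: (iota (g x) - b).
      by rewrite !scalerBr addrACA -scalerDl subrK scale1r opprD.
    apply: le_lt_trans (ler_normD _ _) _; rewrite !normrZ !ger0_norm ?subr_ge0//.
    move: xa xb; set p := `|_ - a|; set q := `|_ - b| => xa xb.
    (* The strict inequality comes from [p] when t = 0 and from [q] otherwise. *)
    have [->|t0'] := eqVneq t 0; first by rewrite subr0 mul1r mul0r addr0.
    have : t * q < t * e x by rewrite ltr_pM2l// lt_neqAle eq_sym t0'.
    have : (1 - t) * p <= (1 - t) * e x by rewrite ler_wpM2l ?subr_ge0// ltW.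
    by nra.
  - by move=> t; apply: sx; apply: jcyl; exact: circle_point_sphere.
exists h => // x kx; rewrite hh//; congr g.
apply/esym/(@coords_skel1_inj R S N) => //.
by have := congr1 (tri_map (tri N)) (jP _ kx); rewrite !tri_mapK.
Qed.

End NotExtensor.

Lemma em_classifier (R : realType) (G : groupType) (K : topologicalType) :
  eilenberg_maclane1 R G K -> exists cls : K -> (R -> K) -> G, pi1_classifier cls.
Proof.
move=> [_ _ pi1 _]; have /choice[cls clsP] := pi1.
by exists cls => x0; have [] := clsP x0.
Qed.

Section CircleRealization.
Variables (R : realType) (K : topologicalType) (G : groupType).
Variable cls : K -> (R -> K) -> G.
Hypotheses (clsP : pi1_classifier cls) (hK : hausdorff_space K).
Local Notation I := (`[0, 1]%classic : set R).

(** The circle is the interval with its ends glued, so a loop descends to the curve. The last clause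
    turns an extension over the disk back into triviality of the class at the given base point. *)
Lemma loop_on_curve (T : topologicalType) (C : set T) (phi : 'rV[R]_2 -> T)
    (x0 : K) (l : R -> K) : hausdorff_space T -> homeo_on (@sphere R 2) C phi ->
  loop x0 l -> exists h : T -> K, [/\ {within C, continuous h},
    forall t, 0 <= t <= 1 -> h (phi (circle_point t)) = l t &
    bounds_disk (fun t => h (phi (circle_point t))) 1 -> cls x0 l = 1%g].
Proof.
move=> hT [g [[cphi _] phiP gP]] lp; have [cl l0 l1] := lp.
have phiK t : g (phi (circle_point t)) = circle_point t.
  by rewrite (phiP _ (circle_point_sphere t)).2.
have leq t t' : I t -> I t' -> phi (circle_point t) = phi (circle_point t') -> l t = l t'.
  move=> /itv01P/andP[t0 t1] /itv01P/andP[t0' t1'] /(congr1 g); rewrite !phiK => ct.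
  have [tt|tt] := ltP `|t - t'| 1; first by rewrite (circle_point_inj ct tt).
  have : (t = 0 /\ t' = 1) \/ (t = 1 /\ t' = 0).
    by move: tt; rewrite ler_normr => /orP[?|?]; [right|left]; split; lra.
  by case=> -[-> ->]; rewrite l0 l1.
have /choice[sec secP] : forall y, exists t, C y -> I t /\ phi (circle_point t) = y.
  move=> y; have [/gP[gy gyK]|nC] := pselect (C y); last by exists 0.
  by have [t t01 gt] := sphere_circle_point gy; exists t => _; split; [exact/itv01P|rewrite -gt].
have Cphi t : C (phi (circle_point t)) by exact: (phiP _ (circle_point_sphere t)).1.
have hl t : 0 <= t <= 1 -> l (sec (phi (circle_point t))) = l t.
  by move=> /itv01P t01; have [st se] := secP _ (Cphi t); exact: leq.
have ch : {within C, continuous (fun y => l (sec y))}.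
  have -> : C = (fun t => phi (circle_point t)) @` I.
    apply/seteqP; split=> [y Cy|_ [t _ <-]//].
    by have [st se] := secP _ Cy; exists (sec y).
  apply: within_quotient (@segment_compact R 0 1) hT _ _.
    by apply: continuous_subspaceT; exact: circle_map_continuous.
  by apply: within_ext cl => t /itv01P t01; rewrite /= hl.
exists (fun y => l (sec y)); split => // bd.
have cF : continuous (fun t => l (sec (phi (circle_point t)))).
  apply: (circle_map_continuous (h := fun u => l (sec (phi u)))).
  by apply: (within_comp _ cphi ch) => u us; exact: (phiP u us).1.
have F1 t : l (sec (phi (circle_point (t + 1)))) = l (sec (phi (circle_point t))).
  by rewrite circle_pointD1.
have := (bounds_diskP clsP hK cF F1 0 (ltn0Sn 0)).1 bd.
rewrite expg1 /turn hl ?lexx ?ler01// l0 => <-.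
have [_ hom _] := clsP x0.
have e t : 0 <= t <= 1 -> l t = l (sec (phi (circle_point (0 + t)))).
  by move=> t01; rewrite add0r hl.
by apply/hom => //; [exact: loop_ext lp e|exact: loop_homotopic_ext].
Qed.

End CircleRealization.

Lemma torsion_free_not_extensor (R : realType) (S : pontryagin_sequence R)
    (G : groupType) (K : topologicalType) :
  torsion_free G -> nontrivial_group G -> eilenberg_maclane1 R G K ->
  ~ absolute_extensor (pontryagin_disk S) K.
Proof.
move=> tf [c c1] EM AE; have [cls clsP] := em_classifier EM.
have [[C] [[x0 _] _] _ _] := EM; have hK := cw_hausdorff C.
have [s ts] := has_triangle S; have [sL s3] := ts.
have [att [inc [att_disk [collar [attP _ _ _ _]]]]] := pd_step S 0.
have [_ [phi [th [hphi _ _ _]]]] := attP s ts.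
have [g' [_ phiP _]] := hphi.
have [surj _ _] := clsP x0; have [l lp lc] := surj c.
have [h [ch hl hc]] := loop_on_curve clsP hK (@rV_hausdorff R _) hphi lp.
pose coords (x : pontryagin_disk S) := tri_coord (pd_tri S 0) (coord_at 0 x).
have ccoords : continuous coords := @coords_continuous R S 0.
pose A := coords @^-1` simplex_boundary R s.
have cA : closed A by apply: closed_preimage ccoords (@simplex_boundary_closed R _ s).
have cf : {within A, continuous (fun x => h (coords x))}.
  apply: (within_comp (f := coords) _ _ ch) => //.
  exact: continuous_subspaceT.
have [g cg gf] := AE A cA _ ((subspace_sigL_continuousP _ _).1 cf).
have [N gN] := stage_approximation_exists hK C cg.
have [H cH Hg] : stage_approximation g 0.
  elim: N gN => // N IH /(stage_approximation_down clsP hK tf).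
  exact: IH.
have [j [_ jP]] := skel1_section S 0.
apply: c1; rewrite -lc; apply: hc.
have cHs : {within simplex R s, continuous H}.
  by apply: continuous_subspaceW cH; exact: simplex_real.
have := simplex_map_bounds_disk hK hphi cHs.
rewrite (_ : (fun t => H _) = fun t => h (phi (circle_point t)))//.
apply/funext => t; have pb := (phiP _ (circle_point_sphere t)).1.
have kp := boundary_skel1 ts pb; set y := phi _ in pb kp *.
(* The limit point over [y] belongs both to [A], where [g] is prescribed by [h], and to the set over
   the 1-skeleton, where [H] agrees with [g]. *)
have Aj : j y \in A by rewrite inE /A /= /coords jP.
have := gf (exist _ (j y) Aj); rewrite /= /sigL /= /coords jP// => <-.
by rewrite -Hg /coords jP.
Qed.

(** * 2-groups *)

Section ExtendCylinders.
Variables (R : realType) (S : pontryagin_sequence R).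
Variables (K : topologicalType) (G : groupType) (cls : K -> (R -> K) -> G).
Hypotheses (clsP : pi1_classifier cls) (hK : hausdorff_space K).
Local Notation X := (pontryagin_disk S).
Local Notation tri := (pd_tri S).
Local Notation coords k x := (tri_coord (tri k) (coord_at k x)).
Local Notation I := (`[0, 1]%classic : set R).

(** A map of the circle to itself lifts to an angle function whose ends differ by an integer, its
    degree; precomposition therefore raises the class to that power. *)
Lemma bounds_disk_transfer (h u : _ -> _) (N : nat) : (0 < N)%N ->
  {within @sphere R 2, continuous h} -> {within @sphere R 2, continuous u} ->
  (forall v, sphere v -> sphere (u v)) ->
  bounds_disk (fun t => h (circle_point t) : K) N ->
  bounds_disk (fun t => h (u (circle_point t))) N.
Proof.
move=> N0 ch cu us bd.
have cuc : {within I, continuous (fun t => u (circle_point t))}.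
  by apply: continuous_subspaceT; exact: circle_map_continuous.
have [th cth thu] := circle_lift cuc (fun t _ => us _ (circle_point_sphere t)).
have e : circle_point (th 1) = circle_point (th 0).
  by rewrite !thu ?lexx ?ler01// -[in LHS](add0r 1) circle_pointD1.
have [k thk] := circle_point_eq e.
apply: (bounds_disk_pullback clsP hK (F := fun t => h (circle_point t)) (th := th) _ _ _ _ cth _ N0 thk) => //.
- exact: circle_map_continuous.
- by move=> t; rewrite circle_pointD1.
- apply: (circle_map_continuous (h := fun v => h (u v))).
  exact: within_comp us cu ch.
- by move=> t; rewrite circle_pointD1.
- by move=> t t01; rewrite thu.
Qed.

(** The stage, the triangle, the parametrization and the map all vary in the induction, since each
    step moves to a smaller triangle of the next stage. *)
Lemma extend_cylinder (m k : nat) (s : {set 'I_(tri_size (tri k))})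
    (phi : 'rV[R]_2 -> 'rV[R]_(tri_size (tri k))) (h : 'rV[R]_(tri_size (tri k)) -> K) :
  is_tri s -> homeo_on (@sphere R 2) (simplex_boundary R s) phi ->
  {within simplex_boundary R s, continuous h} ->
  bounds_disk (fun t => h (phi (circle_point t))) (2 ^ m) ->
  exists2 F : X -> K, {within cylinder s, continuous F} &
    forall x, cylinder s x -> simplex_boundary R s (coords k x) -> F x = h (coords k x).
Proof.
elim: m k s phi h => [|m IH] k s phi h ts hphi ch bd.
  have s0 : (0 < #|s|)%N by case: ts => _ ->.
  have [H cH Hh] := cone_extension s0 hphi bd.
  exists (fun x => H (coords k x)); last by move=> x _; exact: Hh.
  apply: (within_comp (f := fun x : X => coords k x) _ _ cH) => //.
  by apply: continuous_subspaceT; exact: coords_continuous.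
have [att [inc [att_disk [collar [attP attach subdiv [cq q_inc] collarP]]]]] := pd_step S k.
have [catt [phi2 [th [hphi2 cth attphi th2]]]] := attP s ts.
have [g [[cphi cg] phiP gP]] := hphi; have [g2 [[cphi2 _] phi2P _]] := hphi2.
have chphi : {within @sphere R 2, continuous (fun v => h (phi v))}.
  by apply: (within_comp _ cphi ch) => u us; exact: (phiP u us).1.
(* The degree of the attaching map refers to its own parametrization [phi2] of the boundary; it
   differs from [phi] by a self-map of the circle. *)
have bd2 : bounds_disk (fun t => h (phi2 (circle_point t))) (2 ^ m.+1).
  have -> : (fun t => h (phi2 (circle_point t))) =
      (fun t => h (phi (g (phi2 (circle_point t))))).
    apply/funext => t; congr h; apply/esym/(gP _ _).2.
    exact: (phi2P _ (circle_point_sphere t)).1.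
  apply: (bounds_disk_transfer (h := fun v => h (phi v)) (u := fun v => g (phi2 v))) => //.
  - by rewrite expn_gt0.
  - by apply: (within_comp _ cphi2 cg) => u us; exact: (phi2P u us).1.
  - by move=> v vs; exact: (gP _ (phi2P v vs).1).1.
have batt u : sphere u -> simplex_boundary R s (att s u).
  by move=> us; exact: step_att_boundary attP _ _ ts us.
have chatt : {within @sphere R 2, continuous (fun v => h (att s v))}.
  exact: within_comp batt catt ch.
have bdatt : bounds_disk (fun t => h (att s (circle_point t))) (2 ^ m).
  apply: (bounds_disk_half clsP hK (F := fun t => h (phi2 (circle_point t))) (th := th)) => //.
  - apply: (circle_map_continuous (h := fun v => h (phi2 v))).
    by apply: (within_comp _ cphi2 ch) => u us; exact: (phi2P u us).1.
  - by move=> t; rewrite circle_pointD1.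
  - exact: circle_map_continuous chatt.
  - by move=> t; rewrite circle_pointD1.
  - by move=> t t01; rewrite attphi.
  - by rewrite expn_gt0.
  - by rewrite -expnS.
have [s' [sL' s3' sub]] : exists s', [/\ s' \in tri_complex (tri k.+1), #|s'| = 3%N &
      tri_cell (tri k.+1) s' `<=` att_disk s @` @open_disk R 2].
  by apply: step_core_triangle ts; eassumption.
have ts' : is_tri (L := tri k.+1) s' by [].
have hk1 := @stage_hausdorff R S k.+1.
have [h' [ch' h'inc h'loop]] : exists h' : pd_stage S k.+1 -> K,
  [/\ {within [set z | (att_disk s @` @disk R 2) z /\
        support_face (tri_coord (tri k.+1) z) != s'], continuous h'},
      forall y, simplex_boundary R s y -> h' (inc y) = h y
    & forall phi, homeo_on (@sphere R 2) (simplex_boundary R s') phi ->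
      exists u : 'rV[R]_2 -> 'rV[R]_2,
      [/\ {within @sphere R 2, continuous u}, forall v, sphere v -> sphere (u v)
        & forall v, sphere v -> h' (tri_map (tri k.+1) (phi v)) = h (att s (u v))]].
  exact: (step_puncture attP attach subdiv cq q_inc hk1 ts sL' s3' sub ch).
(* The following step of the sequence is opened only for the parametrization [phi'] of the boundary
   of [s']. *)
have [att' [inc' [att_disk' [collar' [attP' _ _ _ _]]]]] := pd_step S k.+1.
have [_ [phi' [_ [hphi' _ _ _]]]] := attP' s' ts'.
have [u [cu us hu]] := h'loop phi' hphi'.
have [g' [_ phi'P _]] := hphi'.
have bproper y : simplex_boundary R s' y -> simplex R s' y /\ support_face y != s'.
  move=> yb; have ys : simplex R s' y by case: yb.
  by split=> //; apply/eqP => e; have := (simplex_boundaryP s3' ys).1 yb; rewrite e s3'.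
have ch'' : {within simplex_boundary R s', continuous (fun y => h' (tri_map (tri k.+1) y))}.
  apply: (within_comp _ _ ch').
    move=> y /bproper[ys yn]; split; last by rewrite tri_coordK//; exact: simplex_real ys.
    by have [|w wo wy] := sub (tri_map (tri k.+1) y); [exists y|exists w => //; exact: open_disk_disk].
  apply: continuous_subspaceW (@tri_map_continuous _ _ (tri k.+1)) => y /bproper[ys _].
  exact: simplex_real ys.
have bd' : bounds_disk (fun t => h' (tri_map (tri k.+1) (phi' (circle_point t)))) (2 ^ m).
  have -> : (fun t => h' (tri_map (tri k.+1) (phi' (circle_point t)))) =
      (fun t => h (att s (u (circle_point t)))).
    by apply/funext => t; rewrite hu//; exact: circle_point_sphere.
  by apply: (bounds_disk_transfer (h := fun v => h (att s v)) (u := u)); rewrite ?expn_gt0.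
have [F' cF' F'h] := IH k.+1 s' phi' _ ts' hphi' ch'' bd'.
(* Inside the cylinder of [s], the two pieces overlap only over the boundary of [s'], where [F'] was
   prescribed to be [h']. [B] below is the part of the cylinder of [s] outside the open triangle
   [s'], so both pieces have closed domains. *)
pose F x := if `[< cylinder s' x >] then F' x else h' (coord_at k.+1 x).
have Fh' x : support_face (coords k.+1 x) != s' -> F x = h' (coord_at k.+1 x).
  rewrite /F; case: asboolP => // xs xn; rewrite F'h ?tri_mapK//.
  by apply: contrapT => nb; move: xn; rewrite (simplex_interior xs nb) eqxx.
pose B := cylinder s `&` \bigcup_(i in [set i | i \in s']) [set x | coords k.+1 x ord0 i <= 0].
have Bn x : B x -> support_face (coords k.+1 x) != s'.
  move=> [_ [i si /= xi]]; apply/eqP => /(open_triangleP _ ts')/(_ i si).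
  by rewrite ltNge xi.
have cB : closed B.
  apply: closedI; first exact: cylinder_closed.
  apply: closed_bigcup => [|i _]; first exact: finite_finset.
  apply: (closed_preimage (f := fun x : X => coords k.+1 x ord0 i) _ (@closed_le R 0)).
  move=> x; apply: (@continuous_comp _ _ _ (fun x : X => coords k.+1 x)
    (fun y : 'rV[R]_(tri_size (tri k.+1)) => y ord0 i)); first exact: coords_continuous.
  exact: coord_continuous.
have sdisk x : cylinder s x -> (att_disk s @` @disk R 2) (coord_at k.+1 x).
  move=> xs; have [v dv ->] : exists2 v, disk v & coord_at k.+1 x = att_disk s v; last by exists v.
  apply: (step_cell_disk attP attach q_inc collarP ts).
  by rewrite coord_at_bond.
exists F.
  apply: (@continuous_subspaceW _ _ _ (cylinder s' `|` B)).
    move=> x xs; have [e|/eqP n] := eqVneq (support_face (coords k.+1 x)) s'.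
      left; have [w _ wx] := tri_coord_real (tri k.+1) (coord_at k.+1 x).
      by rewrite /cylinder /= -e; exact: (simplex_support wx).1.
    right; split=> //; apply: contrapT => nB; apply: n.
    apply/(open_triangleP _ ts') => i si; rewrite ltNge; apply/negP => xi.
    by apply: nB; exists i.
  apply: withinU_continuous => //; first exact: cylinder_closed.
    by apply: within_ext cF' => x xs; rewrite /F; case: asboolP.
  apply: (@within_ext _ _ _ (fun x => h' (coord_at k.+1 x))) => [x /Bn/Fh'//|].
  apply: (within_comp (f := @coord_at R S k.+1) _ _ ch') => [x Bx|].
    by split; [apply: sdisk; case: Bx|exact: Bn].
  by apply: continuous_subspaceT; exact: coord_at_continuous.
move=> x xs xb; have kx := boundary_skel1 ts xb.
have xinc : coord_at k.+1 x = inc (coords k x).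
  apply: (step_fiber_skel1 attP attach q_inc collarP kx).
  by rewrite coord_at_bond tri_mapK.
rewrite Fh' ?xinc ?h'inc//; apply/eqP => e.
have := step_inc_skel1 subdiv cq q_inc kx.
by move/(skel1P (tri_coord_real _ _)); rewrite e s3'.
Qed.

End ExtendCylinders.

(** The image of [A] lies in a finite subcomplex [Y]; extend [iota \o f] to the ambient space by
    Tietze, then retract wherever the extension stays in the open set [U]. *)
Lemma extension_near (R : realType) (X K : topologicalType) (C : cw_structure R K)
    (A : set X) (f : X -> K) :
  hausdorff_space X -> compact [set: X] -> closed A -> {within A, continuous f} ->
  exists (B : set X) (f' : X -> K), [/\ open B, A `<=` B,
    forall x, B x -> {for x, continuous f'} & forall x, A x -> f' x = f x].
Proof.
(* The empty set is set apart because the retraction needs a point of [K], taken here to be a value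
   of [f]. *)
move=> hX kX cA cf; have [->|/set0P[x0 Ax0]] := eqVneq A set0.
  by exists set0, f; split=> //; exact: open0.
have kfA : compact (f @` A).
  by apply: continuous_compact => //; exact: subclosed_compact cA kX (@subsetT _ A).
have [Y fY fAY] := compact_finite_subcomplex C kfA.
have [E [iota [r [U [[tE ci oU rK] Ur]]]]] := finite_subcomplex_retract (f x0) hX kX fY.
have AY x : A x -> Y (f x) by move=> Ax; apply: fAY; exists x.
have [e ce ef] := tE A (fun x => iota (f x)) cA (within_comp AY cf ci).
exists (e @^-1` U), (fun x => r (e x)); split.
- by apply: open_comp => // x _; exact: ce.
- by move=> x Ax; rewrite /= ef//; exact: (rK _ (AY _ Ax)).1.
- move=> x /Ur[_ cr]; apply: (@continuous_comp _ _ _ e r) => //; exact: ce.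
- by move=> x Ax; rewrite ef//; exact: (rK _ (AY _ Ax)).2.
Qed.

(** * Extension over the edges of a graph *)

Section GraphExtension.
Variables (R : realType) (n : nat) (K : topologicalType).
Implicit Types (s : {set 'I_n}) (y : 'rV[R]_n).

Lemma vertexE (a : 'I_n) y : simplex R (finset.set1 a) y -> forall i, y ord0 i = (i == a)%:R.
Proof.
move=> [_ y1 ya] i; have [->|ia] := eqVneq i a; last by rewrite ya// inE.
by rewrite -y1 (bigD1 a)//= big1 ?addr0// => j ja; rewrite ya// inE.
Qed.

Lemma vertex_unique (a : 'I_n) y y' :
  simplex R (finset.set1 a) y -> simplex R (finset.set1 a) y' -> y = y'.
Proof. by move=> ya ya'; apply/rowP => i; rewrite (vertexE ya) (vertexE ya'). Qed.

(** [f] is kept on the simplices in [P] and at every vertex, where continuity is automatic; each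
    remaining edge is filled by a path between the values of [f] at its ends. *)
Lemma graph_extension (L : {set {set 'I_n}}) (P : {set 'I_n} -> Prop)
    (f : 'rV[R]_n -> K) : complex2 L -> path_connected R K ->
  (forall s (t : {set 'I_n}), P s -> t \subset s -> P t) ->
  (forall s, s \in skeleton1 L -> P s -> {within simplex R s, continuous f}) ->
  exists2 h : 'rV[R]_n -> K, {within realization R (skeleton1 L), continuous h} &
    forall s y, s \in skeleton1 L -> P s -> simplex R s y -> h y = f y.
Proof.
move=> cL [_ pK] PS cf; have cL1 := skeleton1_complex cL.
have /choice[H HP] : forall s, exists H : 'rV[R]_n -> K, s \in skeleton1 L ->
    [/\ {within simplex R s, continuous H},
      forall y, simplex R s y -> (#|support_face y| <= 1)%N -> H y = f y &
      P s -> forall y, simplex R s y -> H y = f y].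
  move=> s; have [Ps|nP] := pselect (P s); first by exists f => sL; split=> //; exact: cf.
  have [s1|s1] := leqP #|s| 1.
    exists f => sL; split=> //; have s0 := (cL1 s sL).1.
    have /cards1P[a ->] : #|s| == 1%N by rewrite eqn_leq s1; case/andP: s0.
    apply/withinP => y ya U oU Uy; exists setT; split=> //; first exact: openT.
    by move=> y' _ ya'; rewrite (vertex_unique ya' ya).
  have [sL|nL] := boolP (s \in skeleton1 L); last by exists f.
  have /cards2P[a [b [ab sab]]] : #|s| == 2%N.
    by rewrite eqn_leq s1 andbT; move: sL; rewrite inE => /andP[].
  have va := @barycenter_simplex R n (finset.set1 a); have vb := @barycenter_simplex R n (finset.set1 b).
  rewrite cards1 in va; rewrite cards1 in vb.
  have [p [cp p0 p1]] := pK (f (barycenter R (finset.set1 a))) (f (barycenter R (finset.set1 b))).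
  (* The barycentric coordinate at [b] parametrizes the edge from [a] (value 0) to [b] (value 1). *)
  exists (fun y => p (y ord0 b)) => _; split=> //.
    apply: (within_comp (f := fun y : 'rV[R]_n => y ord0 b) _ _ cp) => [y ys|].
      by apply/itv01P; rewrite (simplex_le1 _ ys) andbT; case: ys.
    by apply: continuous_subspaceT; exact: coord_continuous.
  move=> y ys y1; have [yy ysub] := simplex_support ys.
  have /cards1P[c yc] : #|support_face y| == 1%N.
    by rewrite eqn_leq y1; exact: support_face_gt0 ys.
  have : c \in s by apply: (fintype.subsetP ysub); rewrite yc inE.
  rewrite yc in yy; rewrite sab !inE => /orP[] /eqP ce; rewrite (vertexE yy) ce.
    by rewrite eq_sym (negbTE ab) p0; congr f; rewrite ce in yy; exact: (vertex_unique (va isT) yy).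
  by rewrite eqxx p1; congr f; rewrite ce in yy; exact: (vertex_unique (vb isT) yy).
pose h y := if (#|support_face y| <= 1)%N then f y else H (support_face y) y.
have hH s y : s \in skeleton1 L -> simplex R s y -> h y = H s y.
  move=> sL ys; have [_ Hf _] := HP s sL; rewrite /h; case: ifPn => [/Hf->//|y2].
  have [_ ysub] := simplex_support ys; congr H.
  apply/eqP; rewrite eqEcard ysub; apply: leq_trans _ (_ : 2 <= _)%N; last by rewrite ltnNge.
  by move: sL; rewrite inE => /andP[].
exists h; last by move=> s y sL Ps ys; rewrite (hH s)//; case: (HP s sL) => _ _; exact.
apply: (@within_cover _ _ _ (fun s => s \in skeleton1 L) (fun s => simplex R s)) => [s _|s sL|y [s sL ys]].
- exact: simplex_closed.
- by have [cH _ _] := HP s sL; apply: within_ext cH => y /(hH s y sL).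
- by exists s.
Qed.

End GraphExtension.

Lemma cylinderS (R : realType) (S : pontryagin_sequence R) k
    (s t : {set 'I_(tri_size (pd_tri S k))}) :
  s \subset t -> @cylinder R S k s `<=` cylinder t.
Proof. by move=> st x; exact: simplexS. Qed.

Lemma two_group_extensor (R : realType) (S : pontryagin_sequence R)
    (G : groupType) (K : topologicalType) :
  two_group G -> eilenberg_maclane1 R G K ->
  absolute_extensor (pontryagin_disk S) K.
Proof.
move=> tG EM A cA f cf; have [cls clsP] := em_classifier EM.
have [[C] pcK _ _] := EM; have hK := cw_hausdorff C; have [[x0 _] pK] := pcK.
have cf0 : {within A, continuous (valL_ x0 f)}.
  by apply/subspace_valL_continuousP'.
have f0f a : valL_ x0 f (\val a) = f a by exact: (congr1 (fun u : A -> K => u a) (valLK x0 f)).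
set f0 := valL_ x0 f in cf0 f0f.
have [B [f' [oB AB cf' f'f]]] := extension_near C (@pontryagin_disk_hausdorff R S)
  (@pontryagin_disk_compact R S) cA cf0.
(* The neighbourhoods are chosen so that a fine cylinder which meets [A] cannot lie in the
   complement of [A], hence lies in [B], where [f'] is continuous. *)
have [|k kP] := @small_cylinders R S (fun x => if `[< A x >] then B else ~` A).
  move=> x; case: asboolP => Ax; apply: open_nbhs_nbhs; split=> //; first exact: AB.
  exact: closed_openC.
pose tri := pd_tri S k; pose L := tri_complex tri.
pose coords (x : pontryagin_disk S) := tri_coord tri (coord_at k x).
have ccoords : continuous coords := @coords_continuous R S k.
have cL : complex2 L := tri_complexP (t := tri).
have coords_real x : realization R L (coords x) := tri_coord_real tri (coord_at k x).
pose good s := @cylinder R S k s `<=` B.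
have goodA x : A x -> good (support_face (coords x)).
  move=> Ax; have [sL xs] := realization_support cL (coords_real x).
  have [z] := kP k (leqnn k) _ sL x xs; case: asboolP => // _ /(_ x xs).
  by [].
have goodS s (t : {set _}) : good s -> t \subset s -> good t.
  by move=> gs ts x xt; apply: gs; exact: cylinderS xt.
have [j [cj jP]] := skel1_section S k.
have jK x : skel1 (coords x) -> j (coords x) = x.
  move=> kx; apply/esym/(coords_skel1_inj kx).
  by rewrite -[RHS](tri_mapK tri) jP// tri_mapK.
have cB D : D `<=` B -> {within D, continuous f'} by move=> DB; exact: within_at oB DB cf'.
have skelS s : s \in skeleton1 L -> simplex R s `<=` skel1 (L := tri) by move=> sL x xs; exists s.
have [|h ch hf] := graph_extension (P := good) (f := fun y => f' (j y)) cL pcK goodS.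
  move=> s sL gs; apply: (within_comp (f := j) (B := cylinder s)).
  - by move=> y ys; rewrite /cylinder /= jP//; exact: skelS ys.
  - by apply: continuous_subspaceW cj; exact: skelS.
  - exact: cB.
have hf' x s : good s -> cylinder s x -> skel1 (coords x) -> h (coords x) = f' x.
  move=> gs xs kx; have [xx xsub] := simplex_support xs.
  rewrite (hf (support_face (coords x)))//; first by rewrite jK.
    rewrite inE (realization_support cL (coords_real x)).1/=.
    exact/(skel1P (coords_real x)).
  exact: goodS gs xsub.
(* On a good triangle [F] must be [f'] itself and not merely agree on the boundary, since [A] may
   meet the interior of its cylinder. *)
have /choice[F FP] : forall s, exists F : pontryagin_disk S -> K, is_tri (L := tri) s ->
    [/\ {within cylinder s, continuous F},
      forall x, cylinder s x -> simplex_boundary R s (coords x) -> F x = h (coords x)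
    & good s -> F = f'].
  move=> s; have [ts|] := pselect (is_tri (L := tri) s); last by exists f'.
  have [gs|ngs] := pselect (good s).
    exists f' => _; split=> //; first exact: cB.
    by move=> x xs xb; rewrite (hf' x s)//; exact: boundary_skel1 xb.
  have [att [inc [att_disk [collar [attP _ _ _ _]]]]] := pd_step S k.
  have [_ [phi [_ [hphi _ _ _]]]] := attP s ts; have [g' [[cphi _] phiP _]] := hphi.
  have chs : {within simplex_boundary R s, continuous h}.
    by apply: continuous_subspaceW ch => y; exact: boundary_skel1.
  have cl : continuous (fun t => h (phi (circle_point t))).
    apply: (circle_map_continuous (h := fun u => h (phi u))).
    by apply: (within_comp _ cphi chs) => u us; exact: (phiP u us).1.
  have l1 t : h (phi (circle_point (t + 1))) = h (phi (circle_point t)) :> K.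
    by rewrite circle_pointD1.
  (* The exponent may vary with the triangle; there are finitely many triangles to glue over. *)
  have [m tm] := tG (turn cls (fun t => h (phi (circle_point t))) 0).
  have bd : bounds_disk (fun t => h (phi (circle_point t))) (2 ^ m).
    by apply/(bounds_diskP clsP hK cl l1 0) => //; rewrite expn_gt0.
  have [F cF Fh] := extend_cylinder clsP hK ts hphi chs bd.
  by exists F.
pose g x := if (#|support_face (coords x)| <= 2)%N then h (coords x)
  else F (support_face (coords x)) x.
have gF s x : is_tri (L := tri) s -> cylinder s x -> g x = F s x.
  move=> ts xs; have [_ Fh _] := FP s ts; have [sL s3] := ts.
  have xb := simplex_boundaryP s3 xs.
  rewrite /g; case: ifPn => [/xb.2/(Fh x xs)//|x3].
  by rewrite (simplex_interior xs)// => /xb.1; rewrite (negbTE x3).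
exists g.
  apply/within_setT.
  pose D (o : option {set 'I_(tri_size tri)}) : set (pontryagin_disk S) :=
    if o is Some s then cylinder s else coords @^-1` skel1 (L := tri).
  pose P (o : option {set 'I_(tri_size tri)}) : Prop :=
    if o is Some s then is_tri (L := tri) s else True.
  apply: (@within_cover _ _ _ P D) => [[s|] _|[s ts|_]|x _].
  - exact: cylinder_closed.
  - apply: closed_preimage ccoords _; apply: compact_closed; first exact: rV_hausdorff.
    exact: realization_compact.
  - by have [cF _ _] := FP s ts; apply: within_ext cF => x xs; exact/esym/gF.
  - apply: (@within_ext _ _ _ (fun x => h (coords x))).
      by move=> x /(skel1P (coords_real x)); rewrite /g => ->.
    apply: (within_comp (f := coords) _ _ ch) => //.
    exact: continuous_subspaceT.
  - have [x2|x3] := boolP (#|support_face (coords x)| <= 2)%N.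
      by exists None => //=; apply/(skel1P (coords_real x)).
    have [sL sx] := realization_support cL (coords_real x).
    exists (Some (support_face (coords x))) => //; split=> //.
    apply/eqP; rewrite eqn_leq ltnNge x3 andbT.
    by have [/andP[]] := cL _ sL.
move=> a; rewrite -f0f; set x := \val a; have Ax : A x by exact: set_valP.
rewrite -(f'f x Ax); have [sL sx] := realization_support cL (coords_real x).
have gx := goodA x Ax; rewrite /g; case: ifPn => [x2|x3].
  by apply: hf' gx sx _; apply/(skel1P (coords_real x)).
have ts : is_tri (L := tri) (support_face (coords x)).
  split=> //; apply/eqP; rewrite eqn_leq ltnNge x3 andbT.
  by have [/andP[]] := cL _ sL.
by have [_ _ ->] := FP _ ts.
Qed.

Theorem theorem6p1 (R : realType) (S : pontryagin_sequence R)
    (Gamma : groupType)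
    (Gamma_torsion_free : torsion_free Gamma)
    (ab_nontrivial : nontrivial_group (abelianization Gamma))
    (ab_two_group : two_group (abelianization Gamma)) :
  (forall K : topologicalType,
     eilenberg_maclane1 R (abelianization Gamma) K ->
     absolute_extensor (pontryagin_disk S) K) /\
  (forall K : topologicalType,
     eilenberg_maclane1 R Gamma K ->
     ~ absolute_extensor (pontryagin_disk S) K).
Proof.
split=> K EM; first exact: two_group_extensor ab_two_group EM.
apply: torsion_free_not_extensor Gamma_torsion_free _ EM.
(* A nontrivial class in the abelianization lifts to a nontrivial element of the group. *)
have [a a1] := ab_nontrivial; have [x ax] := ab_pi_surj a.
by exists x => x1; apply: a1; rewrite ax x1.
Qed.
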